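(* Let $S_0\in\mathbb{R}^{q\times q}$, $C_0\in\mathbb{R}^{p\times q}$ be constant matrices, and consider the leader system $\dot v_0=S_0v_0$, $y_0=C_0v_0$, with $v_0(t)\in\mathbb{R}^q$, $y_0(t)\in\mathbb{R}^p$. Let $\bar{\mathcal G}$ be a weighted digraph on the node set $\{0,1,\dots,N\}$ with weighted adjacency matrix $[a_{ij}]_{i,j=0}^N$, and assume that $\bar{\mathcal G}$ contains a spanning tree with node $0$ as the root. Let $n$ be the degree of the minimal polynomial of $S_0$, and let $\alpha_0$, $\zeta_0$, $\mathcal{S}_0$, $\mathcal{C}_0$, $\mathcal{P}_0$, $H$, $\bar\delta_{S_0}$, $\underline\delta_H$ be as defined in the context. For $i=1,\dots,N$ consider the systems $$\dot\alpha_i=\mu_\alpha\sum_{j=0}^N a_{ij}(\alpha_j-\alpha_i),\qquad \dot\zeta_i=\mathcal{S}_i\zeta_i+\mu_\zeta\,\mathcal{P}_i\mathcal{C}_0^T\sum_{j=0}^N a_{ij}(y_j-y_i),\qquad y_i=\mathcal{C}_0\zeta_i,$$ where $\alpha_i(t)\in\mathbb{R}^n$, $\zeta_i(t)\in\mathbb{R}^{pn}$, $\mu_\alpha,\mu_\zeta>0$, and $\mathcal{S}_i=\mathcal{S}_i(t)$, $\mathcal{P}_i=\mathcal{P}_i(t)$ are determined by $\alpha_i(t)$ as in the context. If $\mu_\alpha>\bar\delta_{S_0}\,\underline\delta_H^{-1}$ and $\mu_\zeta>\underline\delta_H^{-1}$, then for any $v_0(0)\in\mathbb{R}^q$, $\alpha_i(0)\in\mathbb{R}^n$,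 $\zeta_i(0)\in\mathbb{R}^{pn}$, $i=1,\dots,N$, the solutions $\alpha_i(t)$ and $\zeta_i(t)$ exist for all $t\ge 0$ and satisfy, for every $i=1,\dots,N$, $$\lim_{t\to\infty}(\alpha_i(t)-\alpha_0)=0,\quad \lim_{t\to\infty}(\mathcal{S}_i(t)-\mathcal{S}_0)=0,\quad \lim_{t\to\infty}(\mathcal{P}_i(t)-\mathcal{P}_0)=0,$$ $$\lim_{t\to\infty}(\zeta_i(t)-\zeta_0(t))=0,\quad \lim_{t\to\infty}(y_i(t)-y_0(t))=0.$$
   Context: Graph conventions: $\bar{\mathcal G}=(\bar{\mathcal V},\bar{\mathcal E})$ is a digraph with $\bar{\mathcal V}=\{0,1,\dots,N\}$; node $0$ is the leader and nodes $1,\dots,N$ are the followers. An edge from node $j$ to node $i$ is denoted $(j,i)$. The weighted adjacency matrix $[a_{ij}]$ is real with $a_{ii}=0$ and, for $i\ne j$, $a_{ij}>0$ if $(j,i)\in\bar{\mathcal E}$ and $a_{ij}=0$ otherwise. The digraph contains a spanning tree with node $0$ as the root if every other node is reachable from node $0$ by a directed path. The Laplacian $\bar{\mathcal L}=[l_{ij}]_{i,j=0}^N$ is given by $l_{ii}=\sum_{j=0}^N a_{ij}$ and $l_{ij}=-a_{ij}$ for $i\neq j$. $H\in\mathbb{R}^{N\times N}$ consists of the last $N$ rows and last $N$ columns of $\bar{\mathcal L}$ (those indexed by $1,\dots,N$). For a square matrix $A$ with spectrum $\sigma(A)$, $\bar\delta_A=\max\{\Re(\lambda):\lambda\in\sigma(A)\}$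 and $\underline\delta_A=\min\{\Re(\lambda):\lambda\in\sigma(A)\}$. (Under the spanning tree assumption, $-H$ is Hurwitz, so $\underline\delta_H>0$.) The minimal polynomial of $S_0$ is written $s^n+\alpha_{0,1}s^{n-1}+\dots+\alpha_{0,n-1}s+\alpha_{0,n}$, and $\alpha_0=(\alpha_{0,1},\dots,\alpha_{0,n})^T\in\mathbb{R}^n$ (constant). Let $\zeta_0(t)\in\mathbb{R}^{pn}$ be the stacked column vector of $y_0(t),y_0^{(1)}(t),\dots,y_0^{(n-1)}(t)$, where $y_0^{(k)}=C_0S_0^kv_0$ is the $k$-th time derivative of $y_0$. For $i=0,1,\dots,N$, writing $\alpha_i=(\alpha_{i,1},\dots,\alpha_{i,n})^T$, define $$\mathcal{S}_i=\begin{pmatrix}0&&&\\ \vdots&&I_{n-1}&\\ 0&&&\\ -\alpha_{i,n}&\cdots&-\alpha_{i,2}&-\alpha_{i,1}\end{pmatrix}\otimes I_p\in\mathbb{R}^{pn\times pn},\qquad \mathcal{C}_0=\begin{pmatrix}1&0&\cdots&0\end{pmatrix}\otimes I_p\in\mathbb{R}^{p\times pn},$$ where $\otimes$ is the Kronecker product (the first factor of $\mathcal{S}_i$ is the $n\times n$ companion matrix with ones on the superdiagonal and last row $(-\alpha_{i,n},\dots,-\alpha_{i,1})$). With these definitions $\dot\zeta_0=\mathcal{S}_0\zeta_0$ and $y_0=\mathcal{C}_0\zeta_0$. The pair $(\mathcal{C}_0,\mathcal{S}_i)$ is observable for every value of $\alpha_i\in\mathbb{R}^n$; for $i=0,1,\dots,N$,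 $\mathcal{P}_i$ denotes the unique (symmetric) positive definite solution of the algebraic Riccati equation $$\mathcal{P}_i\mathcal{S}_i^T+\mathcal{S}_i\mathcal{P}_i-\mathcal{P}_i\mathcal{C}_0^T\mathcal{C}_0\mathcal{P}_i+I_{pn}=0.$$ For $i\ge1$, $\mathcal{S}_i$ and $\mathcal{P}_i$ depend on $t$ through $\alpha_i(t)$; $\mathcal{S}_0$ and $\mathcal{P}_0$ are constant. *)

(* Defs.v *)
From HB Require Import structures.
From mathcomp Require Import all_boot all_order all_algebra.
From mathcomp Require Import all_classical all_reals all_analysis.
From mathcomp Require Import complex mxtens.

Set Implicit Arguments.
Unset Strict Implicit.
Unset Printing Implicit Defensive.

Import Order.TTheory GRing.Theory Num.Theory.
Import numFieldNormedType.Exports.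

Local Open Scope classical_set_scope.
Local Open Scope ring_scope.

(** * Weighted digraphs on the nodes 0, ..., N (node 0 is the leader) *)

(* [E j i] means that (j, i) is an edge, directed from j to i; the weight of
   this edge is [a i j]. *)
Definition weighted_adjacency (R : realType) (N : nat)
    (E : rel 'I_N.+1) (a : 'M[R]_N.+1) : Prop :=
  (forall i, a i i = 0) /\
  (forall i j, i != j -> E j i -> 0 < a i j) /\
  (forall i j, i != j -> ~~ E j i -> a i j = 0).

Definition spanning_tree_from_leader (N : nat) (E : rel 'I_N.+1) : Prop :=
  forall i, connect E ord0 i.

Definition laplacian (R : realType) (N : nat) (a : 'M[R]_N.+1) : 'M[R]_N.+1 :=
  \matrix_(i, j) if i == j then \sum_k a i k else - a i j.

Definition follower_laplacian (R : realType) (N : nat) (a : 'M[R]_N.+1) :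
    'M[R]_N :=
  row' ord0 (col' ord0 (laplacian a)).

(** * Spectral quantities *)

Definition spectrum_re (R : realType) (m : nat) (A : 'M[R]_m) : set R :=
  [set complex.Re l | l in
    [set l : R[i] | eigenvalue (map_mx (real_complex R) A) l]].

(* The spectrum is finite, and nonempty when m > 0, so that [sup] and [inf]
   are then a maximum and a minimum. *)
Definition max_re (R : realType) (m : nat) (A : 'M[R]_m) : R :=
  sup (spectrum_re A).

Definition min_re (R : realType) (m : nat) (A : 'M[R]_m) : R :=
  inf (spectrum_re A).

(** * Companion form of the leader *)

(* Indices start at 0: entry k of a coefficient vector is the coefficient
   written alpha_(k+1), which multiplies s^(n-(k+1)). *)
Definition minpoly_coeffs (R : realType) (q n : nat) (S0 : 'M[R]_q.+1) :
    'cV[R]_n :=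
  \col_(k < n) (mxminpoly S0)`_(n - k.+1).

Definition companion (R : realType) (n : nat) (al : 'cV[R]_n) : 'M[R]_n :=
  \matrix_(i, j) if i.+1 == n then - al (rev_ord j) 0
                 else (i.+1 == j :> nat)%:R.

Definition calS (R : realType) (n p : nat) (al : 'cV[R]_n) : 'M[R]_(n * p) :=
  companion al *t (1%:M : 'M[R]_p).

Definition calC (R : realType) (n p : nat) : 'M[R]_(p, n * p) :=
  castmx (mul1n p, erefl (n * p)%N)
    ((\row_(j < n) (j == 0 :> nat)%:R) *t (1%:M : 'M[R]_p)).

(* The column vector obtained by stacking y, y', ..., y^(n-1) for y = C0 v,
   where v' = S0 v, so that y^(k) = C0 S0^k v. *)
Definition stacked_output (R : realType) (q n p : nat) (S0 : 'M[R]_q.+1)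
    (C0 : 'M[R]_(p, q.+1)) (v : 'cV[R]_q.+1) : 'cV[R]_(n * p) :=
  \col_l (C0 *m (S0 ^+ (mxtens_unindex l).1) *m v) (mxtens_unindex l).2 0.

(** * Riccati equation *)

Definition sym_posdef (R : realType) (m : nat) (P : 'M[R]_m) : Prop :=
  P^T = P /\ forall x : 'cV[R]_m, x != 0 -> 0 < (x^T *m P *m x) 0 0.

Definition riccati (R : realType) (m p : nat) (C : 'M[R]_(p, m))
    (S P : 'M[R]_m) : Prop :=
  P *m S^T + S *m P - P *m C^T *m C *m P + 1%:M = 0.

(* Observability of (calC, calS al) makes the selected solution exist and be
   unique, so the default value 0 is never used. *)
Definition calP (R : realType) (n p : nat) (al : 'cV[R]_n) : 'M[R]_(n * p) :=
  xget 0 [set P | sym_posdef P /\ riccati (calC R n p) (calS p al) P].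

(** * Dynamics *)

Definition with_leader (T : Type) (N : nat) (x0 : T) (x : 'I_N -> T)
    (j : 'I_N.+1) : T :=
  if unlift ord0 j is Some k then x k else x0.

(* x' = f on [0, T[. At time 0 only right-continuity is required: as the
   right-hand sides below are continuous in the state, this is the same as
   having the right derivative there. *)
Definition has_velocity (R : realType) (m : nat) (T : \bar R)
    (x f : R -> 'cV[R]_m) : Prop :=
  (x t @[t --> 0^'+] --> x 0) /\
  (forall t : R, 0 < t -> (t%:E < T)%E -> is_derive t 1 x (f t)).

Section ClosedLoop.
Variables (R : realType) (q p n N : nat).
Variables (S0 : 'M[R]_q.+1) (C0 : 'M[R]_(p, q.+1)) (a : 'M[R]_N.+1).
Variables (mu_a mu_z : R).

(* Follower k : 'I_N is the node [lift ord0 k] of the digraph. *)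
Definition coupling (m : nat) (x : 'I_N.+1 -> 'cV[R]_m) (k : 'I_N) : 'cV[R]_m :=
  let i := lift ord0 k in \sum_j a i j *: (x j - x i).

Definition outputs (v : 'cV[R]_q.+1) (zeta : 'I_N -> 'cV[R]_(n * p)) :
    'I_N.+1 -> 'cV[R]_p :=
  with_leader (C0 *m v) (fun k => calC R n p *m zeta k).

Definition solution_on (T : \bar R) (v0 : R -> 'cV[R]_q.+1)
    (alpha : 'I_N -> R -> 'cV[R]_n) (zeta : 'I_N -> R -> 'cV[R]_(n * p)) :
    Prop :=
  [/\ has_velocity T v0 (fun t => S0 *m v0 t),
      forall k, has_velocity T (alpha k) (fun t =>
        mu_a *: coupling
          (with_leader (minpoly_coeffs n S0) (fun l => alpha l t)) k)
    & forall k, has_velocity T (zeta k) (fun t =>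
        calS p (alpha k t) *m zeta k t
        + mu_z *: (calP p (alpha k t) *m (calC R n p)^T
                   *m coupling (outputs (v0 t) (fun l => zeta l t)) k))].

Definition ivp_solution_on (T : \bar R) (v00 : 'cV[R]_q.+1)
    (alpha00 : 'I_N -> 'cV[R]_n) (zeta00 : 'I_N -> 'cV[R]_(n * p))
    (v0 : R -> 'cV[R]_q.+1) (alpha : 'I_N -> R -> 'cV[R]_n)
    (zeta : 'I_N -> R -> 'cV[R]_(n * p)) : Prop :=
  [/\ solution_on T v0 alpha zeta, v0 0 = v00,
      forall k, alpha k 0 = alpha00 k
    & forall k, zeta k 0 = zeta00 k].

End ClosedLoop.

(* Main.v *)
(* The total state is a cascade of linear equations with continuous
   coefficients, so solutions are global and unique by Picard iteration and
   Gronwall's inequality, once P is known to depend continuously on alpha.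

   Riccati equation: X is called a supersolution if it is positive
   semidefinite and P S^T + S P - P C^T C P + I <= 0 at P = X.  Every
   supersolution stabilizes S - X C^T C, so that comparison principles for
   Lyapunov equations apply; a Newton step maps a supersolution to a smaller
   one, and hence a supersolution of least trace is a solution.  Since
   (1 +- e) P are a super- and a subsolution for nearby S, the solution is
   continuous in S.  For the companion matrix a supersolution is obtained by
   scaling the inverse of the Gramian of the shift matrix, which is a signed
   Pascal matrix.

   Convergence: the eigenvalues of H have positive real part by a maximum
   modulus argument along the spanning tree.  A rescaled Schur form turns
   spectral bounds of a real matrix A into quadratic Lyapunov functions
   x^T Q x; this gives the decay of alpha - alpha_0 and the growth of v_0 at
   rates whose product tends to 0.  With Q for H, the function
   tr(E^T Q E P_0^-1) of the stacked error E is a strict Lyapunov function of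
   the nominal error dynamics, and the remaining terms vanish at infinity. *)

Require Import Defs.
From HB Require Import structures.
From mathcomp Require Import all_boot all_order all_algebra.
From mathcomp Require Import all_classical all_reals all_analysis.
From mathcomp Require Import complex mxtens.
From mathcomp Require Import ring lra.

Set Implicit Arguments.
Unset Strict Implicit.
Unset Printing Implicit Defensive.

Import Order.TTheory GRing.Theory Num.Theory.
Import numFieldNormedType.Exports.

Local Open Scope classical_set_scope.
Local Open Scope ring_scope.

(** * Matrix calculus *)

(** The followers carry different, time-dependent S_i and P_i, so the stacked error equation has no
    Kronecker structure. Only the constant pair S_0, P_0 stays in the nominal part; every deviation
    from it is treated as a perturbation. The Lyapunov function then involves P_0 alone, so
    continuity of P in alpha suffices and P is never differentiated.

    Convergence of S_i to S_0 is not enough by itself: the leader may grow exponentially, and (S_i -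
    S_0) zeta_i contains (S_i - S_0) zeta_0. The bound on mu_a makes this product decay; what is
    left is proportional to the error, with a vanishing gain. The bound on mu_z pays for the
    quadratic term of the Riccati equation, which enters the derivative of the Lyapunov function
    with the wrong sign.

    Errors are stored as matrices with one row per follower: H acts on the left, and S_0 acts on the
    right through its transpose. *)

Section MatrixCalculus.
Context {R : realType}.

Lemma normr_mx_le m n (M : 'M[R]_(m, n)) (c : R) : 0 <= c ->
  (`|M| <= c) <-> (forall i j, `|M i j| <= c).
Proof.
move=> c0; rewrite /Num.Def.normr /= mx_normrE; split=> [h i j|h].
  by apply: le_trans h; exact: (le_bigmax _ (fun ij => `|M ij.1 ij.2|) (i, j)).
by apply: bigmax_le => // -[i j] _; exact: h.
Qed.

Lemma normr_entry_le m n (M : 'M[R]_(m, n)) i j : `|M i j| <= `|M|.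
Proof. exact: (normr_mx_le M (normr_ge0 M)).1. Qed.

(** The norm is the largest modulus of an entry, which is not submultiplicative; hence the factor
    given by the inner dimension. *)
Lemma normr_mulmx_le m n p (A : 'M[R]_(m, n)) (B : 'M[R]_(n, p)) :
  `|A *m B| <= n%:R * (`|A| * `|B|).
Proof.
apply/normr_mx_le => [|i j]; first by rewrite !mulr_ge0.
rewrite mxE (le_trans (ler_norm_sum _ _ _)) //.
have -> : n%:R * (`|A| * `|B|) = \sum_(k < n) `|A| * `|B|.
  by rewrite sumr_const card_ord mulr_natl.
by apply: ler_sum => k _; rewrite normrM ler_pM ?normr_entry_le.
Qed.

Lemma normr_trmx m n (A : 'M[R]_(m, n)) : `|A^T| = `|A|.
Proof.
suff le k l (B : 'M[R]_(k, l)) : `|B^T| <= `|B|.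
  by apply/eqP; rewrite eq_le le -{1}[A]trmxK le.
by apply/normr_mx_le => // i j; rewrite mxE normr_entry_le.
Qed.

Lemma normr_mxtrace_le n (A : 'M[R]_n) : `|\tr A| <= n%:R * `|A|.
Proof.
rewrite (le_trans (ler_norm_sum _ _ _)) //.
have -> : n%:R * `|A| = \sum_(k < n) `|A| by rewrite sumr_const card_ord mulr_natl.
by apply: ler_sum => k _; exact: normr_entry_le.
Qed.

Lemma cvg_sum_fin (T : Type) (F : set_system T) {FF : Filter F} (I : finType)
    (f : I -> T -> R) (l : I -> R) :
  (forall i, f i x @[x --> F] --> l i) ->
  \sum_i f i x @[x --> F] --> \sum_i l i.
Proof.
by move=> fl; apply: cvg_big => [|i _]; [exact: add_continuous|exact: fl].
Qed.

Lemma cvg_mxP (T : Type) (F : set_system T) {FF : Filter F} m n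
    (X : T -> 'M[R]_(m, n)) (L : 'M[R]_(m, n)) :
  (X x @[x --> F] --> L) <-> (forall i j, X x i j @[x --> F] --> L i j).
Proof.
split=> [h i j|h].
  apply/cvgrPdist_le => e e0; move/cvgrPdist_le : h => /(_ _ e0) h.
  near=> x; apply: (@le_trans _ _ `|L - X x|); last by near: x.
  by have := normr_entry_le (L - X x) i j; rewrite !mxE.
apply/cvgrPdist_le => e e0; near=> x.
apply/normr_mx_le => [|i j]; first exact: ltW.
rewrite !mxE; move: i j; near: x.
have : \forall x \near F, forall ij : 'I_m * 'I_n,
    `|L ij.1 ij.2 - X x ij.1 ij.2| <= e.
  apply: filter_forall => -[i j] /=.
  by move/cvgrPdist_le : (h i j) => /(_ _ e0).
by apply: filterS => x hx i j; exact: (hx (i, j)).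
Unshelve. all: by end_near. Qed.

Lemma cvg_mulmx (T : Type) (F : set_system T) {FF : Filter F} m n p
    (X : T -> 'M[R]_(m, n)) (Y : T -> 'M[R]_(n, p))
    (A : 'M[R]_(m, n)) (B : 'M[R]_(n, p)) :
  X x @[x --> F] --> A -> Y x @[x --> F] --> B ->
  (X x *m Y x) @[x --> F] --> A *m B.
Proof.
move=> /cvg_mxP XA /cvg_mxP YB; apply/cvg_mxP => i j.
rewrite mxE; under eq_fun do rewrite mxE.
by apply: cvg_sum_fin => k; apply: cvgM; [exact: XA|exact: YB].
Qed.

Lemma cvg_trmx (T : Type) (F : set_system T) {FF : Filter F} m n
    (X : T -> 'M[R]_(m, n)) (A : 'M[R]_(m, n)) :
  X x @[x --> F] --> A -> (X x)^T @[x --> F] --> A^T.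
Proof.
move=> /cvg_mxP XA; apply/cvg_mxP => i j.
by rewrite mxE; under eq_fun do rewrite mxE; exact: XA.
Qed.

Lemma cvg_mxtrace (T : Type) (F : set_system T) {FF : Filter F} n
    (X : T -> 'M[R]_n) (A : 'M[R]_n) :
  X x @[x --> F] --> A -> \tr (X x) @[x --> F] --> \tr A.
Proof. by move=> /cvg_mxP XA; apply: cvg_sum_fin => k; exact: XA. Qed.

Lemma is_derive_mxP m n (X : R -> 'M[R]_(m, n)) (t : R) (D : 'M[R]_(m, n)) :
  is_derive t 1 X D <->
  (forall i j, is_derive t 1 (fun s => X s i j) (D i j)).
Proof.
split=> [[dX <-] i j|h].
  split; first by have /derivable_mxP := dX; exact.
  by rewrite derive_mx // mxE.
have dX : derivable X t 1 by apply/derivable_mxP => i j; case: (h i j).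
split => //; rewrite derive_mx //; apply/matrixP => i j; rewrite mxE.
by case: (h i j).
Qed.

Lemma is_derive_mulmx m n p (X : R -> 'M[R]_(m, n)) (Y : R -> 'M[R]_(n, p))
    (t : R) DX DY : is_derive t 1 X DX -> is_derive t 1 Y DY ->
  is_derive t 1 (fun s => X s *m Y s) (DX *m Y t + X t *m DY).
Proof.
move=> /is_derive_mxP dX /is_derive_mxP dY; apply/is_derive_mxP => i j.
have -> : (fun s => (X s *m Y s) i j) =
    \sum_(k < n) ((fun s => X s i k) * (fun s => Y s k j)).
  by apply/funext => s; rewrite mxE fct_sumE.
rewrite !mxE -big_split /=.
have H k : is_derive t 1 ((fun s => X s i k) * (fun s => Y s k j))
    (DX i k * Y t k j + X t i k * DY k j).
  apply: (is_derive_eq (is_deriveM (dX i k) (dY k j))).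
  by rewrite addrC /GRing.scale /= [DX i k * _]mulrC.
exact: is_derive_sum.
Qed.

Lemma is_derive_trmx m n (X : R -> 'M[R]_(m, n)) (t : R) DX :
  is_derive t 1 X DX -> is_derive t 1 (fun s => (X s)^T) DX^T.
Proof.
move=> /is_derive_mxP dX; apply/is_derive_mxP => i j.
by rewrite mxE; under eq_fun do rewrite mxE; exact: dX.
Qed.

Lemma is_derive_mxtrace n (X : R -> 'M[R]_n) (t : R) DX :
  is_derive t 1 X DX -> is_derive t 1 (fun s => \tr (X s)) (\tr DX).
Proof.
move=> /is_derive_mxP dX.
have -> : (fun s => \tr (X s)) = \sum_(i < n) (fun s => X s i i).
  by apply/funext => s; rewrite fct_sumE.
exact: is_derive_sum.
Qed.

End MatrixCalculus.

(** * Monotonicity, growth and decay from differential inequalities *)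

Section ScalarInequalities.
Context {R : realType}.
Implicit Types f df g h dh : R -> R.

Lemma is_derive1_cvg (V : normedModType R) (f : R -> V) (t : R) (d : V) :
  is_derive t 1 f d -> f s @[s --> t] --> f t.
Proof.
move=> [df _]; have : {for t, continuous f} by
  apply/differentiable_continuous/derivable1_diffP.
exact.
Qed.

(** Right continuity is all that is asked at the left end, because [has_velocity] provides no
    derivative at time 0. *)
Lemma derive_le0_nincr f df (a b : R) : a <= b ->
  f t @[t --> a^'+] --> f a ->
  (forall t, a < t -> t <= b -> is_derive t 1 f (df t) /\ df t <= 0) ->
  f b <= f a.
Proof.
rewrite le_eqVlt => /predU1P[->//|ab] fa fd.
have cf t : a < t -> t <= b -> {for t, continuous f}.
  move=> at_ tb; have [[dft _] _] := fd t at_ tb.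
  exact/differentiable_continuous/derivable1_diffP.
have ab' := ltW ab.
apply: (@ler0_derive1_le_cc _ f a b); rewrite ?bound_itvE //.
- by move=> x; rewrite in_itv /= => /andP[ax xb]; have [[]] := fd x ax (ltW xb).
- move=> x; rewrite in_itv /= => /andP[ax xb].
  by have [[_ dfx] le0] := fd x ax (ltW xb); rewrite derive1E dfx.
- apply/(continuous_within_itvP _ ab); split => //.
  + by move=> x; rewrite in_itv /= => /andP[ax xb]; exact: cf (ltW xb).
  + exact/cvg_at_left_filter/(cf b ab).
Qed.

Lemma derive_le_increment f df h dh (a b : R) : a <= b ->
  f t @[t --> a^'+] --> f a -> h t @[t --> a^'+] --> h a ->
  (forall t, a < t -> t <= b ->
    [/\ is_derive t 1 f (df t), is_derive t 1 h (dh t) & df t <= dh t]) ->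
  f b - f a <= h b - h a.
Proof.
move=> ab fa ha H.
have : (f - h) b <= (f - h) a.
  apply: (@derive_le0_nincr _ (df - dh)) => //; first exact: cvgB.
  move=> t at_ tb; have [? ? le] := H t at_ tb.
  by split; [exact: is_deriveB|rewrite subr_le0].
by rewrite !fctE; lra.
Qed.

Lemma is_derive_expRM (k t : R) :
  is_derive t 1 (fun s => expR (k * s)) (k * expR (k * t)).
Proof.
have d1 : is_derive t 1 (fun s : R => k * s) k.
  by apply: is_derive_eq; rewrite /GRing.scale /= mulr1.
apply: (is_derive_eq (@is_derive1_comp _ expR (fun s => k * s) t (expR (k * t)) k _ _)).
by rewrite mulrC.
Qed.

(** The function f(t) exp(-k t) is nonincreasing. The constant k may be negative, and then this is a
    decay estimate. *)
Lemma gronwall f df (k a b : R) : a <= b ->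
  f t @[t --> a^'+] --> f a ->
  (forall t, a < t -> t <= b -> is_derive t 1 f (df t) /\ df t <= k * f t) ->
  f b <= f a * expR (k * (b - a)).
Proof.
move=> ab fa H.
have : (f * (fun s => expR (- k * s))) b <= (f * (fun s => expR (- k * s))) a.
  apply: (@derive_le0_nincr _ (fun t => expR (- k * t) * (df t - k * f t))) => //.
    apply: cvgM => //; apply: cvg_at_right_filter.
    exact: is_derive1_cvg (is_derive_expRM (- k) a).
  move=> t at_ tb; have [dft le] := H t at_ tb; split.
    apply: (is_derive_eq (is_deriveM dft (is_derive_expRM (- k) t))).
    by rewrite /GRing.scale /=; ring.
  by rewrite mulr_ge0_le0 ?expR_ge0 // subr_le0.
rewrite !fctE /= => le.
have -> : k * (b - a) = - k * a + k * b by ring.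
rewrite expRD mulrA -ler_pdivrMr ?expR_gt0 // -expRN.
by have -> : - (k * b) = - k * b by ring.
Qed.

(* Given e > 0, the function (f - e / 2) exp(k t) is eventually nonincreasing. *)
Lemma cvg0_of_derive_le f df g (k : R) : 0 < k ->
  (forall t : R, 0 < t -> is_derive t 1 f (df t)) ->
  (forall t : R, 0 <= f t) ->
  g t @[t --> +oo] --> (0 : R) ->
  (\forall t \near +oo, df t <= - k * f t + g t) ->
  f t @[t --> +oo] --> (0 : R).
Proof.
move=> k0 fd f0 g0 fg; apply/cvgr0Pnorm_le => e e0.
have e20 : 0 < e / 2 by lra.
have : \forall t \near +oo, 0 < t /\ (g t <= k * (e / 2) /\ df t <= - k * f t + g t).
  near=> t; split; last split; last by near: t.
    by near: t; apply: nbhs_pinfty_gt; exact: num_real.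
  apply: le_trans (ler_norm _) _; near: t.
  by move/cvgr0Pnorm_le : g0; apply; rewrite mulr_gt0.
case=> A [_ HA]; pose a := Num.max (A + 1) 1.
have aA : A < a by rewrite lt_max ltrDl ltr01.
have a0 : 0 < a by rewrite lt_max ltr01 orbT.
have le_f t : a <= t -> f t <= e / 2 + f a * expR (- k * (t - a)).
  move=> at_.
  have : (f - cst (e / 2)) t <= (f - cst (e / 2)) a * expR (- k * (t - a)).
    apply: (@gronwall _ df) => //.
      apply: cvgB; last exact: cvg_cst.
      exact/cvg_at_right_filter/is_derive1_cvg/(fd a a0).
    move=> s as_ st; split.
      have ds := fd s (lt_trans a0 as_).
      by apply: (is_derive_eq (is_deriveB ds (is_derive_cst _ _ _))); rewrite subr0.
    have [_ []] := HA s (lt_trans aA as_).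
    rewrite !fctE /=; lra.
  rewrite !fctE /= mulrBl.
  have : 0 <= e / 2 * expR (- k * (t - a)) by rewrite mulr_ge0 ?expR_ge0 // ltW.
  lra.
near=> t; rewrite ger0_norm //.
apply: le_trans (le_f t _) _; first by near: t; apply: nbhs_pinfty_ge; exact: num_real.
have : f a * expR (- k * (t - a)) <= e / 2; last by lra.
have [->|fa0] := eqVneq (f a) 0; first by rewrite mul0r ltW.
have fap : 0 < f a by rewrite lt_neqAle eq_sym fa0 f0.
rewrite -ler_pdivlMl //.
have -> : - k * (t - a) = - (k * (t - a)) by ring.
rewrite expRN -[leRHS]invrK lef_pV2 ?posrE ?expR_gt0 ?invr_gt0 ?mulr_gt0 ?invr_gt0 //.
apply: le_trans (expR_ge1Dx _).
(* Since 1 + x <= exp x, every t >= X / k + a is late enough. *)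
set X := _^-1; suff : X / k + a <= t by rewrite -lerBrDr ler_pdivrMr //; lra.
by near: t; apply: nbhs_pinfty_ge; exact: num_real.
Unshelve. all: by end_near. Qed.

End ScalarInequalities.

(** * Ordinary differential equations *)

Section LinearGrowthODE.
Context {R : realType}.

(** Freezing the primitive at negative times keeps it continuous on the whole line, as Picard
    iterates have to be, while Lipschitz bounds are needed at nonnegative times only. *)
Lemma scalar_primitive (g : R -> R) : continuous g ->
  exists G : R -> R, [/\ continuous G, forall t, t <= 0 -> G t = 0
    & forall t : R, 0 < t -> is_derive t 1 G (g t)].
Proof.
move=> cg.
(* Integrating from -1 makes 0 an interior point, so F is differentiable and hence continuous
   there. *)
pose F x := (\int[@lebesgue_measure R]_(t in [set` `[(-1 : R), x]]) g t)%R.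
have dF (x : R) : -1 < x -> is_derive x 1 F (g x).
  move=> x1.
  have xu : x < x + 1 by rewrite ltrDl.
  have ig : (@lebesgue_measure R).-integrable `[-1, x + 1] (EFin \o g).
    apply: continuous_compact_integrable; first exact: segment_compact.
    exact: continuous_subspaceT.
  have [dFx Fx] := continuous_FTC1_closed xu ig x1 (cg x).
  by apply: DeriveDef; [exact: dFx|rewrite -derive1E; exact: Fx].
exists (fun t => F (Num.max t 0) - F 0); split.
- move=> t; apply: cvgB; last exact: cvg_cst.
  apply: (@cvg_comp _ _ _ (fun t => Num.max t 0) F _ (nbhs (Num.max t 0))).
    by apply: (@continuous_max _ _ id (cst 0)); [exact: cvg_id|exact: cvg_cst].
  apply/is_derive1_cvg/dF; rewrite lt_max; apply/orP; right.
  by rewrite ltrN10.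
- by move=> t t0; rewrite (max_idPr t0) subrr.
- move=> t t0.
  have d : is_derive t 1 (F - cst (F 0)) (g t).
    have dFt : is_derive t 1 F (g t) by apply: dF; lra.
    by apply: is_derive_eq; rewrite subr0.
  apply: near_eq_is_derive d => //.
  near=> s; rewrite !fctE /=; congr (F _ - _); symmetry; apply/max_idPl/ltW.
  by near: s; exact: lt_nbhsr.
Unshelve. all: by end_near. Qed.

Lemma mx_primitive m n (g : R -> 'M[R]_(m, n)) : continuous g ->
  exists G : R -> 'M[R]_(m, n), [/\ continuous G,
    forall t, t <= 0 -> G t = 0 & forall t : R, 0 < t -> is_derive t 1 G (g t)].
Proof.
move=> cg.
have cgij i j : continuous (fun t => g t i j).
  by move=> t; move/cvg_mxP : (cg t); exact.
have /choice[G HG] : forall ij : 'I_m * 'I_n, exists G : R -> R,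
    [/\ continuous G, forall t, t <= 0 -> G t = 0
      & forall t : R, 0 < t -> is_derive t 1 G (g t ij.1 ij.2)].
  by move=> [i j]; exact: scalar_primitive (cgij i j).
have GE i j : (fun t => (\matrix_(i, j) G (i, j) t) i j) = G (i, j).
  by apply/funext => t; rewrite mxE.
exists (fun t => \matrix_(i, j) G (i, j) t); split.
- move=> t; apply/cvg_mxP => i j; rewrite GE mxE.
  by have [+ _ _] := HG (i, j); exact.
- by move=> t t0; apply/matrixP => i j; rewrite !mxE; have [_ ->] := HG (i, j).
- move=> t t0; apply/is_derive_mxP => i j; rewrite GE.
  by have [_ _ +] := HG (i, j); exact.
Qed.

Lemma mx_increment_le m n (X DX : R -> 'M[R]_(m, n)) (h dh : R -> R) (b : R) :
  0 <= b -> X t @[t --> 0^'+] --> X 0 -> h t @[t --> 0^'+] --> h 0 ->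
  (forall t : R, 0 < t -> t <= b ->
    [/\ is_derive t 1 X (DX t), is_derive t 1 h (dh t) & `|DX t| <= dh t]) ->
  `|X b - X 0| <= h b - h 0.
Proof.
move=> b0 /cvg_mxP X0 h0 H.
(* This is proved apart because the matrix may have no entries. *)
have hb0 : 0 <= h b - h 0.
  have : cst (0 : R) b - cst (0 : R) (0 : R) <= h b - h 0; last by rewrite /= subr0.
  apply: (@derive_le_increment _ (cst 0) (cst 0) h dh) => //; first exact: cvg_cst.
  move=> t t0 tb; have [_ dht le] := H t t0 tb.
  by split; [exact: is_derive_cst|exact: dht|exact: le_trans le].
apply/normr_mx_le => // i j; rewrite !mxE ler_norml; apply/andP; split.
  rewrite lerNl opprB.
  have : (- (fun t => X t i j)) b - (- (fun t => X t i j)) 0 <= h b - h 0.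
    apply: (@derive_le_increment _ _ (fun t => - DX t i j) _ dh) => //.
      exact: (cvgN (X0 i j)).
    move=> t t0 tb; have [/is_derive_mxP/(_ i j) dX dht le] := H t t0 tb.
    split => //; first exact: is_deriveN.
    apply: le_trans le; apply: le_trans (ler_norm _) _.
    by rewrite normrN normr_entry_le.
  by rewrite !fctE; lra.
apply: (@derive_le_increment _ (fun t => X t i j) (fun t => DX t i j) _ dh) => //.
move=> t t0 tb; have [/is_derive_mxP/(_ i j) dX dht le] := H t t0 tb.
split => //; apply: le_trans le; apply: le_trans (ler_norm _) _.
exact: normr_entry_le.
Qed.

Lemma cvg_of_geometric_steps m n (u : nat -> 'M[R]_(m, n)) :
  (exists C, forall k, `|u k.+1 - u k| <= C / 2 ^+ k) -> cvgn u.
Proof.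
move=> [C uC]; suff cu i j : cvgn (fun k => u k i j).
  apply/cvg_ex; exists (\matrix_(i, j) limn (fun k => u k i j)).
  by apply/cvg_mxP => i j; rewrite mxE; exact: cu.
pose v k := u k i j.
have vC k : `|v k.+1 - v k| <= C / 2 ^+ k.
  by apply: le_trans (uC k); have := normr_entry_le (u k.+1 - u k) i j; rewrite !mxE.
have vE k : v k = v 0%N + series (fun k => v k.+1 - v k) k.
  elim: k => [|k IH]; first by rewrite /series /= big_geq // addr0.
  by rewrite seriesSr addrA -IH addrC subrK.
have -> : (fun k => u k i j) = (fun k => v 0%N + series (fun k => v k.+1 - v k) k).
  exact/funext.
apply: is_cvgD; first exact: is_cvg_cst.
apply: normed_cvg; apply: (@series_le_cvg _ _ (geometric C (2^-1))) => //.
- by move=> k; exact: normr_ge0.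
- by move=> k; rewrite /= exprVn; apply: le_trans (vC k); exact: normr_ge0.
- by move=> k; rewrite /= exprVn.
- by apply: is_cvg_geometric_series; rewrite gtr0_norm ?invr_gt0 // invf_lt1 ?ltr1n.
Qed.

Lemma geometric_steps_lim m n (u : nat -> 'M[R]_(m, n)) (C : R) k : 
  (forall k, `|u k.+1 - u k| <= C / 2 ^+ k) ->
  `|limn u - u k| <= 2 * C / 2 ^+ k.
Proof.
move=> uC.
(* The exact geometric sum is kept on the right; the bound 2 C / 2^k alone would not pass through
   the induction on j. *)
have le j : `|u (k + j)%N - u k| <= 2 * C / 2 ^+ k - 2 * C / 2 ^+ (k + j).
  elim: j => [|j IH]; first by rewrite addn0 !subrr normr0.
  rewrite addnS -(subrKA (u (k + j)%N)) (le_trans (ler_normD _ _)) //.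
  rewrite (le_trans (lerD (uC _) IH)) // exprS invfM.
  set a := (2 ^+ (k + j))^-1; set b := (2 ^+ k)^-1.
  by have -> : C * a + (2 * C * b - 2 * C * a) =
       2 * C * b - 2 * C * (2^-1 * a) by field.
have cu : cvgn u by apply: cvg_of_geometric_steps; exists C.
have C0 : 0 <= C by have := le_trans (normr_ge0 _) (uC 0%N); rewrite expr0 divr1.
have -> : limn u - u k = limn (fun j => u (j + k)%N - u k).
  symmetry; apply/cvg_lim => //; apply: cvgB; last exact: cvg_cst.
  by rewrite (cvg_shiftn k).
have cv : cvgn (fun j => u (j + k)%N - u k).
  apply: is_cvgB; last exact: is_cvg_cst.
  by apply/cvg_ex; exists (limn u); rewrite (cvg_shiftn k).
rewrite -lim_norm //; apply: limr_le; first exact: is_cvg_norm.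
apply: nearW => j; rewrite addnC (le_trans (le j)) // lerBlDr lerDl.
by rewrite divr_ge0 ?mulr_ge0 // exprn_ge0.
Qed.

End LinearGrowthODE.

(** * Existence by Picard iteration and uniqueness by Gronwall's inequality *)

Section Picard.
Context {R : realType} {m n : nat}.
Implicit Types X Y : R -> 'M[R]_(m, n).

(* The derivative at 0 is not claimed: [X] is constant on negative times. *)
Lemma lipschitz_ode_exists (F : R -> 'M[R]_(m, n) -> 'M[R]_(m, n))
    (x0 : 'M[R]_(m, n)) :
  (forall X, continuous X -> continuous (fun t => F t (X t))) ->
  (forall T : R, exists L : R, forall (t : R) (x y : 'M[R]_(m, n)), 0 <= t <= T ->
    `|F t x - F t y| <= L * `|x - y|) ->
  exists X, [/\ continuous X, X 0 = x0
    & forall t : R, 0 < t -> is_derive t 1 X (F t (X t))].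
Proof.
move=> cF lF.
(* The choice principle needs a primitive operator defined on all functions; it takes the junk value
   0 at discontinuous ones. *)
have /choice[I HI] : forall g : R -> 'M[R]_(m, n), exists G : R -> 'M[R]_(m, n),
    continuous g -> [/\ continuous G, forall t : R, t <= 0 -> G t = 0
      & forall t : R, 0 < t -> is_derive t 1 G (g t)].
  move=> g; have [/mx_primitive[G HG]|] := pselect (continuous g).
    by exists G.
  by exists 0.
pose step X := fun t => x0 + I (fun s => F s (X s)) t.
pose Xs k : R -> 'M[R]_(m, n) := iter k step (cst x0).
have cstep X : continuous X -> continuous (step X).
  by move=> /cF /HI[cI _ _] t; apply: cvgD; [exact: cvg_cst|exact: cI].
have step0 X (t : R) : continuous X -> t <= 0 -> step X t = x0.
  by move=> /cF /HI[_ I0 _] t0; rewrite /step I0 // addr0.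
have dstep X (t : R) : continuous X -> 0 < t -> is_derive t 1 (step X) (F t (X t)).
  move=> /cF /HI[_ _ dI] t0.
  have dIt := dI t t0.
  by apply: (is_derive_eq (is_deriveD (is_derive_cst x0 t 1) dIt)); rewrite add0r.
have cXs k : continuous (Xs k).
  elim: k => [|k IH]; last exact: cstep.
  by move=> t; exact: cvg_cst.
have lF' (T : R) : exists2 L : R, 0 < L &
    forall (t : R) (x y : 'M[R]_(m, n)), 0 <= t <= T ->
    `|F t x - F t y| <= L * `|x - y|.
  have [L HL] := lF T; exists (Num.max L 1); first by rewrite lt_max ltr01 orbT.
  move=> t x y /HL h; apply: le_trans (h x y) _.
  by rewrite ler_wpM2r // le_max lexx.
(* Bielecki's weighted norm: relative to the weight exp(k t), the step has Lipschitz constant L / k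
   on all of [0, T]. With k = 2 L it contracts by 1/2; the passage to the limit below uses k = L. *)
have stepB (T L : R) X Y (C k : R) : 0 < k ->
    (forall (t : R) (x y : 'M[R]_(m, n)), 0 <= t <= T ->
      `|F t x - F t y| <= L * `|x - y|) ->
    0 < L -> continuous X -> continuous Y ->
    (forall t : R, 0 <= t <= T -> `|X t - Y t| <= C * expR (k * t)) ->
    forall t : R, 0 <= t <= T -> `|step X t - step Y t| <= L / k * C * expR (k * t).
  move=> k0 HL L0 cX cY XY b /andP[b0 bT].
  have : `|(step X b - step Y b) - (step X 0 - step Y 0)| <=
      L / k * C * expR (k * b) - L / k * C * expR (k * 0).
    apply: (@mx_increment_le _ _ _ (fun t => step X t - step Y t)
      (fun t => F t (X t) - F t (Y t)) (fun t => L / k * C * expR (k * t))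
      (fun t => L * (C * expR (k * t)))) => //.
    - by apply: cvg_at_right_filter; apply: cvgB; exact: cstep.
    - apply: cvg_at_right_filter; apply: cvgM; first exact: cvg_cst.
      exact: is_derive1_cvg (is_derive_expRM k 0).
    move=> t t0 tb; have tT : 0 <= t <= T by rewrite (ltW t0) (le_trans tb).
    split.
    - by have dX := dstep X t cX t0; have dY := dstep Y t cY t0; exact: is_deriveB.
    - have dE := is_derive_expRM k t.
      have -> : (fun t => L / k * C * expR (k * t)) =
          (L / k * C) *: (fun t => expR (k * t)) by [].
      apply: is_derive_eq; rewrite /GRing.scale /=.
      by field; rewrite gt_eqF.
    - by rewrite (le_trans (HL _ _ _ tT)) // ler_wpM2l ?XY // ltW.
  rewrite (step0 X 0) // (step0 Y 0) // subrr subr0 => h; apply: le_trans h _.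
  rewrite lerBlDr lerDl mulr_ge0 ?expR_ge0 // mulr_ge0 ?divr_ge0 ?(ltW k0) ?(ltW L0) //.
  have := XY b; rewrite b0 bT => /(_ isT) /(le_trans (normr_ge0 _)).
  by rewrite pmulr_lge0 // expR_gt0.
have Xs_le (T : R) : exists C : R, forall (t : R) k, t <= T ->
    `|Xs k.+1 t - Xs k t| <= C / 2 ^+ k.
  have [L L0 HL] := lF' T.
  have [M HM] : exists M : R, forall t : R, 0 <= t <= T -> `|Xs 1%N t - Xs 0%N t| <= M.
    have [T0|T0] := leP 0 T; last first.
      by exists 0 => t /andP[t0 /(le_trans t0)]; rewrite leNgt T0.
    have [||c _ Hc] := @EVT_max R (fun t => `|Xs 1%N t - Xs 0%N t|) 0 T => //.
      apply: continuous_subspaceT => t; apply: cvg_norm.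
      by apply: cvgB; exact: cXs.
    by exists (`|Xs 1%N c - Xs 0%N c|) => t tT; apply: Hc; rewrite in_itv.
  have H k (t : R) : 0 <= t <= T ->
      `|Xs k.+1 t - Xs k t| <= M / 2 ^+ k * expR (2 * L * t).
    elim: k t => [|k IH] t tT.
      have tT' := tT; case/andP: tT' => t0 _.
      rewrite expr0 divr1 (le_trans (HM t tT)) //.
      rewrite ler_peMr ?(le_trans (normr_ge0 _) (HM t tT)) //.
      by rewrite -expR0 ler_expR !mulr_ge0 // ltW.
    have := @stepB T L (Xs k.+1) (Xs k) (M / 2 ^+ k) (2 * L).
    rewrite mulr_gt0 // => /(_ isT HL L0 (cXs _) (cXs _) IH t tT) h.
    apply: le_trans h _; rewrite exprS invfM le_eqVlt; apply/orP; left; apply/eqP.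
    by field; rewrite expf_neq0 ?gt_eqF.
  exists (`|M| * expR (2 * L * T)) => t k tT.
  have [t0|t0] := leP t 0.
    have Xs0 j : Xs j t = x0 by case: j => [//|j]; rewrite /= step0.
    by rewrite !Xs0 subrr normr0 divr_ge0 ?mulr_ge0 ?expR_ge0 // exprn_ge0.
  rewrite (le_trans (H k t _)) ?(ltW t0) // mulrAC ler_pM2r ?invr_gt0 ?exprn_gt0 //.
  apply: (@le_trans _ _ (`|M| * expR (2 * L * t))).
    by rewrite ler_wpM2r ?expR_ge0 ?ler_norm.
  by rewrite ler_wpM2l // ler_expR ler_wpM2l // mulr_ge0 // ltW.
pose X t := limn (fun k => Xs k t).
have X_le (T : R) : exists C : R, forall (t : R) k, t <= T ->
    `|X t - Xs k t| <= C / 2 ^+ k.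
  have [C HC] := Xs_le T; exists (2 * C) => t k tT.
  by apply: geometric_steps_lim => j; exact: HC.
have pow2 (C e : R) : 0 < e -> exists k, C / 2 ^+ k <= e.
  move=> e0; have : C / 2 ^+ k @[k --> \oo] --> C * 0.
    under eq_fun do rewrite -exprVn.
    apply: cvgM; first exact: cvg_cst.
    by apply: cvg_expr; rewrite gtr0_norm ?invr_gt0 // invf_lt1 ?ltr1n.
  rewrite mulr0 => /cvgr0Pnorm_le /(_ _ e0)[k _ /(_ k (leqnn k))] h.
  by exists k; apply: le_trans h; exact: ler_norm.
have cX : continuous X.
  move=> t; apply/cvgrPdist_le => e e0.
  have [C HC] := X_le (t + 1); have e30 : 0 < e / 3 by rewrite divr_gt0.
  have [k Hk] := pow2 C (e / 3) e30.
  near=> s.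
  have st : s <= t + 1 by apply/ltW; near: s; apply: lt_nbhsl; rewrite ltrDl.
  have h1 : `|X t - Xs k t| <= e / 3 by rewrite (le_trans (HC _ _ _)) // lerDl.
  have h2 : `|X s - Xs k s| <= e / 3 by rewrite (le_trans (HC _ _ _)).
  have h3 : `|Xs k t - Xs k s| <= e / 3.
    by near: s; move/cvgrPdist_le : (cXs k t); exact.
  have -> : X t - X s = (X t - Xs k t) + ((Xs k t - Xs k s) - (X s - Xs k s)).
    by apply/matrixP => i j; rewrite !mxE; ring.
  rewrite (le_trans (ler_normD _ _)) // (le_trans (lerD (lexx _) (ler_normB _ _))) //.
  lra.
(* Both sides are close to the iterate [Xs k.+1], which is [step (Xs k)]. *)
have XE : X = step X.
  apply/funext => b; have [b0|b0] := leP b 0.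
    rewrite step0 // /X; apply/cvg_lim => //; apply: cvg_near_cst.
    by exists 1%N => // -[//|k] _; rewrite /= step0.
  apply/eqP; rewrite -subr_eq0 -normr_le0; apply/ler_addgt0Pl => e e0.
  rewrite addr0; have [C HC] := X_le b; have [L L0 HL] := lF' b.
  have C0 : 0 <= C.
    by have := le_trans (normr_ge0 _) (HC b 0%N (lexx b)); rewrite expr0 divr1.
  have [k Hk] := pow2 (C / 2 + C * expR (L * b)) e e0.
  have h1 := HC b k.+1 (lexx b).
  have h2 : `|step X b - step (Xs k) b| <= L / L * (C / 2 ^+ k) * expR (L * b).
    apply: (@stepB b L) => //; last by rewrite (ltW b0) lexx.
    move=> t /andP[t0 tb]; rewrite (le_trans (HC _ _ tb)) //.
    rewrite ler_peMr ?divr_ge0 ?exprn_ge0 //.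
    by rewrite -expR0 ler_expR mulr_ge0 // ltW.
  have -> : X b - step X b = (X b - Xs k.+1 b) - (step X b - step (Xs k) b).
    have -> : Xs k.+1 b = step (Xs k) b by [].
    move: (X b) (step X b) (step (Xs k) b) => u v w.
    by apply/matrixP => i j; rewrite !mxE; ring.
  rewrite (le_trans (ler_normB _ _)) // (le_trans (lerD h1 h2)) //.
  apply: le_trans Hk; rewrite divff ?gt_eqF // mul1r exprS invfM.
  by rewrite mulrDl mulrA [C * expR _ / _]mulrAC.
exists X; split => //; first by rewrite XE step0.
by move=> t t0; rewrite {1}XE; exact: dstep.
Unshelve. all: by end_near. Qed.

(** Gronwall's inequality is applied to tr(D^T D) for the difference D of the solutions, a
    differentiable majorant of the squared norm. *)
Lemma lipschitz_ode_unique (F : R -> 'M[R]_(m, n) -> 'M[R]_(m, n)) X Y (T : R) :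
  X t @[t --> 0^'+] --> X 0 -> Y t @[t --> 0^'+] --> Y 0 -> X 0 = Y 0 ->
  (exists L : R, forall (t : R) (x y : 'M[R]_(m, n)), 0 <= t <= T ->
    `|F t x - F t y| <= L * `|x - y|) ->
  (forall t : R, 0 < t -> t <= T -> is_derive t 1 X (F t (X t))) ->
  (forall t : R, 0 < t -> t <= T -> is_derive t 1 Y (F t (Y t))) ->
  0 <= T -> X T = Y T.
Proof.
move=> X0 Y0 XY0 [L HL] dX dY T0.
pose D t := X t - Y t; pose DD t := F t (X t) - F t (Y t).
have dD (t : R) : 0 < t -> t <= T -> is_derive t 1 D (DD t).
  by move=> t0 tT; have ? := dX t t0 tT; have ? := dY t t0 tT; exact: is_deriveB.
pose V t := \tr ((D t)^T *m D t).
pose dV t := \tr ((DD t)^T *m D t + (D t)^T *m DD t).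
have trE (A B : 'M[R]_(m, n)) : \tr (A^T *m B) = \sum_j \sum_i A i j * B i j.
  by apply: eq_bigr => j _; rewrite mxE; apply: eq_bigr => i _; rewrite mxE.
have V_ge (t : R) : `|D t| ^+ 2 <= V t.
  have [D0|/mx_norm_neq0[[i j] /= E]] := eqVneq (mx_norm (D t)) 0.
    have -> : `|D t| = 0 by exact: D0.
    rewrite expr2 mulr0 /V trE; apply: sumr_ge0 => j _; apply: sumr_ge0 => i _.
    by rewrite -expr2 sqr_ge0.
  have -> : `|D t| = `|D t i j| by exact: E.
  rewrite /V trE (bigD1 j) //= (bigD1 i) //= real_normK ?num_real //.
  have sq_ge0 (x : R) : 0 <= x * x by rewrite -expr2 sqr_ge0.
  rewrite -addrA -expr2 lerDl addr_ge0 //; first by apply: sumr_ge0 => k _.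
  by apply: sumr_ge0 => l _; apply: sumr_ge0 => k _.
have dV_le (t : R) : 0 <= t <= T -> dV t <= (2 * (n%:R * (m%:R * `|L|))) * V t.
  move=> tT; rewrite /dV mxtraceD -[X in X + _]mxtrace_tr trmx_mul trmxK.
  have h : \tr ((D t)^T *m DD t) <= n%:R * (m%:R * `|L|) * V t.
    apply: le_trans (ler_norm _) _; apply: le_trans (normr_mxtrace_le _) _.
    rewrite -mulrA ler_wpM2l //; apply: le_trans (normr_mulmx_le _ _) _.
    rewrite -mulrA ler_wpM2l // normr_trmx.
    apply: (@le_trans _ _ (`|D t| * (`|L| * `|D t|))).
      rewrite ler_wpM2l // (le_trans (HL _ _ _ tT)) // ler_wpM2r //.
      exact: ler_norm.
    by rewrite mulrCA ler_wpM2l // -expr2.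
  lra.
have V0 : V 0 = 0 by rewrite /V /D XY0 subrr mulmx0 mxtrace0.
have : V T <= V 0 * expR ((2 * (n%:R * (m%:R * `|L|))) * (T - 0)).
  apply: (@gronwall _ V dV) => //.
    apply: cvg_mxtrace; apply: cvg_mulmx; [apply: cvg_trmx|]; exact: cvgB.
  move=> t t0 tT; have dDt := dD t t0 tT; split.
    apply: is_derive_mxtrace; apply: is_derive_mulmx => //.
    exact: is_derive_trmx.
  by apply: dV_le; rewrite (ltW t0).
rewrite V0 mul0r => VT; apply/eqP; rewrite -subr_eq0 -normr_eq0 -sqrf_eq0.
by rewrite eq_le sqr_ge0 andbT; exact: le_trans (V_ge T) VT.
Qed.

End Picard.

(** * Quadratic forms and Lyapunov equations *)

Section QuadraticForms.
Context {R : realType}.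

Definition qform m (A : 'M[R]_m) (x : 'cV[R]_m) : R := (x^T *m A *m x) 0 0.

Lemma qformD m (A B : 'M[R]_m) x : qform (A + B) x = qform A x + qform B x.
Proof. by rewrite /qform mulmxDr mulmxDl mxE. Qed.

Lemma qformN m (A : 'M[R]_m) x : qform (- A) x = - qform A x.
Proof. by rewrite /qform mulmxN mulNmx mxE. Qed.

Lemma qformB m (A B : 'M[R]_m) x : qform (A - B) x = qform A x - qform B x.
Proof. by rewrite qformD qformN. Qed.

Lemma qformZ m a (A : 'M[R]_m) x : qform (a *: A) x = a * qform A x.
Proof. by rewrite /qform -scalemxAr -scalemxAl mxE. Qed.

Lemma qform0 m (x : 'cV[R]_m) : qform 0 x = 0.
Proof. by rewrite /qform mulmx0 mul0mx mxE. Qed.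

Lemma qform_scale m a (A : 'M[R]_m) x : qform A (a *: x) = a ^+ 2 * qform A x.
Proof.
by rewrite /qform -scalemxAr linearZ /= -!scalemxAl scalerA mxE expr2.
Qed.

Lemma qform_tr m (A : 'M[R]_m) x : qform A^T x = qform A x.
Proof.
have -> : qform A x = (x^T *m A *m x)^T 0 0 by rewrite mxE.
by rewrite !trmx_mul trmxK mulmxA.
Qed.

Lemma qform_congr m n (A : 'M[R]_m) (B : 'M[R]_(m, n)) x :
  qform (B^T *m A *m B) x = qform A (B *m x).
Proof. by rewrite /qform trmx_mul !mulmxA. Qed.

Lemma qform1E m (x : 'cV[R]_m) : qform 1%:M x = \sum_i x i 0 ^+ 2.
Proof. by rewrite /qform mulmx1 mxE; apply: eq_bigr => i _; rewrite mxE expr2. Qed.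

Lemma qform1_ge0 m (x : 'cV[R]_m) : 0 <= qform 1%:M x.
Proof. by rewrite qform1E sumr_ge0 // => i _; exact: sqr_ge0. Qed.

Lemma qform1_eq0 m (x : 'cV[R]_m) : qform 1%:M x = 0 -> x = 0.
Proof.
rewrite qform1E => /eqP; rewrite psumr_eq0 => [/allP h|i _]; last exact: sqr_ge0.
apply/colP => i; rewrite mxE; apply/eqP; rewrite -sqrf_eq0.
by have := h i (mem_index_enum i).
Qed.

Lemma qform1_gt0 m (x : 'cV[R]_m) : x != 0 -> 0 < qform 1%:M x.
Proof.
move=> x0; rewrite lt_neqAle qform1_ge0 andbT eq_sym.
by apply: contra_neq x0; exact: qform1_eq0.
Qed.

Lemma qform_gram m n (B : 'M[R]_(m, n)) x : qform (B^T *m B) x = qform 1%:M (B *m x).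
Proof. by rewrite -qform_congr mulmx1. Qed.

Lemma qform_gram_ge0 m n (B : 'M[R]_(m, n)) x : 0 <= qform (B^T *m B) x.
Proof. by rewrite qform_gram qform1_ge0. Qed.

(** With y = M x, the form at x - t y equals t^2 q(y) - 2 t |y|^2, which is negative for small t > 0
    unless y = 0. *)
Lemma psd_null m (M : 'M[R]_m) x : M^T = M -> (forall y, 0 <= qform M y) ->
  qform M x = 0 -> M *m x = 0.
Proof.
move=> Ms Mp Mx; apply: qform1_eq0; set y := M *m x; set a := qform _ y.
have a0 : 0 <= a := qform1_ge0 y.
have H (t : R) : 0 <= t ^+ 2 * qform M y - 2 * t * a.
  have := Mp (x - t *: y).
  have yT : (x - t *: y)^T = x^T - t *: y^T by rewrite linearB /= linearZ.
  rewrite /qform yT !mulmxBl !mulmxBr.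
  rewrite -!scalemxAl -!scalemxAr.
  have e1 : x^T *m M *m y = y^T *m y by rewrite /y trmx_mul Ms.
  have e2 : y^T *m M *m x = y^T *m y by rewrite -mulmxA.
  rewrite e1 e2; move: Mx; rewrite /qform => Mx.
  rewrite !mxE in Mx *; rewrite Mx /a /qform mulmx1 !mxE.
  set u := \sum_j _; set v := \sum_j _ ; lra.
set b := qform M y in H; have b0 : 0 <= b := Mp y.
apply/eqP; rewrite eq_le a0 andbT leNgt; apply/negP => ap.
have b1 : 0 < b + 1 by rewrite ltr_wpDl.
(* The divisor b + 1 stands for b, which may vanish. *)
have := H (a / (b + 1)).
have -> : (a / (b + 1)) ^+ 2 * b - 2 * (a / (b + 1)) * a =
   - (a ^+ 2 * (b + 2)) / (b + 1) ^+ 2 by field; rewrite gt_eqF.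
by rewrite mulNr oppr_ge0 leNgt divr_gt0 ?mulr_gt0 ?exprn_gt0 // ltr_wpDl.
Qed.

Lemma qform_delta m (A : 'M[R]_m) i (e := delta_mx i 0 : 'cV[R]_m) :
  qform A e = A i i.
Proof. by rewrite /qform /e trmx_delta -rowE -colE !mxE. Qed.

Lemma qform_delta2 m (A : 'M[R]_m) i j (s : R) : A^T = A ->
  qform A (delta_mx i 0 + s *: delta_mx j 0) = A i i + 2 * s * A i j + s ^+ 2 * A j j.
Proof.
move=> As.
have eT : (delta_mx i 0 + s *: delta_mx j 0 : 'cV[R]_m)^T =
    delta_mx 0 i + s *: delta_mx 0 j.
  by rewrite linearD /= linearZ /= !trmx_delta.
rewrite /qform eT !mulmxDl !mulmxDr -!scalemxAl -!scalemxAr -!rowE -!colE !mxE.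
have -> : A j i = A i j by rewrite -[in LHS]As mxE.
ring.
Qed.

(** Polarization at e_i + e_j and e_i - e_j gives |D_ij| <= (P_ii + P_jj) / 2. Comparisons of
    quadratic forms thus become entrywise bounds. *)
Lemma mx_entry_le_mxtrace m (D P : 'M[R]_m) i j : D^T = D -> P^T = P ->
  (forall x, `|qform D x| <= qform P x) -> `|D i j| <= \tr P.
Proof.
move=> Ds Ps H.
have Pp k : 0 <= P k k by rewrite -qform_delta (le_trans (normr_ge0 _) (H _)).
have trP : (P i i + P j j) / 2 <= \tr P.
  have le k : P k k <= \tr P.
    by rewrite /mxtrace (bigD1 k) //= lerDl sumr_ge0.
  by have := le i; have := le j; lra.
apply: le_trans trP.
have := H (delta_mx i 0 + 1 *: delta_mx j 0).
have := H (delta_mx i 0 + (-1) *: delta_mx j 0).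
rewrite !qform_delta2 // !ler_norml => /andP[h1 h2] /andP[h3 h4].
apply/andP; split; lra.
Qed.

Lemma qform_eq0_sym m (D : 'M[R]_m) : D^T = D -> (forall x, qform D x = 0) -> D = 0.
Proof.
move=> Ds H; apply/matrixP => i j; rewrite mxE; apply/eqP; rewrite -normr_le0.
rewrite -(mxtrace0 R m); apply: mx_entry_le_mxtrace; rewrite ?trmx0 // => x.
by rewrite H normr0 qform0.
Qed.

Lemma continuous_vec_mx m n : continuous (vec_mx : 'rV[R]_(m * n) -> 'M[R]_(m, n)).
Proof.
move=> v; apply/(@cvg_mxP _ _ (nbhs v) (nbhs_filter v)) => i j.
rewrite mxE; under eq_fun do rewrite mxE.
exact: coord_continuous.
Qed.

(** Heine-Borel, transported from row vectors by [vec_mx]. *)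
Lemma mx_bounded_closed_compact m n (A : set 'M[R]_(m, n)) (M : R) :
  (forall X, A X -> `|X| <= M) -> closed A -> compact A.
Proof.
move=> bA cA.
have -> : A = vec_mx @` (vec_mx @^-1` A).
  apply/seteqP; split => [X AX|_ [v Av <-] //].
  by exists (mxvec X); rewrite /= mxvecK.
apply: continuous_compact.
  exact/continuous_subspaceT/continuous_vec_mx.
apply: bounded_closed_compact.
  exists `|M|; split; first exact: num_real.
  move=> x Mx v Av; apply/ltW; apply: le_lt_trans Mx.
  apply/normr_mx_le => // i j; rewrite ord1.
  case/mxvec_indexP: j => k l.
  have -> : v 0 (mxvec_index k l) = (vec_mx v : 'M[R]_(m, n)) k l by rewrite mxE.
  by rewrite (le_trans (normr_entry_le _ _ _)) // (le_trans (bA _ Av)) // ler_norm.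
by apply: preimage_closed => // v _; exact: continuous_vec_mx.
Qed.

(** The ratio q / p is invariant under scaling, so its maximum over the compact unit sphere is a
    maximum over all nonzero X; [X1] shows that the sphere is nonempty. *)
Lemma max_rayleigh m n (q p : 'M[R]_(m, n) -> R) (X1 : 'M[R]_(m, n)) :
  continuous q -> continuous p ->
  (forall a X, q (a *: X) = a ^+ 2 * q X) ->
  (forall a X, p (a *: X) = a ^+ 2 * p X) ->
  (forall X, X != 0 -> 0 < p X) -> X1 != 0 ->
  exists c X0, [/\ X0 != 0, q X0 = c * p X0 & forall Y, q Y <= c * p Y].
Proof.
move=> cq cp hq hp p0 X10.
pose S := [set X : 'M[R]_(m, n) | `|X| = 1].
have nS X : X != 0 -> S (`|X|^-1 *: X).
  by move=> X0; rewrite /S /= normrZ normfV normr_id mulVf // normr_eq0.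
have S0 X : S X -> X != 0.
  by move=> SX; rewrite -normr_eq0 SX oner_neq0.
have [|||c Sc Hc] := @compact_EVT_max _ R (fun X => q X / p X) S.
- by exists (`|X1|^-1 *: X1); exact: nS.
- apply: (@mx_bounded_closed_compact _ _ _ 1) => [X ->//|].
  have -> : S = (fun X : 'M[R]_(m, n) => `|X|) @^-1` [set x | x = 1] by [].
  by apply: preimage_closed => [X _|]; [exact: norm_continuous|exact: closed_eq].
- apply/continuous_in_subspaceT => X /set_mem SX.
  apply: (@cvgM _ _ _ (nbhs_filter X)); first exact: (cq X).
  by apply: (@cvgV _ _ _ (nbhs_filter X)); [rewrite gt_eqF ?p0 ?S0|exact: (cp X)].
move: Sc => /set_mem Sc.
have pc := p0 _ (S0 _ Sc).
exists (q c / p c), c; split; first exact: S0.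
- by rewrite divfK // gt_eqF.
move=> Y; have [->|Y0] := eqVneq Y 0.
  have -> : (0 : 'M[R]_(m, n)) = 0 *: 0 by rewrite scale0r.
  by rewrite hq hp expr2 !mul0r mulr0.
have := Hc _ (mem_set (nS _ Y0)).
rewrite hq hp -mulf_div divff ?mul1r; last first.
  by rewrite sqrf_eq0 invr_eq0 normr_eq0.
by rewrite ler_pdivrMr // p0.
Qed.

(** The constant is the inverse of the maximum of |X|^2 / p(X). It turns estimates of Lyapunov
    functions into estimates of norms. *)
Lemma coercive m n (p : 'M[R]_(m, n) -> R) : continuous p ->
  (forall a X, p (a *: X) = a ^+ 2 * p X) ->
  (forall X, X != 0 -> 0 < p X) ->
  exists2 c, 0 < c & forall X, c * `|X| ^+ 2 <= p X.
Proof.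
move=> cp hp p0.
have [[X1 X10]|] := pselect (exists X : 'M[R]_(m, n), X != 0).
  have [||c [X0 [X00 E H]]] := @max_rayleigh m n (fun X => `|X| ^+ 2) p X1 _ cp _ hp p0 X10.
  - have -> : (fun X : 'M[R]_(m, n) => `|X| ^+ 2) = (fun X => `|X| * `|X|) by [].
    by move=> X; apply: (@cvgM _ _ _ (nbhs_filter X)); exact: (@norm_continuous _ _ X).
  - by move=> a X; rewrite normrZ exprMn real_normK ?num_real.
  have c0 : 0 < c.
    have : 0 < c * p X0 by rewrite -E exprn_gt0 // normr_gt0.
    by rewrite pmulr_lgt0 // p0.
  exists c^-1; rewrite ?invr_gt0 // => X.
  by rewrite ler_pdivrMl.
move=> nex; exists 1 => // X.
have -> : X = 0 by apply/eqP/negP => /negP X0; apply: nex; exists X.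
have -> : (0 : 'M[R]_(m, n)) = 0 *: 0 by rewrite scale0r.
by rewrite hp scale0r normr0 expr2 !mulr0 mul0r.
Qed.

Lemma continuous_qform m (A : 'M[R]_m) : continuous (qform A).
Proof.
move=> x; have FF := nbhs_filter x.
have c : (y^T *m A *m y) @[y --> x] --> x^T *m A *m x.
  apply: (@cvg_mulmx R _ _ FF); last exact: cvg_id.
  apply: (@cvg_mulmx R _ _ FF); last exact: cvg_cst.
  by apply: (@cvg_trmx R _ _ FF); exact: cvg_id.
exact: (proj1 (@cvg_mxP R _ _ FF _ _ _ _) c).
Qed.

(** * Comparison and solvability for Lyapunov equations with a certificate P *)

Section Lyapunov.
Context {m : nat}.
Variables (F P : 'M[R]_m).
Hypotheses (P_gt0 : forall x, x != 0 -> 0 < qform P x) (Ps : P^T = P).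
Hypothesis FP : forall x, x != 0 -> qform (F *m P + P *m F^T) x < 0.

(* For the least c with D <= c P, a null vector of c P - D would contradict
   F P + P F^T < 0 unless c <= 0. *)
Lemma lyapunov_comparison (D : 'M[R]_m) : D^T = D ->
  (forall x, 0 <= qform (F *m D + D *m F^T) x) -> forall x, qform D x <= 0.
Proof.
move=> Ds FD x1; rewrite leNgt; apply/negP => Dx1.
have x10 : x1 != 0.
  by apply/eqP => x10; move: Dx1; rewrite x10 /qform mulmx0 mxE ltxx.
have [c [x0 [x00 E H]]] := max_rayleigh (@continuous_qform m D)
  (@continuous_qform m P) (fun a X => qform_scale a D X)
  (fun a X => qform_scale a P X) P_gt0 x10.
have c0 : 0 < c.
  by have := lt_le_trans Dx1 (H x1); rewrite pmulr_lgt0 // P_gt0.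
have Ms : (c *: P - D)^T = c *: P - D by rewrite linearB /= linearZ /= Ps Ds.
have Mx0 : (c *: P - D) *m x0 = 0.
  apply: psd_null => //.
    by move=> y; rewrite qformB qformZ subr_ge0.
  by rewrite qformB qformZ E subrr.
have : qform (F *m (c *: P - D) + (c *: P - D) *m F^T) x0 = 0.
  have -> : qform (F *m (c *: P - D) + (c *: P - D) *m F^T) x0 =
     qform (F *m (c *: P - D)) x0 + qform (F *m (c *: P - D))^T x0.
    by rewrite -qformD trmx_mul Ms.
  by rewrite qform_tr /qform -!mulmxA Mx0 !mulmx0 mxE addr0.
have -> : F *m (c *: P - D) + (c *: P - D) *m F^T =
    c *: (F *m P + P *m F^T) - (F *m D + D *m F^T).
  by rewrite mulmxBr mulmxBl -scalemxAl -scalemxAr scalerDr opprD addrACA.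
rewrite qformB qformZ => /eqP; rewrite subr_eq0 => /eqP EE.
have := FD x0; rewrite -EE leNgt => /negP; apply.
by rewrite pmulr_rlt0 // FP.
Qed.

Lemma lyapunov_comparison_ge (D : 'M[R]_m) : D^T = D ->
  (forall x, qform (F *m D + D *m F^T) x <= 0) -> forall x, 0 <= qform D x.
Proof.
move=> Ds FD x; rewrite -oppr_le0 -qformN; move: x.
apply: lyapunov_comparison => [|x]; first by rewrite linearN /= Ds.
by rewrite mulmxN mulNmx -opprD qformN oppr_ge0.
Qed.

(** An injective endomorphism of the space of all matrices is onto. The map f has the Lyapunov
    operator at X + X^T as symmetric part and X - X^T as antisymmetric part, so its injectivity
    follows from the two comparison principles, and a symmetric W forces X to be symmetric. *)
Lemma lyapunov_solvable (W : 'M[R]_m) : W^T = W ->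
  exists X : 'M[R]_m, X^T = X /\ F *m X + X *m F^T = W.
Proof.
move=> Ws.
pose f (X : 'M[R]_m) := F *m (X + X^T) + (X + X^T) *m F^T + (X - X^T).
have f_lin : linear f.
  move=> a X Y; rewrite /f linearP /=.
  have -> : a *: X + Y + (a *: X^T + Y^T) = a *: (X + X^T) + (Y + Y^T).
    by rewrite scalerDr addrACA.
  have -> : a *: X + Y - (a *: X^T + Y^T) = a *: (X - X^T) + (Y - Y^T).
    by rewrite scalerBr opprD addrACA.
  rewrite mulmxDr mulmxDl -scalemxAr -scalemxAl.
  move: (F *m _) (_ *m F^T) (_ - _) (F *m _) (_ *m F^T) (_ - _) => A1 A2 A3 B1 B2 B3.
  by apply/matrixP => i j; rewrite !mxE; ring.
pose fL := HB.pack_for {linear 'M[R]_m -> 'M[R]_m} f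
  (GRing.isLinear.Build R 'M[R]_m 'M[R]_m _ f f_lin).
have fT X : (f X)^T = F *m (X + X^T) + (X + X^T) *m F^T - (X - X^T).
  have UT : (X + X^T)^T = X + X^T by rewrite linearD /= trmxK addrC.
  have VT : (X - X^T)^T = - (X - X^T) by rewrite linearB /= trmxK opprB.
  have trD (A B : 'M[R]_m) : (A + B)^T = A^T + B^T by rewrite linearD.
  by rewrite /f 2!trD VT !trmx_mul UT trmxK [_ *m F^T + _]addrC.
have f_inj X : f X = 0 -> X = 0.
  move=> fX0.
  have asym : X - X^T = 0.
    have : f X - (f X)^T = 0 by rewrite fX0 trmx0 subrr.
    rewrite fT /f opprD opprK addrACA subrr add0r => h.
    apply/matrixP => i j; move/matrixP : h => /(_ i j); rewrite !mxE; lra.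
  have XT : X^T = X by apply/esym/eqP; rewrite -subr_eq0 asym.
  have S0 : F *m (X + X^T) + (X + X^T) *m F^T = 0.
    by move: fX0; rewrite /f asym addr0.
  rewrite XT in S0; set Z := X + X in S0.
  have Zs : Z^T = Z by rewrite /Z linearD /= XT.
  have Z0 : Z = 0.
    apply: qform_eq0_sym => // x; apply/eqP; rewrite eq_le.
    rewrite lyapunov_comparison ?lyapunov_comparison_ge // => y;
    by rewrite S0 qform0.
  apply/matrixP => i j; move/matrixP : Z0 => /(_ i j); rewrite !mxE; lra.
pose G := lin_mx fL.
have Gu : G \in unitmx.
  rewrite -row_free_unit -kermx_eq0; apply/eqP/row_matrixP => i; rewrite row0.
  apply: (can_inj vec_mxK); rewrite linear0; apply: f_inj.
  have : row i (kermx G) *m G = 0 by rewrite -row_mul mulmx_ker row0.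
  rewrite -{1}(vec_mxK (row i (kermx G))) mul_vec_lin => /(congr1 vec_mx).
  by rewrite mxvecK linear0.
pose X := vec_mx (mxvec W *m invmx G).
have fX : f X = W.
  apply: (can_inj mxvecK).
  have := mul_vec_lin fL X.
  by rewrite /X vec_mxK mulmxKV.
have : (f X)^T = f X by rewrite fX.
rewrite fT /f => /addrI h.
have asym : X - X^T = 0.
  apply/matrixP => i j; move/matrixP : h => /(_ i j); rewrite !mxE; lra.
exists (X + X^T); split; first by rewrite linearD /= trmxK addrC.
by rewrite -fX /f asym addr0.
Qed.

End Lyapunov.
End QuadraticForms.

(** * The algebraic Riccati equation *)

Section Riccati.
Context {R : realType}.

(** Unlike [mxE], these three rules leave matrix products folded, so that [ring] can take their
    entries as atoms. *)
Lemma addmxE m n (A B : 'M[R]_(m, n)) i j : (A + B) i j = A i j + B i j.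
Proof. by rewrite mxE. Qed.

Lemma oppmxE m n (A : 'M[R]_(m, n)) i j : (- A) i j = - A i j.
Proof. by rewrite mxE. Qed.

Lemma scalemxE m n a (A : 'M[R]_(m, n)) i j : (a *: A) i j = a * A i j.
Proof. by rewrite mxE. Qed.

Context {m p : nat}.
Variable C : 'M[R]_(p, m).
Implicit Types S P X Y D : 'M[R]_m.

Definition ric S P := P *m S^T + S *m P - P *m C^T *m C *m P + 1%:M.

Definition closed_loop S P := S - P *m C^T *m C.

Definition supersolution S P :=
  [/\ P^T = P, forall x, 0 <= qform P x & forall x, qform (ric S P) x <= 0].

Lemma closed_loop_tr S P : P^T = P ->
  (closed_loop S P)^T = S^T - C^T *m C *m P.
Proof. by move=> Ps; rewrite linearB /= !trmx_mul trmxK Ps mulmxA. Qed.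

(** For a supersolution the right-hand side is at most -I, so P itself certifies the stability of
    its closed loop. *)
Lemma closed_loop_lyapunov S P : P^T = P ->
  closed_loop S P *m P + P *m (closed_loop S P)^T =
    ric S P - (1%:M + (C *m P)^T *m (C *m P)).
Proof.
move=> Ps; rewrite closed_loop_tr // /closed_loop /ric trmx_mul Ps.
rewrite !mulmxBl !mulmxBr !mulmxA.
by apply/matrixP => i j; rewrite !(addmxE, oppmxE); ring.
Qed.

(** Exact second-order expansion of [ric S] at X: the derivative is the Lyapunov operator of the
    closed loop, and the remainder is minus a Gram matrix, which makes [ric S] concave. *)
Lemma closed_loop_diff S X Y : X^T = X -> Y^T = Y ->
  closed_loop S X *m (Y - X) + (Y - X) *m (closed_loop S X)^T =
    ric S Y - ric S X + (C *m (Y - X))^T *m (C *m (Y - X)).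
Proof.
move=> Xs Ys; have DT : (Y - X)^T = Y - X by rewrite linearB /= Xs Ys.
rewrite closed_loop_tr // /closed_loop /ric trmx_mul DT.
rewrite !(mulmxBl, mulmxBr) !mulmxA.
by apply/matrixP => i j; rewrite !(addmxE, oppmxE); ring.
Qed.

Lemma supersolution_stable S P : supersolution S P ->
  forall x, x != 0 ->
    qform (closed_loop S P *m P + P *m (closed_loop S P)^T) x < 0.
Proof.
move=> [Ps _ ricP] x x0; rewrite closed_loop_lyapunov // qformB (qformD 1%:M).
have := ricP x; have := qform1_gt0 x0; have := qform_gram_ge0 (C *m P) x; lra.
Qed.

(** At a null vector of P the Lyapunov form would vanish, against its strict negativity. *)
Lemma supersolution_posdef S P : supersolution S P ->
  forall x, x != 0 -> 0 < qform P x.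
Proof.
move=> PS x x0; have [Ps P0 _] := PS.
rewrite lt_neqAle P0 andbT eq_sym; apply/eqP => Px.
have Px0 := psd_null Ps P0 Px.
have := supersolution_stable PS x0.
rewrite qformD -[X in _ + X < 0]qform_tr trmx_mul trmxK Ps /qform -!mulmxA.
by rewrite Px0 !mulmx0 mxE addr0 ltxx.
Qed.

(** By concavity the Lyapunov operator of the closed loop of X is positive semidefinite at Y - X,
    and the comparison principle applies. *)
Lemma le_supersolution S X Y : supersolution S X -> Y^T = Y ->
  (forall x, 0 <= qform (ric S Y) x) -> forall x, qform Y x <= qform X x.
Proof.
move=> XS Ys ricY x; have [Xs X0 ricX] := XS.
rewrite -subr_le0 -qformB; move: x.
apply: (lyapunov_comparison (supersolution_posdef XS) Xs (supersolution_stable XS)).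
  by rewrite linearB /= Xs Ys.
move=> x; rewrite closed_loop_diff // [X in 0 <= X]qformD qformB.
have := ricX x; have := ricY x; have := qform_gram_ge0 (C *m (Y - X)) x; lra.
Qed.

(** Kleinman's form of the Newton iteration: X is the zero of the linearization of [ric S] at P, a
    Lyapunov equation with right-hand side W. The residual at X is then the second-order remainder
    alone, which has the sign required of a supersolution. *)
Lemma newton_step S P : supersolution S P -> exists X,
  [/\ supersolution S X, forall x, qform X x <= qform P x
    & ric S X = - ((C *m (P - X))^T *m (C *m (P - X)))].
Proof.
move=> PS; have [Ps P0 ricP] := PS.
pose W := - (1%:M + (C *m P)^T *m (C *m P)).
have Ws : W^T = W by rewrite /W linearN linearD /= trmx1 trmx_mul trmxK.
have [X [Xs FX]] := lyapunov_solvable (supersolution_posdef PS) Ps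
  (supersolution_stable PS) Ws.
have ricX : ric S X = - ((C *m (P - X))^T *m (C *m (P - X))).
  have DT : (P - X)^T = P - X by rewrite linearB /= Xs Ps.
  have : ric S X = closed_loop S P *m X + X *m (closed_loop S P)^T - W
     - (C *m (P - X))^T *m (C *m (P - X)).
    rewrite /W closed_loop_tr // /closed_loop /ric !trmx_mul DT Ps.
    rewrite !(mulmxBl, mulmxBr) !mulmxA.
    by apply/matrixP => i j; rewrite !(addmxE, oppmxE); ring.
  by rewrite FX subrr sub0r.
have ge := lyapunov_comparison_ge (supersolution_posdef PS) Ps
  (supersolution_stable PS).
exists X; split => //.
  split => //; last by move=> x; rewrite ricX qformN oppr_le0 qform_gram_ge0.
  apply: ge => // x; rewrite FX qformN qformD.
  have := qform_gram_ge0 (C *m P) x; have := qform1_ge0 x; lra.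
move=> x; rewrite -subr_ge0 -qformB; move: x; apply: ge.
  by rewrite linearB /= Ps Xs.
move=> x; rewrite (mulmxBr _ P X) (mulmxBl P X) addrACA -opprD FX closed_loop_lyapunov //.
by rewrite /W opprK subrK.
Qed.

Lemma mxtrace_le_of_qform X P : (forall x, qform X x <= qform P x) -> \tr X <= \tr P.
Proof. by move=> XP; apply: ler_sum => i _; rewrite -!qform_delta. Qed.

Lemma cvg_qform (T : Type) (F : set_system T) {FF : Filter F} k
    (Z : T -> 'M[R]_k) (Z0 : 'M[R]_k) x :
  Z t @[t --> F] --> Z0 -> qform (Z t) x @[t --> F] --> qform Z0 x.
Proof.
move=> ZZ0; have c : (x^T *m Z t *m x) @[t --> F] --> x^T *m Z0 *m x.
  by apply: cvg_mulmx (cvg_cst _); apply: cvg_mulmx (cvg_cst _) _.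
exact: (proj1 (@cvg_mxP R _ _ FF _ _ _ _) c).
Qed.

(* A supersolution of least trace is fixed by the Newton step, hence solves the
   equation. *)
Lemma riccati_exists S P : supersolution S P ->
  exists Q, sym_posdef Q /\ riccati C S Q.
Proof.
move=> PS; pose A := [set Q : 'M[R]_m | supersolution S Q /\ \tr Q <= \tr P].
have cric : continuous (ric S).
  move=> X; have FF := nbhs_filter X.
  have c (B : 'M[R]_m) : B @[Y --> X] --> B by exact: cvg_cst.
  have cX : Y @[Y --> X] --> X by exact: cvg_id.
  apply: (@cvgD _ _ _ _ FF); last exact: cvg_cst.
  apply: (@cvgB _ _ _ _ FF).
    apply: (@cvgD _ _ _ _ FF); apply: (@cvg_mulmx R _ _ FF) => //; exact: cvg_cst.
  apply: (@cvg_mulmx R _ _ FF) => //.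
  apply: (@cvg_mulmx R _ _ FF); last exact: cvg_cst.
  by apply: (@cvg_mulmx R _ _ FF); last exact: cvg_cst.
have cA : closed A.
  have -> : A = (\bigcap_(ij : 'I_m * 'I_m)
        ((fun Q : 'M[R]_m => Q ij.1 ij.2 - Q ij.2 ij.1) @^-1` [set r | r = 0])) `&`
     (\bigcap_x ((fun Q => qform Q x) @^-1` [set r | 0 <= r]) `&`
     (\bigcap_x ((fun Q => qform (ric S Q) x) @^-1` [set r | r <= 0]) `&`
     (fun Q => \tr Q) @^-1` [set r | r <= \tr P])).
    apply/seteqP; split => Q.
      move=> [[Qs Q0 Qr] Qt]; split.
        by move=> [i j] _ /=; rewrite -[in X in X - _]Qs mxE subrr.
      by split => [x _|]; [exact: Q0|split => // x _; exact: Qr].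
    move=> [Qs [Q0 [Qr Qt]]]; split => //; split.
    - apply/matrixP => i j; rewrite mxE; apply/eqP; rewrite -subr_eq0.
      exact/eqP/(Qs (j, i)).
    - by move=> x; exact: Q0.
    - by move=> x; exact: Qr.
  apply: closedI; [|apply: closedI; [|apply: closedI]].
  - apply: closed_bigI => ij _; apply: preimage_closed; last exact: closed_eq.
    move=> X _; have FF := nbhs_filter X.
    by apply: (@cvgB _ _ _ _ FF); exact: coord_continuous.
  - apply: closed_bigI => x _; apply: preimage_closed; last exact: closed_ge.
    by move=> X _; apply: (@cvg_qform _ _ (nbhs_filter X)); exact: cvg_id.
  - apply: closed_bigI => x _; apply: preimage_closed; last exact: closed_le.
    by move=> X _; apply: (@cvg_qform _ _ (nbhs_filter X)); exact: cric.
  - apply: preimage_closed; last exact: closed_le.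
    by move=> X _; apply: (@cvg_mxtrace R _ _ (nbhs_filter X)); exact: cvg_id.
have [|||Q /set_mem [QS Qt] Qmin] := @compact_EVT_min _ R (fun X => \tr X) A.
- by exists P.
- apply: (@mx_bounded_closed_compact _ _ _ _ `|\tr P|) => // Q [[Qs Q0 _] Qt].
  apply/normr_mx_le => // i j; apply: le_trans (ler_norm _); apply: le_trans Qt.
  by apply: mx_entry_le_mxtrace => // x; rewrite ger0_norm.
- apply: continuous_subspaceT => X.
  by apply: (@cvg_mxtrace R _ _ (nbhs_filter X)); exact: cvg_id.
have [Qs Q0 _] := QS; have [X [XS XQ ricX]] := newton_step QS.
have [Xs _ _] := XS.
(* X lies below Q and Q has least trace, so the positive semidefinite Q - X has trace 0. *)
have tr0 : \tr (Q - X) = 0.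
  apply/eqP; rewrite linearB /= subr_eq0 eq_le; apply/andP; split.
    apply: Qmin; apply/mem_set; split => //.
    by apply: le_trans Qt; exact: mxtrace_le_of_qform.
  exact: mxtrace_le_of_qform.
have QX : Q - X = 0.
  have DT : (Q - X)^T = Q - X by rewrite linearB /= Qs Xs.
  apply/matrixP => i j; rewrite mxE [RHS]mxE; apply/eqP; rewrite -normr_le0.
  have -> : Q i j + (- X) i j = (Q - X) i j by rewrite [RHS]mxE.
  rewrite -tr0; apply: mx_entry_le_mxtrace => // x.
  by rewrite ger0_norm // qformB subr_ge0.
exists X; split; first by split => // x x0; exact: (supersolution_posdef XS).
by rewrite /riccati -/(ric S X) ricX QX mulmx0 mulmx0 oppr0.
Qed.

Lemma riccati_supersolution S P : sym_posdef P -> riccati C S P -> supersolution S P.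
Proof.
move=> [Ps P0] ricP; split => // x; last by rewrite /ric ricP qform0.
have [->|/P0/ltW//] := eqVneq x 0.
by rewrite /qform mulmx0 mxE.
Qed.

(* (1 + e) P and (1 - e) P are a super- and a subsolution of the equation with
   S replaced by a nearby matrix. *)
Lemma riccati_perturbation S P S' P' (e : R) : 0 < e -> e < 1 ->
  sym_posdef P -> riccati C S P -> sym_posdef P' -> riccati C S' P' ->
  (forall x, `|qform (P *m (S' - S)^T + (S' - S) *m P) x| <= e / 2 * qform 1%:M x) ->
  forall x, `|qform (P' - P) x| <= e * qform P x.
Proof.
move=> e0 e1 P0 ricP P'0 ricP' HD x; have [Ps Pp] := P0; have [P's _] := P'0.
have Pge y : 0 <= qform P y.
  by have [_ + _] := riccati_supersolution P0 ricP; exact.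
(* The sign of 1 - a decides the sign of the last two terms. For a = 1 + e and a = 1 - e the
   identity term, of size e, absorbs the defect, which is at most (1 + e) e / 2 <= e. *)
have ricE (a : R) : ric S' (a *: P) =
    a *: (P *m (S' - S)^T + (S' - S) *m P) + (1 - a) *: 1%:M
    + (a * (1 - a)) *: ((C *m P)^T *m (C *m P)).
  have ricPE : P *m S^T + S *m P = P *m C^T *m C *m P - 1%:M.
    by apply/eqP; rewrite -subr_eq0 opprB addrA -[_ + 1%:M - _]addrAC; apply/eqP.
  have sT : (S' - S)^T = S'^T - S^T by rewrite linearB.
  rewrite /ric sT trmx_mul Ps mulmxBl mulmxBr.
  have -> : P *m S'^T - P *m S^T + (S' *m P - S *m P) =
      P *m S'^T + S' *m P - (P *m C^T *m C *m P - 1%:M).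
    by rewrite -ricPE; apply/matrixP => i j; rewrite !(addmxE, oppmxE); ring.
  rewrite -!scalemxAl -!scalemxAr !mulmxA.
  by apply/matrixP => i j; rewrite !(addmxE, oppmxE, scalemxE); ring.
have gP y := qform_gram_ge0 (C *m P) y.
have up : qform P' x <= qform ((1 + e) *: P) x.
  apply: (le_supersolution (S := S')) => //; last first.
    by move=> y; rewrite /ric ricP' qform0.
  split; first by rewrite linearZ /= Ps.
    by move=> y; rewrite qformZ mulr_ge0 // addr_ge0 // ltW.
  move=> y; rewrite ricE !qformD !qformZ.
  move: (HD y) (gP y) (qform1_ge0 y); rewrite ler_norml => /andP[_].
  move: (qform (P *m _ + _) y) (qform (_^T *m _) y) (qform 1%:M y) => d g u h1 h2 h3.
  have h4 : (1 + e) * d <= (1 + e) * (e / 2 * u) by rewrite ler_wpM2l // addr_ge0 // ltW.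
  have h5 : 0 <= e * (1 - e) * u by rewrite !mulr_ge0 ?subr_ge0 // ltW.
  have h6 : 0 <= e * (1 + e) * g by rewrite !mulr_ge0 ?addr_ge0 // ltW.
  clear - h4 h5 h6; lra.
have lo : qform ((1 - e) *: P) x <= qform P' x.
  apply: (le_supersolution (S := S')); first exact: riccati_supersolution.
    by rewrite linearZ /= Ps.
  move=> y; rewrite ricE !qformD !qformZ.
  move: (HD y) (gP y) (qform1_ge0 y); rewrite ler_norml => /andP[+ _].
  move: (qform (P *m _ + _) y) (qform (_^T *m _) y) (qform 1%:M y) => d g u h1 h2 h3.
  have h4 : (1 - e) * - (e / 2 * u) <= (1 - e) * d by rewrite ler_wpM2l // subr_ge0 ltW.
  have h5 : 0 <= e * (1 + e) * u by rewrite !mulr_ge0 ?addr_ge0 // ltW.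
  have h6 : 0 <= e * (1 - e) * g by rewrite !mulr_ge0 ?subr_ge0 // ltW.
  clear - h4 h5 h6; lra.
rewrite qformB ler_norml; move: up lo; rewrite !qformZ => up lo.
by apply/andP; split; lra.
Qed.

Lemma qform_normr_le k (A : 'M[R]_k) x :
  `|qform A x| <= (k%:R * (k%:R * `|A|)) * qform 1%:M x.
Proof.
rewrite /qform; have := normr_entry_le (x^T *m A *m x) 0 0 => /le_trans; apply.
apply: le_trans (normr_mulmx_le _ _) _; rewrite -!mulrA ler_wpM2l //.
apply: (@le_trans _ _ (k%:R * (`|x| * `|A|) * `|x|)).
  by rewrite ler_wpM2r // (le_trans (normr_mulmx_le _ _)) // normr_trmx.
rewrite -!mulrA ler_wpM2l // mulrCA ler_wpM2l // -expr2.
rewrite -/(qform _ _) qform1E.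
have [xx|/mx_norm_neq0[[i j] /= E]] := eqVneq (mx_norm x) 0.
  have -> : `|x| = 0 by exact: xx.
  by rewrite expr2 mul0r sumr_ge0 // => i _; rewrite sqr_ge0.
have -> : `|x| = `|x i j| by exact: E.
rewrite [j]ord1 real_normK ?num_real // (bigD1 i) //= lerDl sumr_ge0 // => l _.
exact: sqr_ge0.
Qed.

(** The filter is arbitrary, so that one statement serves both for continuity in time and for limits
    at infinity. *)
Lemma cvg_riccati (T : Type) (F : set_system T) {FF : Filter F}
    (Z P : T -> 'M[R]_m) (Z0 P0 : 'M[R]_m) :
  sym_posdef P0 -> riccati C Z0 P0 ->
  (forall t, sym_posdef (P t) /\ riccati C (Z t) (P t)) ->
  Z t @[t --> F] --> Z0 -> P t @[t --> F] --> P0.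
Proof.
move=> P0p ricP0 HP ZZ0; have [P0s P00] := P0p.
apply/cvgrPdist_le => e e0.
have tr0 : 0 <= \tr P0.
  rewrite /mxtrace sumr_ge0 // => i _; rewrite -qform_delta.
  by have [_ + _] := riccati_supersolution P0p ricP0; exact.
(* The perturbation lemma needs d < 1, and d times tr P0 must not exceed e. *)
pose d := Num.min (1 / 2) (e / (\tr P0 + 1)).
have d0 : 0 < d by rewrite lt_min divr_gt0 //= divr_gt0 // ltr_wpDl.
have d1 : d < 1 by rewrite gt_min; apply/orP; left; rewrite ltr_pdivrMr // mul1r ltr1n.
have ZD : (P0 *m (Z t - Z0)^T + (Z t - Z0) *m P0) @[t --> F] -->
    P0 *m (Z0 - Z0)^T + (Z0 - Z0) *m P0.
  have ZZ : (Z t - Z0) @[t --> F] --> Z0 - Z0 by apply: cvgB (cvg_cst _).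
  apply: cvgD; first by apply: cvg_mulmx (cvg_cst _) _; exact: cvg_trmx.
  exact: cvg_mulmx (cvg_cst _).
rewrite subrr trmx0 mulmx0 mul0mx addr0 in ZD.
(* The summand 1 keeps K positive when m = 0. *)
pose K : R := (m%:R * m%:R + 1).
have K0 : 0 < K by rewrite /K ltr_wpDl // mulr_ge0.
have dK : 0 < d / 2 / K by rewrite !divr_gt0.
move/cvgr0Pnorm_le : ZD => /(_ _ dK); apply: filterS => t Ht.
have [Ptp ricPt] := HP t; have [Pts _] := Ptp.
have H := riccati_perturbation d0 d1 P0p ricP0 Ptp ricPt.
have {}H x : `|qform (P t - P0) x| <= d * qform P0 x.
  apply: H => y; apply: le_trans (qform_normr_le _ _) _.
  rewrite ler_wpM2r ?qform1_ge0 //.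
  move: Ht; rewrite ler_pdivlMr //; apply: le_trans.
  have := normr_ge0 (P0 *m (Z t - Z0)^T + (Z t - Z0) *m P0).
  by rewrite /K; move: `|_| (m%:R : R) => a b; clear; lra.
apply: (@le_trans _ _ (d * \tr P0)).
  rewrite distrC -mxtraceZ; apply/normr_mx_le => [|i j].
    by rewrite mxtraceZ mulr_ge0 // ltW.
  apply: mx_entry_le_mxtrace; first by rewrite linearB /= Pts P0s.
    by rewrite linearZ /= P0s.
  by move=> x; rewrite qformZ.
apply: (@le_trans _ _ (e / (\tr P0 + 1) * \tr P0)).
  by rewrite ler_wpM2r // ge_min lexx orbT.
rewrite mulrAC ler_pdivrMr ?ltr_wpDl //.
by apply: ler_wpM2l; [exact: ltW|rewrite lerDl].
Qed.
End Riccati.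

(** * The observer form *)

Section Tensor.
Context {R : realType}.

Lemma tensmxDl m n p q (A B : 'M[R]_(m, n)) (K : 'M[R]_(p, q)) :
  (A + B) *t K = A *t K + B *t K.
Proof. by apply/matrixP => i j; rewrite !mxE mulrDl. Qed.

Lemma tensmxNl m n p q (A : 'M[R]_(m, n)) (K : 'M[R]_(p, q)) :
  (- A) *t K = - (A *t K).
Proof. by apply/matrixP => i j; rewrite !mxE mulNr. Qed.

Lemma tensmx11 n p : (1%:M : 'M[R]_n) *t (1%:M : 'M[R]_p) = 1%:M.
Proof.
apply/matrixP => i j; case: (mxtens_indexP i) => i1 i2.
case: (mxtens_indexP j) => j1 j2; rewrite tensmxE !mxE -natrM mulnb.
by rewrite (inj_eq (can_inj (@mxtens_indexK n p))) xpair_eqE.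
Qed.

Lemma qform_sum n (A : 'M[R]_n) x :
  qform A x = \sum_i \sum_j x i 0 * A i j * x j 0.
Proof.
rewrite /qform mxE exchange_big /=; apply: eq_bigr => j _.
by rewrite mxE mulr_suml; apply: eq_bigr => i _; rewrite mxE.
Qed.

Lemma sum_mxtens n p (f : 'I_(n * p) -> R) :
  \sum_l f l = \sum_(i < n) \sum_(k < p) f (mxtens_index (i, k)).
Proof.
rewrite (reindex (@mxtens_index n p)) /=; last first.
  by exists (@mxtens_unindex n p) => ij _; rewrite ?mxtens_indexK ?mxtens_unindexK.
by rewrite pair_bigA; apply: eq_bigr => -[].
Qed.

Lemma qform_tens1 n p (W : 'M[R]_n) (x : 'cV[R]_(n * p)) :
  qform (W *t (1%:M : 'M[R]_p)) x =
  \sum_(k < p) qform W (\col_i x (mxtens_index (i, k)) 0).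
Proof.
rewrite qform_sum sum_mxtens exchange_big /=; apply: eq_bigr => k _.
rewrite qform_sum; apply: eq_bigr => i _; rewrite sum_mxtens; apply: eq_bigr => j _.
rewrite (bigD1 k) //= tensmxE !mxE eqxx mulr1 big1 ?addr0 // => l lk.
by rewrite tensmxE !mxE eq_sym (negbTE lk) mulr0 mulr0 mul0r.
Qed.

(** The cast in [calC] disappears from its Gram matrix, the only way in which it enters [ric]. *)
Lemma gram_castmx k k' n (e : k = k') (M : 'M[R]_(k, n)) :
  (castmx (e, erefl n) M)^T *m castmx (e, erefl n) M = M^T *m M.
Proof. by case: k' / e; rewrite castmx_id. Qed.

End Tensor.

(** * A supersolution for the companion matrix, and continuity of [calP] *)

Section ObserverRiccati.
Context {R : realType}.

Definition output_row n : 'rV[R]_n := \row_(j < n) (j == 0 :> nat)%:R.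

Lemma calC_gram n p :
  (calC R n p)^T *m calC R n p = ((output_row n)^T *m output_row n) *t 1%:M.
Proof. by rewrite /calC gram_castmx trmx_tens trmx1 tensmx_mul mulmx1. Qed.

(** All coefficients are Kronecker products with the identity, which reduces the search for a
    supersolution to p = 1. *)
Lemma ric_tens n p (al : 'cV[R]_n) (X : 'M[R]_n) :
  ric (calC R n p) (calS p al) (X *t 1%:M) =
  ric (output_row n) (companion al) X *t 1%:M.
Proof.
rewrite /ric /calS -(mulmxA _ (calC R n p)^T (calC R n p)) calC_gram.
rewrite trmx_tens trmx1 !tensmx_mul !mulmx1 -tensmx11.
by rewrite !tensmxDl tensmxNl !mulmxA.
Qed.

Definition shift_mx n : 'M[R]_n := \matrix_(i, j) (i.+1 == j :> nat)%:R.

(* This is the Gramian \int_0^oo e^(-t) e^(-N^T t) c^T c e^(-N t) dt of the shift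
   matrix N and the first unit row c, which explains [signed_pascal_lyapunov]. *)
Definition signed_pascal n : 'M[R]_n :=
  \matrix_(i, j) ((-1) ^+ (i + j) * ('C(i + j, i))%:R).

(** Inside the matrix this is Pascal's rule with alternating signs; along the first row and column,
    two entries of opposite sign cancel. *)
Lemma signed_pascal_lyapunov n :
  (shift_mx n)^T *m signed_pascal n + signed_pascal n *m shift_mx n
  + signed_pascal n = (output_row n)^T *m output_row n.
Proof.
pose Y i j : R := (-1) ^+ (i + j) * ('C(i + j, i))%:R.
have shiftE (f : nat -> R) (j : 'I_n) :
    \sum_(k < n) f k * (k.+1 == j :> nat)%:R = if j == 0 :> nat then 0 else f j.-1.
  case: j => -[|j] /= jn; first by rewrite big1 // => k _; rewrite mulr0.
  have jn' : (j < n)%N by exact: ltnW.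
  rewrite (bigD1 (Ordinal jn')) //= eqxx mulr1 big1 ?addr0 // => k kj.
  by rewrite eqSS (_ : _ == _ = false) ?mulr0 //; apply/negbTE: kj.
apply/matrixP => i j; rewrite !mxE.
have -> : \sum_k (shift_mx n)^T i k * signed_pascal n k j =
    if i == 0 :> nat then 0 else Y i.-1 j.
  rewrite -(shiftE (fun k => Y k j)); apply: eq_bigr => k _.
  by rewrite !mxE mulrC.
have -> : \sum_k signed_pascal n i k * shift_mx n k j =
    if j == 0 :> nat then 0 else Y i j.-1.
  by rewrite -(shiftE (fun k => Y i k)); apply: eq_bigr => k _; rewrite !mxE.
rewrite big_ord1 !mxE; case: (nat_of_ord i) (nat_of_ord j) => [|k] [|l] /=;
  rewrite ?mulr0 ?mul0r ?mulr1 ?add0r ?addr0 /Y.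
- by [].
- by rewrite !add0n bin0 exprS; ring.
- by rewrite !addn0 !binn exprS; ring.
- by rewrite addSnnS (addSn k l.+1) binS natrD exprS; ring.
Qed.

(** Vandermonde's identity writes the Pascal matrix as the lower triangular Pascal matrix times its
    transpose. The signs go into L, whose diagonal entries are 1 or -1. *)
Lemma signed_pascal_factor n : exists2 L : 'M[R]_n, L \in unitmx &
  signed_pascal n = L *m L^T.
Proof.
pose L : 'M[R]_n := \matrix_(i, k) ((-1) ^+ i * ('C(i, k))%:R).
exists L.
  have tr : is_trig_mx L.
    by apply/is_trig_mxP => i j ij; rewrite mxE bin_small ?mulr0.
  rewrite unitmxE det_trig // unitfE; apply/prodf_neq0 => i _.
  by rewrite mxE binn mulr1 signr_eq0.
apply/matrixP => i j; rewrite !mxE.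
under eq_bigr do rewrite !mxE mulrACA -exprD -natrM.
rewrite -mulr_sumr -natr_sum; congr (_ * _%:R).
rewrite addnC -binomial.Vandermonde.
rewrite (big_ord_widen n (fun k => 'C(j, k) * 'C(i, i - k))%N) //.
rewrite big_mkcond; apply: eq_bigr => k _ /=; rewrite ltnS.
by case: leqP => ki; [rewrite bin_sub // mulnC|rewrite bin_small].
Qed.

(** The inverse X1 of the signed Pascal matrix satisfies X1 N^T + N X1 - X1 c^T c X1 = -X1 for the
    shift N. For D = diag(th^i) one has N D = th D N and c D = c, so th D X1 D gains a factor th^2
    in this negative term, against th in the term from the last row of the companion matrix and 1 in
    the identity. A large th makes it a supersolution. *)
Lemma companion_supersolution n (al : 'cV[R]_n) :
  exists X : 'M[R]_n, [/\ X^T = X, forall x, 0 <= qform X x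
    & forall x, qform (ric (output_row n) (companion al) X) x <= 0].
Proof.
pose N := shift_mx n; pose c := output_row n.
have [L Lu YE] := signed_pascal_factor n.
set Y := signed_pascal n in YE.
have Yu : Y \in unitmx by rewrite YE unitmx_mul unitmx_tr Lu.
pose K := invmx L; pose X1 := K^T *m K.
have X1s : X1^T = X1 by rewrite trmx_mul trmxK.
have YX : Y *m X1 = 1%:M.
  by rewrite YE /X1 /K trmx_inv mulmxA mulmxK ?unitmx_tr // mulmxV.
have XY : X1 *m Y = 1%:M by apply: mulmx1C.
have X1_gt0 z : z != 0 -> 0 < qform X1 z.
  move=> z0; rewrite qform_gram qform1_gt0 //; apply: contra_neq z0 => Kz.
  by rewrite -(mul1mx z) -(mulmxV Lu) -mulmxA Kz mulmx0.
have X1_ge0 z : 0 <= qform X1 z by exact: qform_gram_ge0.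
clearbody X1.
have X1E : X1 *m N^T + N *m X1 - X1 *m c^T *m c *m X1 = - X1.
  have : X1 *m (N^T *m Y + Y *m N + Y) *m X1 = X1 *m (c^T *m c) *m X1.
    by rewrite signed_pascal_lyapunov.
  rewrite !mulmxDr !mulmxDl !mulmxA XY mul1mx -!(mulmxA _ Y X1) YX !mulmx1 => <-.
  rewrite mul1mx; by apply/matrixP => i j; rewrite !(addmxE, oppmxE); ring.
pose B : 'M[R]_n := \matrix_(i, j) if i.+1 == n then - al (rev_ord j) 0 else 0.
have AE : companion al = N + B.
  apply/matrixP => i j; rewrite !mxE; case: eqP => [i1n|_]; last by rewrite addr0.
  by rewrite i1n gtn_eqF ?add0r.
have [k k0 Hk] : exists2 k, 0 < k & forall z, qform 1%:M z <= k * qform X1 z.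
  have [[z1 z10]|nex] := pselect (exists z : 'cV[R]_n, z != 0); last first.
    exists 1 => // z; have -> : z = 0 by apply/eqP/negP => /negP z0; apply: nex; exists z.
    by rewrite /qform !mulmx0 mxE mulr0.
  have [k [z0 [z00 E H]]] := max_rayleigh (@continuous_qform _ _ 1%:M)
    (@continuous_qform _ _ X1) (fun a => qform_scale a 1%:M)
    (fun a => qform_scale a X1) X1_gt0 z10.
  exists k => //; have := qform1_gt0 z00.
  by rewrite E pmulr_lgt0 // X1_gt0.
pose q : R := n%:R * (n%:R * (n%:R * (`|B| * `|X1|) *+ 2)).
have q0 : 0 <= q by rewrite !mulr_ge0 // mulrn_wge0 // !mulr_ge0.
(* As th - 1 = (q + 1) k, the term th (q + 1) |z|^2 is at most (th^2 - th) X1(z); it covers both the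
   contribution q of B and the identity. *)
pose th := (q + 1) * k + 1.
have th1 : 1 <= th by rewrite /th lerDr mulr_ge0 ?addr_ge0 // ltW.
have th0 : 0 < th := lt_le_trans ltr01 th1.
pose D : 'M[R]_n := diag_mx (\row_i th ^+ i).
have Ds : D^T = D by rewrite tr_diag_mx.
have DNE : N *m D = th *: (D *m N).
  apply/matrixP => i j; rewrite mul_mx_diag mul_diag_mx !mxE.
  by case: eqP => [<-|_]; rewrite ?mul0r ?mulr0 // mul1r mulr1 exprS.
have cD : c *m D = c.
  apply/matrixP => i j; rewrite mul_mx_diag !mxE.
  by case: eqP => [->|_]; rewrite ?mul0r ?expr0 ?mulr1.
pose B' : 'M[R]_n := \matrix_(i, j) (B i j * th ^+ j / th ^+ i).
have BD : B *m D = D *m B'.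
  apply/matrixP => i j; rewrite mul_mx_diag mul_diag_mx !mxE.
  have : th ^+ i != 0 by rewrite expf_neq0 ?gt_eqF.
  by move: (if _ then _ else _) (th ^+ j) (th ^+ i) => b u v v0; field.
(* Only the last row i = n - 1 is nonzero, and j <= i there, so the scaling divides by powers of th
   >= 1. *)
have B'B : `|B'| <= `|B|.
  apply/normr_mx_le => // i j; rewrite mxE -mulrA normrM.
  have [i1n|i1n] := eqVneq i.+1 n; last first.
    have -> : B i j = 0 by rewrite mxE (negbTE i1n).
    by rewrite normr0 mul0r.
  rewrite (le_trans _ (normr_entry_le B i j)) // ler_piMr //.
  have ji : (j <= i)%N by rewrite -ltnS i1n.
  rewrite ger0_norm ?divr_ge0 ?exprn_ge0 ?(ltW th0) //.
  by rewrite ler_pdivrMr ?exprn_gt0 // mul1r ler_weXn2l.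
pose X := th *: (D *m X1 *m D).
have Xs : X^T = X by rewrite linearZ /= !trmx_mul Ds X1s mulmxA.
exists X; split => // x.
  by rewrite qformZ -{1}Ds qform_congr mulr_ge0 // ltW.
have ricE : ric c (companion al) X =
    th ^+ 2 *: (D^T *m - X1 *m D) + th *: (D^T *m (B' *m X1 + (B' *m X1)^T) *m D) + 1%:M.
  have AX : companion al *m X = th ^+ 2 *: (D *m (N *m X1) *m D)
      + th *: (D *m (B' *m X1) *m D).
    rewrite AE /X -scalemxAr mulmxDl !mulmxA DNE BD -!scalemxAl scalerDr scalerA.
    by rewrite expr2.
  have XA : X *m (companion al)^T = (companion al *m X)^T.
    by rewrite trmx_mul Xs.
  have XcX : X *m c^T *m c *m X = th ^+ 2 *: (D *m (X1 *m c^T *m c *m X1) *m D).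
    have DcT : D *m c^T = c^T by rewrite -[D]Ds -trmx_mul cD.
    rewrite /X -!scalemxAl -scalemxAr scalerA -expr2; congr (_ *: _).
    rewrite -!mulmxA (mulmxA D c^T) DcT (mulmxA c D) cD.
    by rewrite !mulmxA.
  have trD (U V : 'M[R]_n) : (U + V)^T = U^T + V^T by rewrite linearD.
  have trZ a (U : 'M[R]_n) : (a *: U)^T = a *: U^T by rewrite linearZ.
  rewrite /ric XA XcX AX trD !trZ !trmx_mul Ds X1s -X1E.
  rewrite !(mulmxDr, mulmxDl, mulmxN, mulNmx) !mulmxA.
  by apply/matrixP => i j; rewrite !(addmxE, oppmxE, scalemxE); ring.
rewrite ricE !qformD !qformZ !qform_congr qformN.
set z := D *m x.
have xz : qform 1%:M x <= qform 1%:M z.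
  rewrite !qform1E; apply: ler_sum => i _; rewrite /z mul_diag_mx !mxE exprMn.
  by rewrite ler_peMl ?sqr_ge0 // !exprn_ege1.
have h2 : qform (B' *m X1 + (B' *m X1)^T) z <= q * qform 1%:M z.
  apply: le_trans (ler_norm _) _; apply: le_trans (qform_normr_le _ _) _.
  rewrite ler_wpM2r ?qform1_ge0 // /q ler_wpM2l // ler_wpM2l //.
  apply: le_trans (ler_normD _ _) _; rewrite normr_trmx -mulr2n lerMn2r /=.
  apply: le_trans (normr_mulmx_le _ _) _.
  by rewrite ler_wpM2l // ler_wpM2r.
have h3 := Hk z; have h4 := qform1_ge0 z.
move: xz h2 h3 h4; set a := qform 1%:M x; set b := qform 1%:M z.
set d := qform (_ + _) z; set e := qform X1 z => xz h2 h3 h4.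
have h5 : th * d <= th * (q * b) by rewrite ler_wpM2l // ltW.
have h6 : th * ((q + 1) * b) <= th * ((q + 1) * (k * e)).
  by rewrite ler_wpM2l ?(ltW th0) // ler_wpM2l // addr_ge0.
have h7 : b <= th * b by rewrite ler_peMl.
have e0 : 0 <= e by exact: X1_ge0.
have h8 : th * e <= th ^+ 2 * e by rewrite ler_wpM2r // expr2 ler_peMl // ltW.
have h9 : th * ((q + 1) * (k * e)) = th ^+ 2 * e - th * e by rewrite /th; ring.
have h10 : 0 <= th * e by rewrite mulr_ge0 // ltW.
clear - xz h2 h5 h6 h7 h8 h9 h10; rewrite mulrN; lra.
Qed.

Lemma calS_supersolution n p (al : 'cV[R]_n) :
  exists P, supersolution (calC R n p) (calS p al) P.
Proof.
have [X [Xs X0 Xr]] := companion_supersolution al.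
exists (X *t 1%:M); split; first by rewrite trmx_tens Xs trmx1.
  by move=> x; rewrite qform_tens1 sumr_ge0.
move=> x; rewrite ric_tens qform_tens1 -oppr_ge0 -sumrN sumr_ge0 // => k _.
by rewrite oppr_ge0.
Qed.

(** A supersolution yields a solution, so [xget] does not return its default value. *)
Lemma calP_spec n p (al : 'cV[R]_n) :
  sym_posdef (calP p al) /\ riccati (calC R n p) (calS p al) (calP p al).
Proof.
have [P0 P0S] := calS_supersolution p al.
have [P PP] := riccati_exists P0S.
exact: (@xgetI _ 0
  [set Q | sym_posdef Q /\ riccati (calC R n p) (calS p al) Q] P PP).
Qed.

Lemma cvg_calS (T : Type) (F : set_system T) {FF : Filter F} n p
    (al : T -> 'cV[R]_n) (al0 : 'cV[R]_n) :
  al t @[t --> F] --> al0 -> calS p (al t) @[t --> F] --> calS p al0.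
Proof.
move=> /cvg_mxP h; apply/cvg_mxP => i j; rewrite /calS !mxE.
under eq_fun do rewrite !mxE.
apply: cvgM; last exact: cvg_cst.
by case: ifP => _; [apply: cvgN; exact: h|exact: cvg_cst].
Qed.

Lemma cvg_calP (T : Type) (F : set_system T) {FF : Filter F} n p
    (al : T -> 'cV[R]_n) (al0 : 'cV[R]_n) :
  al t @[t --> F] --> al0 -> calP p (al t) @[t --> F] --> calP p al0.
Proof.
move=> h; have [P0 ricP0] := calP_spec p al0.
apply: (@cvg_riccati _ _ _ _ T F FF (fun t => calS p (al t)) _ _ _ P0 ricP0) => [t|].
  exact: calP_spec.
exact: cvg_calS.
Qed.

End ObserverRiccati.

(** * Spectra and Lyapunov functions *)

Section ComplexMatrices.
Context {R : realType}.

Definition mxRe m n (M : 'M[R[i]]_(m, n)) : 'M[R]_(m, n) := map_mx (@complex.Re R) M.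
Definition mxIm m n (M : 'M[R[i]]_(m, n)) : 'M[R]_(m, n) := map_mx (@complex.Im R) M.
Local Notation cplx := (map_mx (real_complex R)).

Lemma Re_sum (I : finType) (f : I -> R[i]) :
  complex.Re (\sum_i f i) = \sum_i complex.Re (f i).
Proof.
apply: (big_morph (@complex.Re R)) => //.
by move=> [a b] [c d].
Qed.

Lemma Im_sum (I : finType) (f : I -> R[i]) :
  complex.Im (\sum_i f i) = \sum_i complex.Im (f i).
Proof.
apply: (big_morph (@complex.Im R)) => //.
by move=> [a b] [c d].
Qed.

Lemma mxRe_mul m n p (M : 'M[R[i]]_(m, n)) (K : 'M[R[i]]_(n, p)) :
  mxRe (M *m K) = mxRe M *m mxRe K - mxIm M *m mxIm K.
Proof.
apply/matrixP => i j; rewrite !mxE Re_sum -sumrB; apply: eq_bigr => k _.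
by rewrite !mxE; case: (M i k) (K k j) => a b [c d].
Qed.

Lemma mxIm_mul m n p (M : 'M[R[i]]_(m, n)) (K : 'M[R[i]]_(n, p)) :
  mxIm (M *m K) = mxRe M *m mxIm K + mxIm M *m mxRe K.
Proof.
apply/matrixP => i j; rewrite !mxE Im_sum -big_split; apply: eq_bigr => k _.
by rewrite !mxE; case: (M i k) (K k j) => a b [c d].
Qed.

Lemma mxRe_real m n (A : 'M[R]_(m, n)) : mxRe (cplx A) = A.
Proof. by apply/matrixP => i j; rewrite !mxE. Qed.

Lemma mxIm_real m n (A : 'M[R]_(m, n)) : mxIm (cplx A) = 0.
Proof. by apply/matrixP => i j; rewrite !mxE. Qed.

(* Real and imaginary parts of a Schur form U A = T U. *)
Lemma real_schur n (A : 'M[R]_n) :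
  exists Ur Ui Tr Ti : 'M[R]_n,
  [/\ Ur *m A = Tr *m Ur - Ti *m Ui, Ui *m A = Tr *m Ui + Ti *m Ur,
      forall i j : 'I_n, (i < j)%N -> Tr i j = 0 /\ Ti i j = 0,
      forall i, eigenvalue (cplx A) (Complex (Tr i i) (Ti i i))
    & forall x : 'cV[R]_n, Ur *m x = 0 -> Ui *m x = 0 -> x = 0].
Proof.
case: n A => [|n] A.
  by exists 0, 0, 0, 0; split => // [||[]//|[]//|x _ _];
    rewrite ?flatmx0 // [LHS]flatmx0 [RHS]flatmx0.
have [P /unitarymx_unit Pu] := Schur (cplx A) (ltn0Sn n).
rewrite /similar_to conjumx // => Ttrig; set T := P *m _ *m _ in Ttrig.
have PA : P *m cplx A = T *m P by rewrite /T mulmxKV.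
(* The diagonal of the triangular T consists of its eigenvalues, which are eigenvalues of A because
   the minimal polynomials agree. *)
have minT : mxminpoly T = mxminpoly (cplx A).
  by have := mxminpoly_uconj (cplx A) Pu; rewrite conjumx.
clearbody T.
exists (mxRe P), (mxIm P), (mxRe T), (mxIm T); split.
- by rewrite -mxRe_mul -PA mxRe_mul mxRe_real mxIm_real mulmx0 subr0.
- by rewrite -mxIm_mul -PA mxIm_mul mxRe_real mxIm_real mulmx0 add0r.
- by move=> i j ij; have T0 := is_trig_mxP Ttrig i j ij; split; rewrite mxE T0.
- move=> i; have -> : Complex (mxRe T i i) (mxIm T i i) = T i i.
    by rewrite !mxE; case: (T i i).
  have : eigenvalue T (T i i).
    rewrite eigenvalue_root_char.
    rewrite (char_poly_trig Ttrig).
    rewrite -(big_map (fun i => T i i) xpredT (fun z => 'X - z%:P)).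
    rewrite root_prod_XsubC.
    by apply: map_f; rewrite mem_index_enum.
  by rewrite !eigenvalue_root_min minT.
- move=> x Px0 Px1.
  have : P *m cplx x = 0.
    have : mxIm (P *m cplx x) = 0.
      by rewrite mxIm_mul mxRe_real mxIm_real mulmx0 add0r.
    have : mxRe (P *m cplx x) = 0.
      by rewrite mxRe_mul mxRe_real mxIm_real mulmx0 subr0.
    move: (P *m _) => z /matrixP zr /matrixP zi; apply/matrixP => i j.
    by move: (zr i j) (zi i j); rewrite !mxE; case: (z i j) => a b /= -> ->.
  move=> /(congr1 (mulmx (invmx P))); rewrite (mulKmx Pu) mulmx0 => x0.
  by rewrite -(mxRe_real x) x0; apply/matrixP => i j; rewrite !mxE.
Qed.

Lemma spectrum_finite n (A : 'M[R]_n) : exists s : seq R[i],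
  forall l, eigenvalue (cplx A) l -> l \in s.
Proof.
have [s E] := closed_field_poly_normal (char_poly (cplx A)); exists s => l.
rewrite eigenvalue_root_char E rootZ; last first.
  by rewrite lead_coef_eq0 monic_neq0 // char_poly_monic.
by rewrite root_prod_XsubC.
Qed.

Lemma le_max_re n (A : 'M[R]_n) l : eigenvalue (cplx A) l -> complex.Re l <= max_re A.
Proof.
move=> Al; have [s Hs] := spectrum_finite A.
apply: ub_le_sup; last by exists l.
have [M HM] : exists M, forall l, l \in s -> complex.Re l <= M.
  elim: s {Hs} => [|z s [M HM]]; first by exists 0.
  exists (Num.max (complex.Re z) M) => w; rewrite inE => /predU1P[->|/HM h].
    by rewrite le_max lexx.
  by rewrite le_max h orbT.
by exists M => _ [w /Hs /HM h <-].
Qed.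

(** For n > 0 there is an eigenvalue, and finiteness of the spectrum gives a positive lower bound
    for the real parts. *)
Lemma min_re_gt0 n (A : 'M[R]_n) : (0 < n)%N ->
  (forall l, eigenvalue (cplx A) l -> 0 < complex.Re l) ->
  0 < min_re A /\ forall l, eigenvalue (cplx A) l -> min_re A <= complex.Re l.
Proof.
move=> n0 A0; split; last first.
  move=> l Al; apply: ge_inf; last by exists l.
  by exists 0 => _ [w /A0 /ltW h <-].
have [s Hs] := spectrum_finite A.
have [c c0 Hc] : exists2 c : R, 0 < c & forall l, l \in s ->
    eigenvalue (cplx A) l -> c <= complex.Re l.
  elim: s {Hs} => [|z s [c c0 Hc]]; first by exists 1.
  have [Az|nAz] := boolP (eigenvalue (cplx A) z).
    exists (Num.min (complex.Re z) c); first by rewrite lt_min A0.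
    move=> w; rewrite inE => /predU1P[->|/Hc h /h].
      by rewrite ge_min lexx.
    by move=> {}h; rewrite ge_min h orbT.
  exists c => // w; rewrite inE => /predU1P[->|/Hc//].
  by rewrite (negbTE nAz).
apply: (lt_le_trans c0); apply: lb_le_inf.
  have [l Al] := eigenvalue_closed (cplx A) n0.
  by exists (complex.Re l), l.
by move=> _ [w Aw <-]; exact: Hc (Hs _ Aw) Aw.
Qed.

Lemma eigenvalue_opp n (A : 'M[R]_n) l :
  eigenvalue (cplx (- A)) l -> eigenvalue (cplx A) (- l).
Proof.
move=> /eigenvalueP[v Av v0]; apply/eigenvalueP; exists v => //.
by rewrite scaleNr -Av map_mxN mulmxN opprK.
Qed.

End ComplexMatrices.

(** * Quadratic Lyapunov functions from spectral bounds *)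

Section SpectralLyapunov.
Context {R : realType}.
Local Notation cplx := (map_mx (real_complex R)).

Lemma qform1_col_mx m n (u : 'cV[R]_m) (v : 'cV[R]_n) :
  qform 1%:M (col_mx u v) = qform 1%:M u + qform 1%:M v.
Proof. by rewrite /qform !mulmx1 tr_col_mx mul_row_col mxE. Qed.

(** Scaling Schur coordinates by D = diag(e^i) multiplies the entry (i, j) of the lower triangular
    factor by e^(i - j). The off-diagonal part becomes small, diagonalizable or not, and fits into
    the strict gap between g and the real parts. The factor L is returned because the Gram form of
    L^T L is needed later. *)
Lemma lyapunov_of_spectrum n (A : 'M[R]_n) (g : R) :
  (forall l, eigenvalue (cplx A) l -> complex.Re l < g) ->
  exists m (L : 'M[R]_(m, n)), (forall x, x != 0 -> 0 < qform (L^T *m L) x) /\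
    forall x, qform (L^T *m L *m A) x <= g * qform (L^T *m L) x.
Proof.
move=> Ag; have [Ur [Ui [Tr [Ti [UrA UiA Ttrig Teig Uinj]]]]] := real_schur A.
(* In the double sum below each w_i receives n c from its row and n c from its column. *)
have [c c0 Hc] : exists2 c : R, 0 < c & forall i, Tr i i + 2 * n%:R * c <= g.
  have [c c0 Hc] : exists2 c : R, 0 < c & forall i, Tr i i + c <= g.
    have lt i : 0 < g - Tr i i by rewrite subr_gt0; exact: Ag (Teig i).
    exists (\big[Num.min/1]_i (g - Tr i i)).
      by apply: lt_bigmin => // i _.
    by move=> i; rewrite -lerBrDl; exact: bigmin_le_cond.
  have n1 : 0 < 2 * n%:R + 1 :> R by rewrite ltr_wpDl // mulr_ge0.
  exists (c / (2 * n%:R + 1)) => [|i]; first by rewrite divr_gt0.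
  apply: le_trans (Hc i); rewrite lerD2l mulrCA ger_pMr //.
  by rewrite ler_pdivrMr // mul1r lerDl.
pose b := `|Tr| + `|Ti|.
(* e b <= c bounds the scaled entries next to the diagonal, and e <= 1 makes the farther ones
   smaller still. *)
pose e := Num.min 1 (c / (b + 1)).
have b0 : 0 <= b by rewrite addr_ge0.
have e0 : 0 < e by rewrite lt_min ltr01 divr_gt0 // ltr_wpDl.
have e1 : e <= 1 by rewrite ge_min lexx.
have eb : e * b <= c.
  apply: (@le_trans _ _ (c / (b + 1) * b)).
    by rewrite ler_wpM2r // ge_min lexx orbT.
  by rewrite mulrAC ler_pdivrMr ?ltr_wpDl // ler_pM2l // lerDl.
pose D : 'M[R]_n := diag_mx (\row_i e ^+ i).
pose sc (T : 'M[R]_n) : 'M[R]_n := \matrix_(i, j) (e ^+ i * T i j / e ^+ j).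
have en0 k : e ^+ k != 0 by rewrite expf_neq0 ?gt_eqF.
have DT T : D *m T = sc T *m D.
  apply/matrixP => i j; rewrite mul_mx_diag mul_diag_mx !mxE.
  by rewrite divfK.
have sc_diag T i : sc T i i = T i i by rewrite mxE mulrAC divff // mul1r.
have sc_le (T : 'M[R]_n) i j : `|T| <= b -> (forall i j : 'I_n, (i < j)%N -> T i j = 0) ->
    i != j -> `|sc T i j| <= c.
  move=> Tb T0 ij; rewrite mxE.
  have [lt|ge] := ltnP i j; first by rewrite T0 // mulr0 mul0r normr0 ltW.
  have ji : (j < i)%N by rewrite ltn_neqAle ge andbT eq_sym.
  have -> : e ^+ i * T i j / e ^+ j = e ^+ (i - j) * T i j.
    by rewrite mulrAC -{1}(subnK ge) exprD mulfK.
  rewrite normrM ger0_norm ?exprn_ge0 ?(ltW e0) //; apply: le_trans eb.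
  apply: ler_pM => //; first by rewrite exprn_ge0 // ltW.
    by rewrite -[leRHS]expr1 ler_wiXn2l ?subn_gt0 // ltW.
  exact: le_trans (normr_entry_le _ _ _) Tb.
pose L := col_mx (D *m Ur) (D *m Ui).
have Lx x : L *m x = col_mx (D *m Ur *m x) (D *m Ui *m x) by rewrite mul_col_mx.
exists (n + n)%N, L; split.
  move=> x x0; rewrite qform_gram qform1_gt0 //; apply: contra_neq x0.
  rewrite Lx -[0]col_mx0 => /eq_col_mx[].
  have Dinj (z : 'cV[R]_n) : D *m z = 0 -> z = 0.
    move=> Dz; apply/colP => i; have := congr1 (fun M : 'cV[R]_n => M i 0) Dz.
    by rewrite mul_diag_mx !mxE => /eqP; rewrite mulf_eq0 (negbTE (en0 i)) => /eqP.
  by rewrite -!mulmxA => /Dinj h1 /Dinj h2; exact: Uinj.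
move=> x; rewrite qform_gram Lx qform1_col_mx !qform1E.
set u := D *m Ur *m x; set v := D *m Ui *m x.
have -> : qform (L^T *m L *m A) x =
    (u^T *m (sc Tr *m u - sc Ti *m v) + v^T *m (sc Tr *m v + sc Ti *m u)) 0 0.
  have uA : D *m Ur *m A *m x = sc Tr *m u - sc Ti *m v.
    by rewrite -(mulmxA D) UrA mulmxBr !mulmxA !DT mulmxBl.
  have vA : D *m Ui *m A *m x = sc Tr *m v + sc Ti *m u.
    by rewrite -(mulmxA D) UiA mulmxDr !mulmxA !DT mulmxDl.
  have LAx : L *m A *m x = col_mx (D *m Ur *m A *m x) (D *m Ui *m A *m x).
    by rewrite !mul_col_mx.
  have -> : qform (L^T *m L *m A) x = ((L *m x)^T *m (L *m A *m x)) 0 0.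
    by rewrite /qform trmx_mul !mulmxA.
  by rewrite LAx Lx tr_col_mx mul_row_col uA vA.
have -> : (u^T *m (sc Tr *m u - sc Ti *m v) + v^T *m (sc Tr *m v + sc Ti *m u)) 0 0 =
  \sum_i \sum_j (sc Tr i j * (u i 0 * u j 0 + v i 0 * v j 0)
                + sc Ti i j * (v i 0 * u j 0 - u i 0 * v j 0)).
  rewrite !mxE -big_split; apply: eq_bigr => i _; rewrite !mxE /=.
  rewrite -sumrB -big_split /= !mulr_sumr -big_split; apply: eq_bigr => j _ /=.
  ring.
pose w i := u i 0 ^+ 2 + v i 0 ^+ 2.
have w0 i : 0 <= w i by rewrite addr_ge0 ?sqr_ge0.
have -> : \sum_i u i 0 ^+ 2 + \sum_i v i 0 ^+ 2 = \sum_i w i by rewrite big_split.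
apply: (@le_trans _ _ (\sum_i \sum_j ((if i == j then Tr i i * w i else 0)
     + c * (w i + w j)))).
  apply: ler_sum => i _; apply: ler_sum => j _.
  have [<-|ij] := eqVneq i j.
    rewrite !sc_diag -lerBlDl.
    (* The imaginary part of an eigenvalue only rotates (u_i, v_i), and its contribution cancels. *)
    have -> : Tr i i * (u i 0 * u i 0 + v i 0 * v i 0) +
      Ti i i * (v i 0 * u i 0 - u i 0 * v i 0) - Tr i i * w i = 0 by rewrite /w; ring.
    by apply: mulr_ge0; [exact: ltW|exact: addr_ge0].
  have Trb : `|Tr| <= b by rewrite lerDl.
  have Tib : `|Ti| <= b by rewrite lerDr.
  have h1 := sc_le Tr i j Trb (fun i j h => (Ttrig i j h).1) ij.
  have h2 := sc_le Ti i j Tib (fun i j h => (Ttrig i j h).2) ij.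
  rewrite add0r (le_trans (ler_norm _)) // (le_trans (ler_normD _ _)) // !normrM.
  have h3 : `|u i 0 * u j 0 + v i 0 * v j 0| <= (w i + w j) / 2.
    rewrite ler_norml /w; apply/andP; split.
      have := sqr_ge0 (u i 0 + u j 0); have := sqr_ge0 (v i 0 + v j 0); lra.
    have := sqr_ge0 (u i 0 - u j 0); have := sqr_ge0 (v i 0 - v j 0); lra.
  have h4 : `|v i 0 * u j 0 - u i 0 * v j 0| <= (w i + w j) / 2.
    rewrite ler_norml /w; apply/andP; split.
      have := sqr_ge0 (v i 0 + u j 0); have := sqr_ge0 (u i 0 - v j 0); lra.
    have := sqr_ge0 (v i 0 - u j 0); have := sqr_ge0 (u i 0 + v j 0); lra.
  apply: (@le_trans _ _ (c * ((w i + w j) / 2) + c * ((w i + w j) / 2))).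
    by apply: lerD; apply: ler_pM.
  by rewrite -mulrDr -splitr.
rewrite mulr_sumr -subr_ge0.
have -> : \sum_i \sum_j ((if i == j then Tr i i * w i else 0) + c * (w i + w j)) =
   \sum_i (Tr i i + 2 * n%:R * c) * w i.
  have -> : \sum_i (Tr i i + 2 * n%:R * c) * w i =
    \sum_i Tr i i * w i + 2 * n%:R * c * \sum_i w i.
    by rewrite mulr_sumr -big_split; apply: eq_bigr => i _; rewrite mulrDl.
  under eq_bigr do rewrite big_split /=; rewrite big_split /=; congr (_ + _).
    apply: eq_bigr => i _; rewrite (bigD1 i) //= eqxx big1 ?addr0 // => j ji.
    by rewrite eq_sym (negbTE ji).
  under eq_bigr do rewrite -mulr_sumr big_split /= sumr_const card_ord.
  rewrite -mulr_sumr big_split /= sumr_const card_ord sumrMnl.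
  by rewrite -(mulr_natr (\sum_i w i)); ring.
rewrite -sumrB sumr_ge0 // => i _; rewrite -mulrBl mulr_ge0 // subr_ge0.
exact: Hc.
Qed.

End SpectralLyapunov.

(** * Eigenvalues of the follower Laplacian *)

Section FollowerLaplacian.
Context {R : realType} {N : nat}.
Variables (E : rel 'I_N.+1) (a : 'M[R]_N.+1).
Hypotheses (ha : weighted_adjacency E a) (hE : spanning_tree_from_leader E).
Let H := follower_laplacian a.
Local Notation f := (lift (ord0 : 'I_N.+1)).
Local Notation norm := (@Normc.normc R).

Lemma adjacency_ge0 i j : 0 <= a i j.
Proof.
have [aii [apos azero]] := ha; have [->|ij] := eqVneq i j; first by rewrite aii.
by have [/(apos _ _ ij)/ltW//|/(azero _ _ ij)->] := boolP (E j i).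
Qed.

Lemma follower_laplacianE i j :
  H i j = if i == j then a (f i) ord0 + \sum_k a (f i) (f k) else - a (f i) (f j).
Proof.
by rewrite !mxE (inj_eq lift_inj) big_ord_recl.
Qed.

Lemma normc_sum (I : finType) (F : I -> R[i]) : norm (\sum_i F i) <= \sum_i norm (F i).
Proof.
elim/big_ind2 : _ => [|x1 x2 y1 y2 h1 h2|//].
  by rewrite Normc.normc0.
by apply: le_trans (le_normcD _ _) _; exact: lerD.
Qed.

Lemma normc_ge_Re (z : R[i]) : complex.Re z <= norm z.
Proof.
case: z => x y /=; apply: le_trans (ler_norm _) _.
by rewrite -sqrtr_sqr ler_wsqrtr // lerDl sqr_ge0.
Qed.

(* The entries of largest modulus of a right eigenvector with Re l <= 0 would
   be closed under taking in-neighbours, and have no edge from the leader. *)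
Lemma follower_eigenvalue_gt0 l :
  eigenvalue (map_mx (real_complex R) H) l -> 0 < complex.Re l.
Proof.
move=> Hl; rewrite ltNge; apply/negP => Rel.
(* [eigenvalue] speaks of row vectors, whereas the maximum modulus argument needs a column; a matrix
   and its transpose have the same characteristic polynomial. *)
have [x x0 Hx] : exists2 x : 'cV[R[i]]_N, x != 0 &
    map_mx (real_complex R) H *m x = l *: x.
  have : eigenvalue (map_mx (real_complex R) H)^T l.
    suff tr (B : 'M[R[i]]_N) : char_poly B^T = char_poly B.
      by move: Hl; rewrite !eigenvalue_root_char tr.
    rewrite /char_poly /char_poly_mx -[in RHS]det_tr linearB /=.
    by rewrite tr_scalar_mx map_trmx.
  move=> /eigenvalueP[v vH v0]; exists v^T; first by rewrite trmx_eq0.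
  by apply: trmx_inj; rewrite trmx_mul trmxK linearZ /= trmxK.
have Hxi i : (Complex (a (f i) ord0 + \sum_k a (f i) (f k)) 0 - l) * x i 0 =
    \sum_k Complex (a (f i) (f k)) 0 * x k 0.
  have := congr1 (fun M : 'cV[R[i]]_N => M i 0) Hx.
  pose h k := if i == k then a (f i) ord0 + \sum_k a (f i) (f k) else - a (f i) (f k).
  have mapE k : map_mx (real_complex R) H i k = Complex (h k) 0.
    by rewrite mxE follower_laplacianE.
  rewrite /= mxE [RHS]mxE mulrBl => <-.
  rewrite (eq_bigr (fun k => Complex (h k) 0 * x k 0)); last first.
    by move=> k _; congr (_ * _); exact: mapE.
  have hi : h i = a (f i) ord0 + \sum_k a (f i) (f k) by rewrite /h eqxx.
  have hk k : k != i -> h k = - a (f i) (f k).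
    by rewrite /h eq_sym => /negbTE ->.
  clearbody h; rewrite [X in _ - X](bigD1 i) // [in RHS](bigD1 i) //= hi.
  have -> : a (f i) (f i) = 0 by have [-> _] := ha.
  rewrite opprD addrA subrr add0r.
  have -> : Complex (0 : R) 0 = 0 by [].
  rewrite mul0r add0r -sumrN; apply: eq_bigr => k ki.
  rewrite hk // -mulNr; congr (_ * _).
  by apply/eqP; rewrite eq_complex /= opprK oppr0 !eqxx.
have [i0 i0max] : exists i0, forall i, norm (x i 0) <= norm (x i0 0).
  have [j xj] : exists j, x j 0 != 0.
    apply/existsP; apply: contra_neqT x0; rewrite negb_exists => /forallP h.
    by apply/colP => i; rewrite mxE; apply/eqP; have := h i; rewrite negbK.
  have [i _ imax] := Order.TotalTheory.arg_maxP (fun i => norm (x i 0))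
    (erefl true : predT j).
  by exists i => k; exact: imax.
set M := norm (x i0 0) in i0max.
have M0 : 0 < M.
  rewrite lt_neqAle; apply/andP; split; last first.
    by rewrite /M; case: (x i0 0) => ? ?; exact: sqrtr_ge0.
  apply: contra_neq x0 => M0; apply/colP => i; rewrite mxE.
  apply: Normc.eq0_normc; apply/eqP; rewrite eq_le {1}M0 i0max /=.
  by case: (x i 0) => ? ?; exact: sqrtr_ge0.
pose Q (k : 'I_N.+1) := exists2 j, k = f j & norm (x j 0) = M.
have step u v : E u v -> Q v -> Q u.
  move=> Euv [i vi xi]; rewrite vi in Euv.
  (* With d the total weight into node i, |d - l| >= d - Re l >= d because Re l <= 0; then the
     triangle inequality is applied to row i. *)
  have le1 : (a (f i) ord0 + \sum_k a (f i) (f k)) * M <=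
      \sum_k a (f i) (f k) * norm (x k 0).
    apply: (@le_trans _ _ (norm (\sum_k Complex (a (f i) (f k)) 0 * x k 0))).
      rewrite -Hxi Normc.normcM xi ler_wpM2r ?(ltW M0) //.
      apply: le_trans (normc_ge_Re _).
      by case: l Rel {Hl Hx Hxi} => lr li /= Rel; rewrite lerDl oppr_ge0.
    apply: le_trans (normc_sum _) _; apply: ler_sum => k _.
    rewrite Normc.normcM ler_wpM2r //.
      by case: (x k 0) => ? ?; exact: sqrtr_ge0.
    by rewrite /= expr0n /= addr0 sqrtr_sqr ger0_norm ?adjacency_ge0.
  have [ui|ui] := eqVneq u (f i); first by exists i.
  have au : 0 < a (f i) u by have [_ [apos _]] := ha; apply: apos; rewrite // eq_sym.
  case: (unliftP ord0 u) => [j uj|u0]; last first.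
    exfalso; rewrite u0 in au; move: le1; rewrite leNgt => /negP; apply.
    rewrite mulrDl mulr_suml; apply: ltr_pwDl; first by rewrite mulr_gt0.
    by apply: ler_sum => k _; rewrite ler_wpM2l ?adjacency_ge0.
  exists j => //; apply/eqP; rewrite eq_le i0max /= leNgt; apply/negP => xj.
  move: le1; rewrite leNgt => /negP; apply.
  rewrite mulrDl mulr_suml; apply: ltr_wpDl.
    by rewrite mulr_ge0 ?adjacency_ge0 ?ltW.
  rewrite (bigD1 j) //= [ltRHS](bigD1 j) //=; apply: ltr_leD.
    by rewrite ltr_pM2l // -uj.
  by apply: ler_sum => k _; rewrite ler_wpM2l ?adjacency_ge0.
have back u p : path E u p -> Q (last u p) -> Q u.
  elim: p u => [//|v p IH] u /= /andP[Euv pv] /IH h.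
  by apply: step Euv _; exact: h.
have /connectP[p pp lp] := hE (f i0).
have [j /eqP] : Q ord0 by apply: back pp _; rewrite -lp; exists i0.
by rewrite (negbTE (neq_lift _ _)).
Qed.

End FollowerLaplacian.

(** * Solutions of the closed loop *)

Section FamilyODE.
Context {R : realType} {N m : nat}.
Implicit Types x y : 'I_N -> R -> 'cV[R]_m.

Lemma continuous_bounded k l (f : R -> 'M[R]_(k, l)) (T : R) : continuous f ->
  exists2 B, 0 <= B & forall t, 0 <= t <= T -> `|f t| <= B.
Proof.
move=> cf; have [T0|T0] := leP 0 T; last first.
  by exists 0 => // t /andP[t0 /(le_trans t0)]; rewrite leNgt T0.
have [|c _ Hc] := @EVT_max R (fun t => `|f t|) 0 T T0.
  by apply: continuous_subspaceT => t; apply: cvg_norm; exact: cf.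
by exists `|f c| => // t tT; apply: Hc; rewrite in_itv.
Qed.

(** With one row per follower, left multiplication by the Laplacian mixes followers and right
    multiplication acts on each state. *)
Definition pack (x : 'I_N -> 'cV[R]_m) : 'M[R]_(N, m) := \matrix_(k, j) x k j 0.
Definition unpack (X : 'M[R]_(N, m)) (k : 'I_N) : 'cV[R]_m := \col_j X k j.

Lemma packK : cancel pack unpack.
Proof.
by move=> z; apply/funext => k; apply/colP => j; rewrite !mxE.
Qed.

Lemma unpackK : cancel unpack pack.
Proof. by move=> X; apply/matrixP => k j; rewrite !mxE. Qed.

Lemma normr_pack_le (z : 'I_N -> 'cV[R]_m) d : 0 <= d ->
  (forall k, `|z k| <= d) -> `|pack z| <= d.
Proof.
move=> d0 zd; apply/normr_mx_le => // k j; rewrite mxE.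
exact: le_trans (normr_entry_le _ _ _) (zd k).
Qed.

Lemma normr_unpack_le (X : 'M[R]_(N, m)) k : `|unpack X k| <= `|X|.
Proof. by apply/normr_mx_le => // i j; rewrite mxE normr_entry_le. Qed.

Lemma unpackB (X Y : 'M[R]_(N, m)) k : unpack (X - Y) k = unpack X k - unpack Y k.
Proof. by apply/colP => j; rewrite !mxE. Qed.

Lemma packB (z w : 'I_N -> 'cV[R]_m) : pack z - pack w = pack (fun k => z k - w k).
Proof. by apply/matrixP => k j; rewrite !mxE. Qed.

Lemma cvg_pack (T : Type) (F : set_system T) {FF : Filter F}
    (z : T -> 'I_N -> 'cV[R]_m) (z0 : 'I_N -> 'cV[R]_m) :
  (forall k, z t k @[t --> F] --> z0 k) -> pack (z t) @[t --> F] --> pack z0.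
Proof.
move=> h; apply/cvg_mxP => k j; rewrite mxE; under eq_fun do rewrite mxE.
by move/cvg_mxP : (h k); exact.
Qed.

Lemma cvg_unpack (T : Type) (F : set_system T) {FF : Filter F}
    (X : T -> 'M[R]_(N, m)) (X0 : 'M[R]_(N, m)) k :
  X t @[t --> F] --> X0 -> unpack (X t) k @[t --> F] --> unpack X0 k.
Proof.
move=> /cvg_mxP h; apply/cvg_mxP => i j; rewrite mxE; under eq_fun do rewrite mxE.
exact: h.
Qed.

Lemma is_derive_pack (z : R -> 'I_N -> 'cV[R]_m) (t : R) dz :
  (forall k, is_derive t 1 (fun s => z s k) (dz k)) ->
  is_derive t 1 (fun s => pack (z s)) (pack dz).
Proof.
move=> h; apply/is_derive_mxP => k j; rewrite mxE; under eq_fun do rewrite mxE.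
by move/is_derive_mxP : (h k); exact.
Qed.

Lemma is_derive_unpack (X : R -> 'M[R]_(N, m)) (t : R) DX k :
  is_derive t 1 X DX -> is_derive t 1 (fun s => unpack (X s) k) (unpack DX k).
Proof.
move=> /is_derive_mxP h; apply/is_derive_mxP => i j.
by rewrite mxE; under eq_fun do rewrite mxE; exact: h.
Qed.

Variable Phi : R -> ('I_N -> 'cV[R]_m) -> 'I_N -> 'cV[R]_m.
Hypothesis Phi_continuous : forall x, (forall k, continuous (x k)) ->
  forall k, continuous (fun t => Phi t (fun l => x l t) k).
Hypothesis Phi_lipschitz : forall T : R, exists L : R, forall t z w d,
  0 <= t <= T -> (forall k, `|z k - w k| <= d) ->
  forall k, `|Phi t z k - Phi t w k| <= L * d.

Let F t X := pack (Phi t (unpack X)).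

Let F_lipschitz (T : R) : exists L : R, forall (t : R) (X Y : 'M[R]_(N, m)),
  0 <= t <= T -> `|F t X - F t Y| <= L * `|X - Y|.
Proof.
have [L HL] := Phi_lipschitz T; exists `|L| => t X Y tT; rewrite /F packB.
apply: normr_pack_le => [|k]; first by rewrite mulr_ge0.
apply: (@le_trans _ _ (L * `|X - Y|)); last by rewrite ler_wpM2r // ler_norm.
by apply: HL tT _ _ => l; rewrite -unpackB normr_unpack_le.
Qed.

Lemma family_ode_exists (x0 : 'I_N -> 'cV[R]_m) :
  exists x, forall k, [/\ continuous (x k), x k 0 = x0 k
    & forall t : R, 0 < t -> is_derive t 1 (x k) (Phi t (fun l => x l t) k)].
Proof.
have cF X : continuous X -> continuous (fun t => F t (X t)).
  move=> cX t; apply: cvg_pack => k.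
  apply: (@Phi_continuous (fun l s => unpack (X s) l)) => l s.
  by apply: cvg_unpack; exact: cX.
have [X [cX X0 dX]] := lipschitz_ode_exists (pack x0) cF F_lipschitz.
exists (fun k t => unpack (X t) k) => k; split.
- by move=> t; apply: cvg_unpack; exact: cX.
- by rewrite X0 packK.
- move=> t t0; have := is_derive_unpack k (dX t t0).
  by rewrite /F packK.
Qed.

Lemma family_ode_unique x y (T : R) :
  (forall k, x k t @[t --> 0^'+] --> x k 0) ->
  (forall k, y k t @[t --> 0^'+] --> y k 0) ->
  (forall k, x k 0 = y k 0) ->
  (forall k (t : R), 0 < t -> t <= T -> is_derive t 1 (x k) (Phi t (fun l => x l t) k)) ->
  (forall k (t : R), 0 < t -> t <= T -> is_derive t 1 (y k) (Phi t (fun l => y l t) k)) ->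
  0 <= T -> forall k, x k T = y k T.
Proof.
move=> x0 y0 xy0 dx dy T0 k.
suff : pack (fun k => x k T) = pack (fun k => y k T).
  by move/(can_inj packK) => /(congr1 (fun z => z k)).
apply: (@lipschitz_ode_unique _ _ _ F (fun t => pack (fun k => x k t))
  (fun t => pack (fun k => y k t))) => //.
- by apply: cvg_pack => l; exact: x0.
- by apply: cvg_pack => l; exact: y0.
- by congr pack; apply/funext.
- move=> t t0 tT; rewrite /F packK; apply: is_derive_pack => l; exact: dx.
- move=> t t0 tT; rewrite /F packK; apply: is_derive_pack => l; exact: dy.
Qed.

End FamilyODE.

(** * Well-posedness of the cascade *)

Section ClosedLoopSolutions.
Context {R : realType} {q p n N : nat}.
Variables (S0 : 'M[R]_q.+1) (C0 : 'M[R]_(p, q.+1)) (a : 'M[R]_N.+1).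
Variables (mu_a mu_z : R).

Lemma with_leader_diff m (c : 'cV[R]_m) (x y : 'I_N -> 'cV[R]_m) d j : 0 <= d ->
  (forall k, `|x k - y k| <= d) -> `|with_leader c x j - with_leader c y j| <= d.
Proof.
move=> d0 xyd; rewrite /with_leader; case: (unlift ord0 j) => [k|]; first exact: xyd.
by rewrite subrr normr0.
Qed.

Lemma coupling_lipschitz m (c : 'cV[R]_m) : exists2 K, 0 <= K &
  forall (x y : 'I_N -> 'cV[R]_m) d k, 0 <= d -> (forall k, `|x k - y k| <= d) ->
    `|coupling a (with_leader c x) k - coupling a (with_leader c y) k| <= K * d.
Proof.
exists (\sum_i \sum_j `|a i j| * 2).
  by apply: sumr_ge0 => i _; apply: sumr_ge0 => j _; rewrite mulr_ge0.
move=> x y d k d0 xyd; rewrite /coupling; set i := lift ord0 k.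
rewrite -sumrB (le_trans (ler_norm_sum _ _ _)) //.
apply: (@le_trans _ _ ((\sum_j `|a i j| * 2) * d)); last first.
  rewrite ler_wpM2r // [leRHS](bigD1 i) //= lerDl sumr_ge0 // => l _.
  by apply: sumr_ge0 => j _; rewrite mulr_ge0.
rewrite mulr_suml; apply: ler_sum => j _.
rewrite -scalerBr normrZ -mulrA ler_wpM2l //.
have h l := with_leader_diff c l d0 xyd.
move: (h j) (h i); move: (with_leader c x j) (with_leader c x i)
  (with_leader c y j) (with_leader c y i) => xj xi yj yi hj hi.
have -> : xj - xi - (yj - yi) = (xj - yj) - (xi - yi).
  by apply/matrixP => s r; rewrite !(addmxE, oppmxE); ring.
by rewrite (le_trans (ler_normB _ _)) // mulr_natl mulr2n lerD.
Qed.

Lemma cvg_coupling (T : Type) (F : set_system T) {FF : Filter F} m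
    (x : T -> 'I_N.+1 -> 'cV[R]_m) (x0 : 'I_N.+1 -> 'cV[R]_m) k :
  (forall j, x t j @[t --> F] --> x0 j) ->
  coupling a (x t) k @[t --> F] --> coupling a x0 k.
Proof.
move=> h; apply/cvg_mxP => i j.
have -> : coupling a x0 k i j =
    \sum_l a (lift ord0 k) l * (x0 l i j - x0 (lift ord0 k) i j).
  by rewrite summxE; apply: eq_bigr => l _; rewrite !mxE.
have -> : (fun t => coupling a (x t) k i j) =
    (fun t => \sum_l a (lift ord0 k) l * (x t l i j - x t (lift ord0 k) i j)).
  by apply/funext => t; rewrite summxE; apply: eq_bigr => l _; rewrite !mxE.
apply: cvg_sum_fin => l; apply: cvgM; first exact: cvg_cst.
by apply: cvgB; [move/cvg_mxP : (h l)|move/cvg_mxP : (h (lift ord0 k))]; exact.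
Qed.

Lemma cvg_with_leader (T : Type) (F : set_system T) {FF : Filter F} m
    (c : T -> 'cV[R]_m) (c0 : 'cV[R]_m) (x : T -> 'I_N -> 'cV[R]_m) x0 j :
  c t @[t --> F] --> c0 -> (forall k, x t k @[t --> F] --> x0 k) ->
  with_leader (c t) (x t) j @[t --> F] --> with_leader c0 x0 j.
Proof. by move=> cc xx; rewrite /with_leader; case: (unlift ord0 j). Qed.

Definition leader_field (t : R) (v : 'M[R]_(q.+1, 1)) : 'M[R]_(q.+1, 1) := S0 *m v.

Definition alpha_field (t : R) (x : 'I_N -> 'cV[R]_n) (k : 'I_N) : 'cV[R]_n :=
  mu_a *: coupling a (with_leader (minpoly_coeffs n S0) x) k.

(** In the cascade [v0] and [alpha] are given functions of time at this level, so the field is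
    affine in z. *)
Definition zeta_field (v0 : R -> 'cV[R]_q.+1) (alpha : 'I_N -> R -> 'cV[R]_n)
    (t : R) (z : 'I_N -> 'cV[R]_(n * p)) (k : 'I_N) : 'cV[R]_(n * p) :=
  calS p (alpha k t) *m z k
  + mu_z *: (calP p (alpha k t) *m (calC R n p)^T *m coupling a (outputs C0 (v0 t) z) k).

Lemma leader_field_lipschitz : exists L : R, forall (t : R) x y,
  `|leader_field t x - leader_field t y| <= L * `|x - y|.
Proof.
exists (q.+1%:R * `|S0|) => t x y.
by rewrite /leader_field -mulmxBr -mulrA normr_mulmx_le.
Qed.

Lemma alpha_field_continuous (x : 'I_N -> R -> 'cV[R]_n) :
  (forall k, continuous (x k)) ->
  forall k, continuous (fun t => alpha_field t (fun l => x l t) k).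
Proof.
move=> cx k t; have FF := nbhs_filter t.
apply: cvgZr; apply: (@cvg_coupling _ _ FF) => j.
by apply: (@cvg_with_leader _ _ FF); [exact: cvg_cst|move=> l; exact: cx].
Qed.

Lemma alpha_field_lipschitz (T : R) : exists L : R, forall t z w d,
  0 <= t <= T -> (forall k, `|z k - w k| <= d) ->
  forall k, `|alpha_field t z k - alpha_field t w k| <= L * d.
Proof.
have [K K0 HK] := coupling_lipschitz (minpoly_coeffs n S0).
exists (`|mu_a| * K) => t z w d _ zwd k.
have d0 : 0 <= d := le_trans (normr_ge0 _) (zwd k).
by rewrite /alpha_field -scalerBr normrZ -mulrA ler_wpM2l // HK.
Qed.

Section ZetaField.
Variables (v0 : R -> 'cV[R]_q.+1) (alpha : 'I_N -> R -> 'cV[R]_n).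
Hypotheses (cv0 : continuous v0) (calpha : forall k, continuous (alpha k)).

Let cS k : continuous (fun t => calS p (alpha k t)).
Proof. by move=> t; apply: (@cvg_calS _ _ _ (nbhs_filter t)); exact: calpha. Qed.

Let cP k : continuous (fun t => calP p (alpha k t)).
Proof. by move=> t; apply: (@cvg_calP _ _ _ (nbhs_filter t)); exact: calpha. Qed.

Lemma zeta_field_continuous (x : 'I_N -> R -> 'cV[R]_(n * p)) :
  (forall k, continuous (x k)) ->
  forall k, continuous (fun t => zeta_field v0 alpha t (fun l => x l t) k).
Proof.
move=> cx k t; have FF := nbhs_filter t.
apply: (@cvgD _ _ _ _ FF).
  by apply: (@cvg_mulmx _ _ _ FF); [exact: cS|exact: cx].
apply: cvgZr; apply: (@cvg_mulmx _ _ _ FF).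
  by apply: (@cvg_mulmx _ _ _ FF); [exact: cP|exact: cvg_cst].
apply: (@cvg_coupling _ _ FF) => j; apply: (@cvg_with_leader _ _ FF).
  by apply: (@cvg_mulmx _ _ _ FF); [exact: cvg_cst|exact: cv0].
by move=> l; apply: (@cvg_mulmx _ _ _ FF); [exact: cvg_cst|exact: cx].
Qed.

Lemma zeta_field_lipschitz (T : R) : exists L : R, forall t z w d,
  0 <= t <= T -> (forall k, `|z k - w k| <= d) ->
  forall k, `|zeta_field v0 alpha t z k - zeta_field v0 alpha t w k| <= L * d.
Proof.
have [BS BS0 HBS] : exists2 B, 0 <= B & forall k t, 0 <= t <= T ->
    `|calS p (alpha k t)| <= B.
  have /choice[B HB] k : exists B, 0 <= B /\ forall t, 0 <= t <= T ->
      `|calS p (alpha k t)| <= B.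
    by have [B B0 HB] := continuous_bounded T (@cS k); exists B.
  exists (\sum_k B k); first by apply: sumr_ge0 => k _; case: (HB k).
  move=> k t tT; have [_ /(_ t tT) h] := HB k; apply: le_trans h _.
  by rewrite (bigD1 k) //= lerDl sumr_ge0 // => l _; case: (HB l).
have [BP BP0 HBP] : exists2 B, 0 <= B & forall k t, 0 <= t <= T ->
    `|calP p (alpha k t)| <= B.
  have /choice[B HB] k : exists B, 0 <= B /\ forall t, 0 <= t <= T ->
      `|calP p (alpha k t)| <= B.
    by have [B B0 HB] := continuous_bounded T (@cP k); exists B.
  exists (\sum_k B k); first by apply: sumr_ge0 => k _; case: (HB k).
  move=> k t tT; have [_ /(_ t tT) h] := HB k; apply: le_trans h _.
  by rewrite (bigD1 k) //= lerDl sumr_ge0 // => l _; case: (HB l).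
set m := (n * p)%N; set C := calC R n p.
pose L1 := m%:R * BS.
pose L2 K := `|mu_z| * (p%:R * ((m%:R * (BP * `|C^T|)) * (K * (m%:R * `|C|)))).
have [K K0 HK] : exists2 K, 0 <= K & forall t (x y : 'I_N -> 'cV[R]_p) d k, 0 <= d ->
    (forall k, `|x k - y k| <= d) ->
    `|coupling a (with_leader (C0 *m v0 t) x) k -
      coupling a (with_leader (C0 *m v0 t) y) k| <= K * d.
  have [K K0 HK] := coupling_lipschitz (0 : 'cV[R]_p).
  exists K => // t x y d k d0 xyd.
  (* The coupling is invariant under translation, so the leader value can be moved to 0 and K does
     not depend on t. *)
  have wl (c : 'cV[R]_p) (u : 'I_N -> 'cV[R]_p) : coupling a (with_leader c u) k =
     coupling a (with_leader 0 (fun k => u k - c)) k.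
    apply: eq_bigr => j _; congr (_ *: _); rewrite /with_leader.
    by case: (unlift ord0 j) => [l|]; case: (unlift ord0 (lift ord0 k)) => [l'|] //;
      apply/matrixP => s r; rewrite !mxE; ring.
  rewrite !(wl (C0 *m v0 t)); apply: HK => // l.
  by rewrite opprB addrA subrK.
exists (L1 + L2 K) => t z w d tT zwd k.
have d0 : 0 <= d := le_trans (normr_ge0 _) (zwd k).
rewrite /zeta_field opprD addrACA -mulmxBr -scalerBr -mulmxBr.
rewrite (le_trans (ler_normD _ _)) // mulrDl lerD //.
  rewrite (le_trans (normr_mulmx_le _ _)) // /L1 -!mulrA ler_wpM2l //.
  by apply: ler_pM => //; exact: HBS.
rewrite normrZ /L2 -!(mulrA `|mu_z|) ler_wpM2l //.
rewrite (le_trans (normr_mulmx_le _ _)) // -(mulrA p%:R) ler_wpM2l //.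
rewrite -(mulrA (_ * _)); apply: ler_pM => //.
  rewrite (le_trans (normr_mulmx_le _ _)) // ler_wpM2l // ler_wpM2r //.
  exact: HBP.
rewrite -(mulrA K); apply: HK => [|l]; first by rewrite !mulr_ge0.
rewrite -mulmxBr (le_trans (normr_mulmx_le _ _)) // -(mulrA m%:R).
by rewrite ler_wpM2l // ler_wpM2l.
Qed.

End ZetaField.

Variables (v00 : 'cV[R]_q.+1) (alpha00 : 'I_N -> 'cV[R]_n).
Variable zeta00 : 'I_N -> 'cV[R]_(n * p).
Local Notation ivp T :=
  (ivp_solution_on S0 C0 a mu_a mu_z T v00 alpha00 zeta00).

Lemma closed_loop_exists : exists v0 alpha zeta,
  [/\ ivp +oo%E v0 alpha zeta, continuous v0 & forall k, continuous (alpha k)].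
Proof.
have [||v0 [cv0 v0E dv0]] := @lipschitz_ode_exists _ _ _ leader_field v00.
- move=> X cX t; have FF := nbhs_filter t.
  by apply: (@cvg_mulmx _ _ _ FF); [exact: cvg_cst|exact: cX].
- by move=> T; have [L HL] := leader_field_lipschitz; exists L => *; exact: HL.
have [alpha Halpha] := family_ode_exists alpha_field_continuous
  alpha_field_lipschitz alpha00.
have calpha k : continuous (alpha k) by have [] := Halpha k.
have [zeta Hzeta] := family_ode_exists (@zeta_field_continuous _ _ cv0 calpha)
  (@zeta_field_lipschitz v0 _ calpha) zeta00.
exists v0, alpha, zeta; split => //; split => //.
- split.
  + split; first exact/cvg_at_right_filter/cv0.
    by move=> t t0 _; exact: dv0.
  + move=> k; have [ck _ dk] := Halpha k; split.
      exact/cvg_at_right_filter/ck.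
    by move=> t t0 _; exact: dk.
  + move=> k; have [ck _ dk] := Hzeta k; split.
      exact/cvg_at_right_filter/ck.
    by move=> t t0 _; exact: dk.
- by move=> k; have [] := Halpha k.
- by move=> k; have [] := Hzeta k.
Qed.

(** Uniqueness climbs the cascade. An arbitrary solution need not be continuous at negative times,
    so the Lipschitz bound for the last level uses the coefficients of the globally continuous one;
    the other solution satisfies the same equation once v0 and alpha are identified. *)
Lemma closed_loop_unique (T : \bar R) v0 alpha zeta v0' alpha' zeta' :
  ivp T v0 alpha zeta -> ivp +oo%E v0' alpha' zeta' ->
  (forall k, continuous (alpha' k)) ->
  forall t : R, 0 <= t -> (t%:E < T)%E ->
    [/\ v0' t = v0 t, forall k, alpha' k t = alpha k t
      & forall k, zeta' k t = zeta k t].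
Proof.
move=> [[[v0r dv0] Halpha Hzeta] v0E alphaE zetaE].
move=> [[[v0r' dv0'] Halpha' Hzeta'] v0E' alphaE' zetaE'] calpha'.
have ltT s t : s <= t -> (t%:E < T)%E -> (s%:E < T)%E.
  by move=> st; apply: le_lt_trans; rewrite lee_fin.
have vE t : 0 <= t -> (t%:E < T)%E -> v0' t = v0 t.
  move=> t0 tT; apply: (@lipschitz_ode_unique _ _ _ leader_field v0' v0 t) => //.
  - by rewrite v0E v0E'.
  - by have [L HL] := leader_field_lipschitz; exists L => *; exact: HL.
  - by move=> s s0 st; apply: dv0'; rewrite ?ltry.
  - by move=> s s0 st; apply: dv0 => //; exact: ltT st tT.
have aE t : 0 <= t -> (t%:E < T)%E -> forall k, alpha' k t = alpha k t.
  move=> t0 tT; apply: (family_ode_unique alpha_field_lipschitz) => //.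
  - by move=> k; have [] := Halpha' k.
  - by move=> k; have [] := Halpha k.
  - by move=> k; rewrite alphaE alphaE'.
  - by move=> k s s0 st; have [_ h] := Halpha' k; apply: h; rewrite ?ltry.
  - by move=> k s s0 st; have [_ h] := Halpha k; apply: h => //; exact: ltT st tT.
move=> t t0 tT; split; [exact: vE|exact: aE|].
apply: (family_ode_unique (@zeta_field_lipschitz v0' _ calpha')) => //.
- by move=> k; have [] := Hzeta' k.
- by move=> k; have [] := Hzeta k.
- by move=> k; rewrite zetaE zetaE'.
- by move=> k s s0 st; have [_ h] := Hzeta' k; apply: h; rewrite ?ltry.
- move=> k s s0 st; have [_ h] := Hzeta k; have sT := ltT _ _ st tT.
  by rewrite /zeta_field vE ?aE ?(ltW s0) //; exact: h.
Qed.

End ClosedLoopSolutions.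

(** * Convergence *)

Section Stability.
Context {R : realType}.

Lemma mxtrace_qform m n (Q : 'M[R]_m) (X : 'M[R]_(m, n)) :
  \tr (X^T *m Q *m X) = \sum_j qform Q (col j X).
Proof.
apply: eq_bigr => j _; rewrite /qform mxE [RHS]mxE; apply: eq_bigr => k _.
congr (_ * _); last by rewrite mxE.
by rewrite !mxE; apply: eq_bigr => l _; rewrite !mxE.
Qed.

Lemma mxtrace_qform_gt0 m n (Q : 'M[R]_m) (X : 'M[R]_(m, n)) :
  (forall x, x != 0 -> 0 < qform Q x) -> X != 0 -> 0 < \tr (X^T *m Q *m X).
Proof.
move=> Q0 X0; have [j Xj] : exists j, col j X != 0.
  apply/existsP; apply: contra_neqT X0; rewrite negb_exists => /forallP h.
  apply/matrixP => i j; have := h j; rewrite negbK => /eqP /colP /(_ i).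
  by rewrite !mxE.
have Qge x : 0 <= qform Q x.
  by have [->|/Q0/ltW//] := eqVneq x 0; rewrite /qform mulmx0 mxE.
rewrite mxtrace_qform (bigD1 j) //= ltr_pwDl ?Q0 // sumr_ge0 // => k _.
Qed.

Lemma le_mxtrace_qform m n (Q Q' : 'M[R]_m) (X : 'M[R]_(m, n)) :
  (forall x, qform Q x <= qform Q' x) -> \tr (X^T *m Q *m X) <= \tr (X^T *m Q' *m X).
Proof. by move=> QQ; rewrite !mxtrace_qform ler_sum. Qed.

Lemma continuous_mxtrace_quad m n (Q : 'M[R]_m) (M : 'M[R]_n) :
  continuous (fun X : 'M[R]_(m, n) => \tr (X^T *m Q *m X *m M)).
Proof.
move=> X; have FF := nbhs_filter X; apply: (@cvg_mxtrace _ _ _ FF).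
apply: (@cvg_mulmx _ _ _ FF); last exact: cvg_cst.
apply: (@cvg_mulmx _ _ _ FF); last exact: cvg_id.
apply: (@cvg_mulmx _ _ _ FF); last exact: cvg_cst.
by apply: (@cvg_trmx _ _ _ FF); exact: cvg_id.
Qed.

Lemma mxtrace_quad_scale m n (Q : 'M[R]_m) (M : 'M[R]_n) s (X : 'M[R]_(m, n)) :
  \tr ((s *: X)^T *m Q *m (s *: X) *m M) = s ^+ 2 * \tr (X^T *m Q *m X *m M).
Proof.
have -> : (s *: X)^T = s *: X^T by rewrite linearZ.
by rewrite -!scalemxAl -scalemxAr -scalemxAl scalerA mxtraceZ expr2.
Qed.

(** Gronwall's inequality for tr(U^T Q U). With U a matrix it serves both for the alpha errors of
    all followers and for the leader state. *)
Lemma linear_ode_bound m n (B Q : 'M[R]_m) (g : R) (U : R -> 'M[R]_(m, n)) :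
  Q^T = Q -> (forall x, x != 0 -> 0 < qform Q x) ->
  (forall x, qform (Q *m B) x <= g * qform Q x) ->
  U t @[t --> 0^'+] --> U 0 -> (forall t : R, 0 < t -> is_derive t 1 U (B *m U t)) ->
  exists2 K, 0 <= K & forall t, 0 <= t -> `|U t| ^+ 2 <= K * expR (2 * g * t).
Proof.
move=> Qs Q0 QB U0 dU; pose V (X : 'M[R]_(m, n)) := \tr (X^T *m Q *m X).
have [||c c0 Hc] := @coercive _ m n V _ _ (fun X => @mxtrace_qform_gt0 _ _ _ X Q0).
- have := @continuous_mxtrace_quad _ n Q 1%:M.
  by under eq_fun do rewrite mulmx1.
- by move=> s X; have := mxtrace_quad_scale Q 1%:M s X; rewrite !mulmx1.
have V_le t : 0 <= t -> V (U t) <= V (U 0) * expR (2 * g * (t - 0)).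
  move=> t0; apply: (@gronwall _ (V \o U)
    (fun t => \tr (((B *m U t)^T *m Q) *m U t + ((U t)^T *m Q) *m (B *m U t)))) => //.
    apply: cvg_mxtrace; apply: cvg_mulmx => //.
    by apply: cvg_mulmx; [exact: cvg_trmx|exact: cvg_cst].
  move=> s s0 _; have dUs := dU s s0; split.
    apply: is_derive_mxtrace; apply: is_derive_mulmx => //.
    have := is_derive_mulmx (is_derive_trmx dUs) (is_derive_cst Q s 1).
    by rewrite mulmx0 addr0.
  rewrite mxtraceD -[X in X + _]mxtrace_tr !trmx_mul !trmxK Qs !mulmxA.
  have dbl (x : R) : x + x = 2 * x by ring.
  rewrite dbl -mulrA ler_wpM2l //.
  have -> : g * (V \o U) s = \tr ((U s)^T *m (g *: Q) *m U s).
    by rewrite -scalemxAr -scalemxAl mxtraceZ.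
  by rewrite -(mulmxA _ Q B); apply: le_mxtrace_qform => x; rewrite qformZ.
exists (V (U 0) / c).
  by rewrite divr_ge0 ?(ltW c0) // (le_trans _ (Hc _)) // mulr_ge0 ?(ltW c0) // sqr_ge0.
move=> t /V_le h; rewrite mulrAC ler_pdivlMr // mulrC (le_trans (Hc _)) //.
by rewrite subr0 in h.
Qed.

Lemma cvg0_of_sqr_le (f : R -> R) (K k : R) : 0 < k -> (forall t, 0 <= f t) ->
  (forall t, 0 <= t -> f t ^+ 2 <= K * expR (- k * t)) ->
  f t @[t --> +oo] --> (0 : R).
Proof.
move=> k0 f0 Hf; apply/cvgr0Pnorm_le => e e0.
near=> t; have t0 : 0 <= t by near: t; apply: nbhs_pinfty_ge; exact: num_real.
have kt : k^-1 * (e ^- 2 * K - 1) <= t.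
  by near: t; apply: nbhs_pinfty_ge; exact: num_real.
rewrite ger0_norm // -(ler_pXn2r (ltn0Sn 1)) ?nnegrE ?(ltW e0) //.
apply: le_trans (Hf t t0) _.
have -> : - k * t = - (k * t) by ring.
rewrite expRN ler_pdivrMr ?expR_gt0 // -ler_pdivrMl ?exprn_gt0 //.
apply: le_trans (expR_ge1Dx _); rewrite -lerBlDl.
by rewrite -ler_pdivrMl.
Unshelve. all: by end_near. Qed.

(* The perturbation is absorbed by the dissipation: Young's inequality bounds
   K |E| f by c |E|^2 / 4 + K^2 f^2 / c. *)
Lemma perturbed_stability m n (E : R -> 'M[R]_(m, n)) (V dV h f : R -> R)
    (c1 c2 c3 K : R) : 0 < c1 -> 0 < c2 -> 0 < c3 ->
  (forall t : R, 0 < t -> is_derive t 1 V (dV t)) ->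
  (forall t, c3 * `|E t| ^+ 2 <= V t) -> (forall t, V t <= c2 * `|E t| ^+ 2) ->
  (forall t, 0 < t ->
    dV t <= - c1 * `|E t| ^+ 2 + K * `|E t| * (h t * `|E t| + f t)) ->
  h t @[t --> +oo] --> (0 : R) -> f t @[t --> +oo] --> (0 : R) ->
  E t @[t --> +oo] --> (0 : 'M[R]_(m, n)).
Proof.
move=> c10 c20 c30 dV_ Vge Vle dVle h0 f0.
have V0 t : 0 <= V t by apply: le_trans (Vge t); rewrite mulr_ge0 ?sqr_ge0 // ltW.
have V_cvg : V t @[t --> +oo] --> (0 : R).
  (* Of the dissipation c1, one quarter absorbs the gain h, one quarter goes into Young's
     inequality, and one half remains as decay rate of V. *)
  apply: (@cvg0_of_derive_le _ V dV (fun t => K ^+ 2 / c1 * f t ^+ 2) (c1 / 2 / c2)) => //.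
  - by rewrite !divr_gt0.
  - rewrite -(mulr0 (K ^+ 2 / c1)); apply: cvgM; first exact: cvg_cst.
    have -> : 0 = (0 : R) * 0 by rewrite mulr0.
    by under eq_fun do rewrite expr2; exact: cvgM.
  have Kh : K * h t @[t --> +oo] --> (0 : R).
    by rewrite -(mulr0 K); apply: cvgM => //; exact: cvg_cst.
  have c14 : 0 < c1 / 4 by rewrite divr_gt0.
  near=> t; have t0 : 0 < t by near: t; apply: nbhs_pinfty_gt; exact: num_real.
  have Kht : K * h t <= c1 / 4.
    apply: le_trans (ler_norm _) _; near: t.
    by move/cvgr0Pnorm_le : Kh; exact.
  have H := dVle t t0; apply: le_trans H _; have := Vle t.
  move: `|E t| (normr_ge0 (E t)) => x x0 Vx.
  have -> : - (c1 / 2 / c2) * V t = - (c1 / 2) * (V t / c2) by field; rewrite gt_eqF.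
  have {}Vx : V t / c2 <= x ^+ 2 by rewrite ler_pdivrMr // mulrC.
  have h1 : K * h t * x ^+ 2 <= c1 / 4 * x ^+ 2 by rewrite ler_wpM2r // sqr_ge0.
  have h2 : c1 / 2 * (V t / c2) <= c1 / 2 * x ^+ 2 by rewrite ler_wpM2l // divr_ge0 // ltW.
  have h3 : K * x * f t <= c1 / 4 * x ^+ 2 + K ^+ 2 / c1 * f t ^+ 2.
    have : 0 <= c1 * (x / 2 - K * f t / c1) ^+ 2 by rewrite mulr_ge0 ?sqr_ge0 // ltW.
    have -> : c1 * (x / 2 - K * f t / c1) ^+ 2 =
      c1 / 4 * x ^+ 2 + K ^+ 2 / c1 * f t ^+ 2 - K * x * f t.
      by field; rewrite gt_eqF.
    lra.
  move: (K ^+ 2 / c1 * _) h3 => w h3; lra.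
apply/cvgr0Pnorm_le => e e0.
have ce : 0 < c3 * e ^+ 2 by rewrite mulr_gt0 // exprn_gt0.
move/cvgr0Pnorm_le : V_cvg => /(_ _ ce); apply: filterS => t.
rewrite ger0_norm // => Vt.
rewrite -(ler_pXn2r (ltn0Sn 1)) ?nnegrE ?(ltW e0) // -(ler_pM2l c30).
exact: le_trans (Vge t) Vt.
Unshelve. all: by end_near. Qed.

End Stability.

(** * The leader in companion coordinates *)

Section LeaderCompanion.
Context {R : realType} {q n p : nat}.
Variables (S0 : 'M[R]_q.+1) (C0 : 'M[R]_(p, q.+1)).

(** This is the observability matrix of the pair (C0, S0) with n block rows. *)
Definition stack_mx : 'M[R]_(n * p, q.+1) :=
  \matrix_(l, c) (C0 *m (S0 ^+ (mxtens_unindex l).1)) (mxtens_unindex l).2 c.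

Lemma stacked_outputE v : stacked_output n S0 C0 v = stack_mx *m v.
Proof.
apply/colP => l; rewrite !mxE; apply: eq_bigr => c _.
by rewrite [stack_mx l c]mxE.
Qed.

Lemma calC_mulE r (M : 'M[R]_(n * p, r)) (n0 : (0 < n)%N) k c :
  (calC R n p *m M) k c = M (mxtens_index (Ordinal n0, k)) c.
Proof.
have calCE i k' : calC R n p k (mxtens_index (i, k')) = ((i == 0 :> nat) && (k == k'))%:R.
  have k2 : (mxtens_unindex (cast_ord (esym (mul1n p)) k)).2 = k.
    by apply: val_inj; rewrite /= modn_small.
  by rewrite /calC castmxE cast_ord_id !mxE k2 mxtens_indexK /= -natrM mulnb.
rewrite mxE sum_mxtens (bigD1 (Ordinal n0)) //= (bigD1 k) //= calCE !eqxx mul1r.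
rewrite big1 ?addr0 => [|k' k'k]; last first.
  by rewrite calCE [k == k']eq_sym (negbTE k'k) andbF mul0r.
rewrite big1 ?addr0 // => i i0; rewrite big1 // => k' _; rewrite calCE.
by rewrite (_ : _ == _ = false) ?mul0r //; apply/negbTE: i0.
Qed.

Lemma calC_stack : (0 < n)%N -> calC R n p *m stack_mx = C0.
Proof.
move=> n0; apply/matrixP => k c.
by rewrite (calC_mulE _ n0) mxE mxtens_indexK expr0 mulmx1.
Qed.

Lemma minpoly_power : n = degree_mxminpoly S0 ->
  S0 ^+ n = - \sum_(j < n) (mxminpoly S0)`_j *: S0 ^+ j.
Proof.
move=> nE; have := mx_root_minpoly S0.
have sz := size_mxminpoly S0; have mon := mxminpoly_monic S0.
rewrite -{1}(coefK (mxminpoly S0)) poly_def sz -nE big_ord_recr /=.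
have -> : (mxminpoly S0)`_n = 1.
  by move/monicP : mon; rewrite lead_coefE sz -nE.
rewrite rmorphD /= scale1r rmorphXn /= horner_mx_X => /eqP.
rewrite addrC addr_eq0 => /eqP ->; congr (- _); rewrite rmorph_sum /=.
by apply: eq_bigr => j _; rewrite linearZ /= rmorphXn /= horner_mx_X.
Qed.

(** Each block row C0 S0^i is shifted to the next, and the minimal polynomial closes the last one.
    Hence [stack_mx] maps the leader state to a solution of the uncoupled zeta equation. *)
Lemma calS_stack : n = degree_mxminpoly S0 ->
  calS p (minpoly_coeffs n S0) *m stack_mx = stack_mx *m S0.
Proof.
move=> nE; apply/matrixP => l c.
case: (mxtens_indexP l) => i k.
have -> : (stack_mx *m S0) (mxtens_index (i, k)) c = (C0 *m S0 ^+ i.+1) k c.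
  rewrite exprSr -mulmxE mulmxA !mxE; apply: eq_bigr => d _.
  by rewrite [stack_mx _ d]mxE mxtens_indexK.
rewrite mxE sum_mxtens.
have -> : \sum_(j < n) \sum_(k' < p)
    calS p (minpoly_coeffs n S0) (mxtens_index (i, k)) (mxtens_index (j, k')) *
    stack_mx (mxtens_index (j, k')) c =
  \sum_(j < n) companion (minpoly_coeffs n S0) i j * (C0 *m S0 ^+ j) k c.
  apply: eq_bigr => j _; rewrite (bigD1 k) //= /calS tensmxE [1%:M k k]mxE eqxx mulr1.
  rewrite [stack_mx _ c]mxE mxtens_indexK big1 ?addr0 // => k' k'k.
  by rewrite tensmxE [1%:M k k']mxE eq_sym (negbTE k'k) mulr0 mul0r.
have [i1n|i1n] := eqVneq i.+1 n; last first.
  have i1n' : (i.+1 < n)%N by rewrite ltn_neqAle i1n ltn_ord.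
  rewrite (bigD1 (Ordinal i1n')) //= mxE (negbTE i1n) eqxx mul1r.
  rewrite big1 ?addr0 // => j ji; rewrite mxE (negbTE i1n).
  rewrite (_ : i.+1 == j = false) ?mul0r // eq_sym.
  by apply/negbTE; apply: contra ji => /eqP ji; apply/eqP/val_inj.
rewrite i1n (minpoly_power nE) mulmxN mulmx_sumr mxE summxE -sumrN.
apply: eq_bigr => j _; rewrite mxE i1n eqxx -scalemxAr scalemxE mulNr.
(* Two index reversals cancel: [rev_ord j] picks the coefficient of degree n - (n - j) = j. *)
congr (- (_ * _)); rewrite mxE /= subnSK // subKn //; exact: ltnW.
Qed.

End LeaderCompanion.

Arguments stack_mx {R q} n {p} S0 C0.

(** * The Laplacian form of the coupling and the nominal dissipation *)

Section Convergence.
Context {R : realType} {q p n N : nat}.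
Variables (S0 : 'M[R]_q.+1) (C0 : 'M[R]_(p, q.+1)) (a : 'M[R]_N.+1).
Local Notation H := (follower_laplacian a).
Local Notation C := (calC R n p).

(** Subtracting the leader value from every node does not change the coupling, and then the leader
    column of the Laplacian drops out. *)
Lemma coupling_laplacian m (x : 'I_N.+1 -> 'cV[R]_m) k :
  a (lift ord0 k) (lift ord0 k) = 0 ->
  coupling a x k = - unpack (H *m pack (fun l => x (lift ord0 l) - x ord0)) k.
Proof.
move=> akk; apply/colP => j; rewrite summxE !mxE.
have -> : \sum_l H k l * pack (fun l => x (lift ord0 l) - x ord0) l j =
    (a (lift ord0 k) ord0 + \sum_l a (lift ord0 k) (lift ord0 l)) *
      (x (lift ord0 k) j 0 - x ord0 j 0)
    - \sum_l a (lift ord0 k) (lift ord0 l) * (x (lift ord0 l) j 0 - x ord0 j 0).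
  rewrite (bigD1 k) //= [X in _ = _ - X](bigD1 k) //= akk mul0r add0r.
  rewrite follower_laplacianE eqxx [pack _ k j]mxE !mxE -sumrN; congr (_ + _).
  apply: eq_bigr => l lk; rewrite follower_laplacianE eq_sym (negbTE lk) !mxE.
  by rewrite mulNr.
rewrite big_ord_recl !mxE mulrDl opprB opprD.
have -> : \sum_(i < N) (a (lift ord0 k) (lift ord0 i) *:
      (x (lift ord0 i) - x (lift ord0 k))) j 0 =
    \sum_l a (lift ord0 k) (lift ord0 l) * (x (lift ord0 l) j 0 - x ord0 j 0)
    - (\sum_l a (lift ord0 k) (lift ord0 l)) * (x (lift ord0 k) j 0 - x ord0 j 0).
  by rewrite mulr_suml -sumrB; apply: eq_bigr => l _; rewrite !mxE; ring.
ring.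
Qed.

Lemma posdef_unit m (P : 'M[R]_m) : (forall x, x != 0 -> 0 < qform P x) -> P \in unitmx.
Proof.
move=> P0; rewrite -unitmx_tr -row_free_unit -kermx_eq0; apply/eqP/row_matrixP => i.
rewrite row0; have : row i (kermx P^T) *m P^T = 0 by rewrite -row_mul mulmx_ker row0.
move: (row i _) => v vP; apply/eqP; apply: contraT => v0.
have : 0 < qform P v^T by apply: P0; rewrite trmx_eq0.
by rewrite /qform trmxK -mulmxA -[P]trmxK -trmx_mul vP trmx0 mulmx0 mxE ltxx.
Qed.

(** Multiplying the Riccati equation by P^-1 on both sides gives the equation for the weight of the
    Lyapunov function. *)
Lemma riccati_inverse m r (C' : 'M[R]_(r, m)) (S P : 'M[R]_m) :
  P^T = P -> P \in unitmx -> riccati C' S P ->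
  S^T *m invmx P + invmx P *m S = C'^T *m C' - invmx P *m invmx P.
Proof.
move=> Ps Pu; rewrite /riccati => ric0; set M := invmx P.
have : M *m (P *m S^T + S *m P - P *m C'^T *m C' *m P + 1%:M) *m M = 0.
  by rewrite ric0 mulmx0 mul0mx.
have MP : M *m P = 1%:M by rewrite mulVmx.
have PM : P *m M = 1%:M by rewrite mulmxV.
rewrite !(mulmxDr, mulmxDl, mulmxN, mulNmx) !mulmxA MP !mul1mx.
rewrite -!(mulmxA _ P M) PM !mulmx1 => h.
apply/eqP; rewrite -subr_eq0 opprB addrA addrAC; apply/eqP.
by rewrite -[RHS]h; apply/matrixP => i j; rewrite !(addmxE, oppmxE); ring.
Qed.

(* Dissipation of V(E) = tr(E^T Q E P^-1) along E' = E S^T - mu H E C^T C P. *)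
Lemma lyapunov_dissipation m r (C' : 'M[R]_(r, m)) (S P : 'M[R]_m) (Q B : 'M[R]_N)
    (E D F : 'M[R]_(N, m)) (mu d : R) (M := invmx P) :
  P^T = P -> P \in unitmx -> riccati C' S P ->
  Q^T = Q -> (forall x, 0 <= qform Q x) ->
  (forall x, qform (Q *m - B) x <= - d * qform Q x) -> 0 < mu -> 1 <= 2 * mu * d ->
  D = E *m S^T - mu *: (B *m E *m (C'^T *m C' *m P)) + F ->
  \tr ((D^T *m Q *m E + E^T *m Q *m D) *m M) <=
    - \tr (E^T *m Q *m E *m (M *m M)) + 2 * \tr (E^T *m Q *m F *m M).
Proof.
move=> Ps Pu ricP Qs Q0 QB mu0 mud DE.
have Ms : M^T = M by rewrite trmx_inv Ps.
have PM : P *m M = 1%:M by rewrite mulmxV.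
have trsym (X : 'M[R]_(N, m)) : \tr (X^T *m Q *m E *m M) = \tr (E^T *m Q *m X *m M).
  by rewrite -mxtrace_tr !trmx_mul !trmxK Qs Ms mxtrace_mulC !mulmxA.
rewrite mulmxDl mxtraceD trsym.
have dbl (x : R) : x + x = 2 * x by ring.
rewrite dbl DE mulmxDr mulmxDl mxtraceD mulmxBr mulmxBl.
have trB (X Y : 'M[R]_m) : \tr (X - Y) = \tr X - \tr Y by rewrite linearB.
rewrite trB mulrDr lerD2r.
set G := E^T *m Q *m E; pose EC := E *m C'^T.
have -> : E^T *m Q *m (E *m S^T) *m M = G *m (S^T *m M) by rewrite /G !mulmxA.
have Gs : G^T = G by rewrite /G !trmx_mul trmxK Qs mulmxA.
have -> : E^T *m Q *m (mu *: (B *m E *m (C'^T *m C' *m P))) *m M =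
    mu *: (E^T *m (Q *m B) *m EC *m C').
  rewrite -scalemxAr -scalemxAl /EC; congr (_ *: _).
  by rewrite !mulmxA -(mulmxA _ P M) PM mulmx1.
(* The Riccati equation leaves tr(EC^T Q EC) with coefficient 1; the coupling subtracts at least 2
   mu d times the same trace. *)
have e1 : 2 * \tr (G *m (S^T *m M)) = \tr (EC^T *m Q *m EC) - \tr (G *m (M *m M)).
  have tT : \tr (G *m (S^T *m M)) = \tr (G *m (M *m S)).
    by rewrite -mxtrace_tr (trmx_mul G) (trmx_mul S^T M) trmxK Gs Ms mxtrace_mulC.
  rewrite -dbl {2}tT -mxtraceD -mulmxDr (riccati_inverse Ps Pu ricP) mulmxBr trB.
  congr (_ - _); rewrite /EC trmx_mul trmxK /G !mulmxA.
  by rewrite mxtrace_mulC !mulmxA.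
have e2 : \tr (E^T *m (Q *m B) *m EC *m C') = \tr (EC^T *m (Q *m B) *m EC).
  by rewrite mxtrace_mulC /EC trmx_mul trmxK !mulmxA.
have h1 : d * \tr (EC^T *m Q *m EC) <= \tr (EC^T *m (Q *m B) *m EC).
  have -> : d * \tr (EC^T *m Q *m EC) = \tr (EC^T *m (d *: Q) *m EC).
    by rewrite -scalemxAr -scalemxAl mxtraceZ.
  apply: le_mxtrace_qform => x; rewrite qformZ -lerN2 -mulNr -qformN -mulmxN.
  exact: QB.
have h0 : 0 <= \tr (EC^T *m Q *m EC).
  by rewrite mxtrace_qform sumr_ge0.
rewrite mulrBr e1 mxtraceZ e2 /M.
move: (\tr (EC^T *m Q *m EC)) (\tr (EC^T *m (Q *m B) *m EC)) h0 h1 => x y x0 xy.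
have h2 : mu * (d * x) <= mu * y by rewrite ler_wpM2l // ltW.
have h3 : 1 * x <= 2 * mu * d * x by rewrite ler_wpM2r.
clear - h2 h3; lra.
Qed.

End Convergence.

(** * Error dynamics of the closed loop and their convergence *)

Section Synchronization.
Context {R : realType} {q p n N : nat}.
Variables (S0 : 'M[R]_q.+1) (C0 : 'M[R]_(p, q.+1)) (E : rel 'I_N.+1) (a : 'M[R]_N.+1).
Variables (mu_a mu_z : R).
Hypotheses (hn : n = degree_mxminpoly S0) (ha : weighted_adjacency E a).
Hypotheses (hE : spanning_tree_from_leader E) (N0 : (0 < N)%N).
Hypotheses (hmua0 : 0 < mu_a) (hmuz0 : 0 < mu_z).
Local Notation H := (follower_laplacian a).
Hypotheses (hmua : max_re S0 * (min_re H)^-1 < mu_a) (hmuz : (min_re H)^-1 < mu_z).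
Local Notation C := (calC R n p).
Local Notation Z := (stack_mx n S0 C0).
Local Notation al0 := (minpoly_coeffs n S0).

Lemma with_leader0 (T : Type) (x0 : T) (x : 'I_N -> T) : with_leader x0 x ord0 = x0.
Proof. by rewrite /with_leader unlift_none. Qed.

Lemma with_leader_lift (T : Type) (x0 : T) (x : 'I_N -> T) k :
  with_leader x0 x (lift ord0 k) = x k.
Proof. by rewrite /with_leader liftK. Qed.

Lemma convergence_rates : exists d g : R,
  [/\ d < min_re H, max_re S0 < g, g < mu_a * d & 1 <= 2 * mu_z * d].
Proof.
have [h0 _] := min_re_gt0 N0 (follower_eigenvalue_gt0 ha hE).
move: hmua hmuz; set h := min_re H in h0 *; set s := max_re S0.
rewrite ltr_pdivrMr // => sh; rewrite -[h^-1]mul1r ltr_pdivrMr // => zh.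
(* The slack e is shared out: g = s + e / 2 stays below mu_a d1 = s + 3 e / 4. Taking d >= h / 2
   gives 2 mu_z d >= mu_z h > 1. *)
pose e := mu_a * h - s; have e0 : 0 < e by rewrite subr_gt0.
pose d1 := h - e / 4 / mu_a.
have d1E : mu_a * d1 = s + 3 / 4 * e.
  by rewrite /d1 /e; field; rewrite gt_eqF.
exists (Num.max d1 (h / 2)), (s + e / 2); split.
- rewrite gt_max; apply/andP; split; last by lra.
  by rewrite /d1 ltrBlDr ltrDl !divr_gt0.
- by rewrite ltrDl divr_gt0.
- apply: (@lt_le_trans _ _ (mu_a * d1)); first by rewrite d1E; lra.
  by rewrite ler_wpM2l ?(ltW hmua0) // le_max lexx.
- apply: (@le_trans _ _ (2 * mu_z * (h / 2))); first by lra.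
  by rewrite ler_wpM2l ?mulr_ge0 ?(ltW hmuz0) // le_max lexx orbT.
Qed.

Variables (v0 : R -> 'cV[R]_q.+1) (alpha : 'I_N -> R -> 'cV[R]_n).
Variable zeta : 'I_N -> R -> 'cV[R]_(n * p).
Hypothesis sol : solution_on S0 C0 a mu_a mu_z +oo%E v0 alpha zeta.

Let akk k : a k k = 0. Proof. by have [] := ha. Qed.

Definition alpha_error t : 'M[R]_(N, n) := pack (fun k => alpha k t - al0).
Definition zeta_error t : 'M[R]_(N, n * p) := pack (fun k => zeta k t - Z *m v0 t).

Lemma alpha_error_ode (t : R) : 0 < t ->
  is_derive t 1 alpha_error ((- mu_a *: H) *m alpha_error t).
Proof.
move=> t0; have [_ sa _] := sol.
have -> : (- mu_a *: H) *m alpha_error t =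
    pack (fun k => mu_a *: coupling a (with_leader al0 (fun l => alpha l t)) k).
  apply: (can_inj (@unpackK _ _ _)); apply/funext => k; rewrite packK.
  rewrite coupling_laplacian // with_leader0.
  have -> : pack (fun l => with_leader al0 (alpha^~ t) (lift ord0 l) - al0) = alpha_error t.
    by congr pack; apply/funext => l; rewrite with_leader_lift.
  by apply/colP => j; rewrite -scalemxAl !mxE mulrN mulNr.
apply: is_derive_pack => k; have [_ /(_ t t0 (ltry _)) dk] := sa k.
by apply: (is_derive_eq (is_deriveB dk (is_derive_cst al0 t 1))); rewrite subr0.
Qed.

(* The part of the error dynamics which is not in the nominal equation
   E' = E S^T - mu H E C^T C P. *)
Definition perturbation t : 'M[R]_(N, n * p) :=
  pack (fun k => (calS p (alpha k t) - calS p al0) *m zeta k t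
    - mu_z *: ((calP p (alpha k t) - calP p al0) *m (C^T *m C) *m
                unpack (H *m zeta_error t) k)).

Lemma coupling_outputs t k :
  coupling a (outputs C0 (v0 t) (fun l => zeta l t)) k =
  - (C *m unpack (H *m zeta_error t) k).
Proof.
have n0 : (0 < n)%N by rewrite hn mxminpoly_nonconstant.
rewrite coupling_laplacian // /outputs with_leader0; congr (- _).
have -> : pack (fun l => with_leader (C0 *m v0 t) (fun k => C *m zeta k t) (lift ord0 l)
    - C0 *m v0 t) = zeta_error t *m C^T.
  apply: (can_inj (@unpackK _ _ _)); apply/funext => l; rewrite packK.
  rewrite with_leader_lift -(calC_stack S0 C0 n0) -mulmxA -mulmxBr.
  apply/colP => j; rewrite !mxE; apply: eq_bigr => i _.
  by rewrite mulrC [C^T i j]mxE [zeta_error t l i]mxE.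
rewrite mulmxA; apply/colP => j; rewrite !mxE; apply: eq_bigr => i _.
by rewrite mulrC [C^T i j]mxE [unpack _ _ _ _]mxE.
Qed.

Lemma zeta_error_ode (t : R) : 0 < t ->
  is_derive t 1 zeta_error
    (zeta_error t *m (calS p al0)^T
     - mu_z *: (H *m zeta_error t *m (C^T *m C *m calP p al0)) + perturbation t).
Proof.
move=> t0; have [[_ /(_ t t0 (ltry _)) dv] _ sz] := sol.
have [[Ps _] _] := calP_spec p al0.
have -> : zeta_error t *m (calS p al0)^T
     - mu_z *: (H *m zeta_error t *m (C^T *m C *m calP p al0)) + perturbation t =
  pack (fun k => calS p (alpha k t) *m zeta k t
        + mu_z *: (calP p (alpha k t) *m C^T
                   *m coupling a (outputs C0 (v0 t) (fun l => zeta l t)) k)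
        - Z *m (S0 *m v0 t)).
  have rowE m r (X : 'M[R]_(N, m)) (Y : 'M[R]_(r, m)) k :
      unpack (X *m Y^T) k = Y *m unpack X k.
    apply/colP => j; rewrite !mxE; apply: eq_bigr => i _.
    by rewrite !mxE mulrC.
  apply: (can_inj (@unpackK _ _ _)); apply/funext => k; rewrite packK.
  set w := unpack (H *m zeta_error t) k.
  have -> : unpack (zeta_error t *m (calS p al0)^T
     - mu_z *: (H *m zeta_error t *m (C^T *m C *m calP p al0)) + perturbation t) k =
     calS p al0 *m (zeta k t - Z *m v0 t)
     - mu_z *: (calP p al0 *m (C^T *m C) *m w)
     + ((calS p (alpha k t) - calS p al0) *m zeta k t
       - mu_z *: ((calP p (alpha k t) - calP p al0) *m (C^T *m C) *m w)).
    have -> : C^T *m C *m calP p al0 = (calP p al0 *m (C^T *m C))^T.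
      by rewrite trmx_mul trmx_mul trmxK Ps.
    have unD (X Y : 'M[R]_(N, n * p)) : unpack (X + Y) k = unpack X k + unpack Y k.
      by apply/colP => j; rewrite !mxE.
    have unZ s (X : 'M[R]_(N, n * p)) : unpack (s *: X) k = s *: unpack X k.
      by apply/colP => j; rewrite !mxE.
    rewrite unD unpackB unZ !rowE /perturbation /zeta_error !packK.
    by rewrite -/(zeta_error t) -/w.
  rewrite coupling_outputs -/w mulmxN scalerN (mulmxA Z) -(calS_stack C0 hn).
  rewrite -(mulmxA _ Z); clearbody w; move: (Z *m v0 t) (zeta k t) => y z; clear Ps.
  move: C w (calS p _) (calS p _) (calP p _) (calP p _) => C' w S1 S2 P1 P2.
  rewrite !(mulmxBl, mulmxBr) scalerBr !mulmxA.
  by apply/matrixP => i j; rewrite !(addmxE, oppmxE); ring.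
apply: is_derive_pack => k; have [_ /(_ t t0 (ltry _)) dk] := sz k.
have dZ : is_derive t 1 (fun s => Z *m v0 s) (Z *m (S0 *m v0 t)).
  have := is_derive_mulmx (is_derive_cst Z t 1) dv.
  by rewrite mul0mx add0r.
exact: is_deriveB.
Qed.

Lemma cvg0_pack m (x : 'I_N -> R -> 'cV[R]_m) k :
  pack (fun l => x l t) @[t --> +oo] --> (0 : 'M[R]_(N, m)) ->
  x k t @[t --> +oo] --> (0 : 'cV[R]_m).
Proof.
move=> h; have := @cvg_unpack _ _ _ _ _ _ _ _ k h.
have -> : unpack (0 : 'M[R]_(N, m)) k = 0 by apply/colP => j; rewrite !mxE.
have -> : (fun t => unpack (pack (fun l => x l t)) k) = x k.
  by apply/funext => t; rewrite packK.
exact.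
Qed.

(** Continuity would not do here: the exponential rate of the alpha error has to carry over to S_i -
    S_0. *)
Lemma calS_diff_le (al be : 'cV[R]_n) : `|calS p al - calS p be| <= `|al - be|.
Proof.
apply/normr_mx_le => // i j; rewrite !mxE -mulrBl.
apply: (@le_trans _ _ (`|al - be| * 1)); last by rewrite mulr1.
rewrite normrM; apply: ler_pM => //; last by case: eqP; rewrite ?normr1 ?normr0.
case: ifP => _; last by rewrite subrr normr0.
have := normr_entry_le (al - be) (rev_ord (mxtens_unindex j).1) 0.
by rewrite !mxE -opprD normrN.
Qed.

Lemma mxtrace_quad_le m k (Q : 'M[R]_m) (M : 'M[R]_k) : exists2 K, 0 <= K &
  forall X Y : 'M[R]_(m, k), `|\tr (X^T *m Q *m Y *m M)| <= K * `|X| * `|Y|.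
Proof.
exists (k%:R * (k%:R * (m%:R * (m%:R * `|Q|) * `|M|))); first by rewrite !mulr_ge0.
move=> X Y; apply: le_trans (normr_mxtrace_le _) _; rewrite -!mulrA ler_wpM2l //.
apply: le_trans (normr_mulmx_le _ _) _; rewrite ler_wpM2l //.
apply: (@le_trans _ _ (m%:R * (m%:R * (`|X| * `|Q|) * `|Y|) * `|M|)).
  rewrite ler_wpM2r // (le_trans (normr_mulmx_le _ _)) // ler_wpM2l // ler_wpM2r //.
  by rewrite (le_trans (normr_mulmx_le _ _)) // normr_trmx.
by rewrite le_eqVlt; apply/orP; left; apply/eqP; ring.
Qed.

(** The state zeta_k is split into its error and Z v0. The error part gives this gain, which
    vanishes as soon as alpha converges; the part with Z v0 gives the offset below, which needs
    decay faster than the growth of the leader. *)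
Definition perturbation_gain t : R :=
  \sum_k ((n * p)%:R * `|calS p (alpha k t) - calS p al0| +
    mu_z * ((n * p)%:R * ((n * p)%:R *
      (`|calP p (alpha k t) - calP p al0| * `|C^T *m C|) * (N%:R * `|H|)))).

Definition perturbation_offset t : R :=
  \sum_k (n * p)%:R * (`|calS p (alpha k t) - calS p al0| * `|Z *m v0 t|).

Lemma perturbation_le t :
  `|perturbation t| <= perturbation_gain t * `|zeta_error t| + perturbation_offset t.
Proof.
rewrite /perturbation_gain /perturbation_offset; set m := (n * p)%N.
have term0 k : 0 <= m%:R * `|calS p (alpha k t) - calS p al0| +
      mu_z * (m%:R * (m%:R * (`|calP p (alpha k t) - calP p al0| * `|C^T *m C|)
        * (N%:R * `|H|))).
  by rewrite addr_ge0 ?mulr_ge0 // ltW.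
have term0' k : 0 <= m%:R * (`|calS p (alpha k t) - calS p al0| * `|Z *m v0 t|).
  by rewrite !mulr_ge0.
apply: normr_pack_le => [|k].
  by rewrite addr_ge0 ?mulr_ge0 ?sumr_ge0.
pose kS := `|calS p (alpha k t) - calS p al0|.
pose kP := `|calP p (alpha k t) - calP p al0|.
have kS0 : 0 <= kS by exact: normr_ge0.
have kP0 : 0 <= kP by exact: normr_ge0.
have le_sum (F : 'I_N -> R) : (forall l, 0 <= F l) -> F k <= \sum_l F l.
  by move=> F0; rewrite (bigD1 k) //= lerDl sumr_ge0.
apply: le_trans (lerD (ler_wpM2r (normr_ge0 _) (le_sum _ term0)) (le_sum _ term0')).
rewrite -/kS -/kP mulrDl addrAC; apply: le_trans (ler_normB _ _) _; apply: lerD.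
  apply: le_trans (normr_mulmx_le _ _) _; rewrite -/kS -mulrA -mulrDr ler_wpM2l //.
  rewrite -mulrDr ler_wpM2l //.
  rewrite -[zeta k t](subrK (Z *m v0 t)) (le_trans (ler_normD _ _)) // lerD2r.
  by have := normr_unpack_le (zeta_error t) k; rewrite packK.
rewrite normrZ (gtr0_norm hmuz0) -!(mulrA mu_z) ler_wpM2l ?(ltW hmuz0) //.
apply: le_trans (normr_mulmx_le _ _) _.
apply: (@le_trans _ _ (m%:R * (m%:R * (kP * `|C^T *m C|) *
    (N%:R * (`|H| * `|zeta_error t|))))); last first.
  by rewrite le_eqVlt; apply/orP; left; apply/eqP; ring.
rewrite ler_wpM2l //; apply: ler_pM => //; first exact: normr_mulmx_le.
exact: le_trans (normr_unpack_le _ _) (normr_mulmx_le _ _).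
Qed.

Lemma synchronization : forall k,
  (alpha k t - al0) @[t --> +oo] --> (0 : 'cV[R]_n) /\
  (zeta k t - Z *m v0 t) @[t --> +oo] --> (0 : 'cV[R]_(n * p)).
Proof.
have [[v0r dv] sa sz] := sol.
have [d [g [dh sg gd zd]]] := convergence_rates.
have [_ Hge] := min_re_gt0 N0 (follower_eigenvalue_gt0 ha hE).
(* One form Q serves for the alpha error and for the zeta error. *)
have [|rL [L [Q0 QH]]] := @lyapunov_of_spectrum _ _ (- H) (- d).
  move=> l /eigenvalue_opp /Hge; have -> : complex.Re (- l) = - complex.Re l by case: l.
  by rewrite lerNr => /le_lt_trans; apply; rewrite ltrN2.
pose Q := L^T *m L; rewrite -/Q in Q0 QH.
have QE : Q = L^T *m L by [].
have Qs : Q^T = Q by rewrite trmx_mul trmxK.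
have Qge x : 0 <= qform Q x by exact: qform_gram_ge0.
clearbody Q.
have QB x : qform (Q *m (- mu_a *: H)) x <= - (mu_a * d) * qform Q x.
  have -> : Q *m (- mu_a *: H) = mu_a *: (Q *m - H).
    by rewrite -scalemxAr mulmxN scalerN scaleNr.
  by rewrite qformZ -mulrN -mulrA ler_wpM2l // ltW.
have Ua : alpha_error t @[t --> 0^'+] --> alpha_error 0.
  apply: cvg_pack => k; apply: cvgB; last exact: cvg_cst.
  by have [] := sa k.
have [Ka Ka0 HKa] := linear_ode_bound Qs Q0 QB Ua alpha_error_ode.
have [rS [LS [S_gt0 SQ]]] := lyapunov_of_spectrum
  (fun l Sl => le_lt_trans (le_max_re (A := S0) (l := l) Sl) sg).
have LSs : (LS^T *m LS)^T = LS^T *m LS by rewrite trmx_mul trmxK.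
have [Kv Kv0 HKv] := linear_ode_bound LSs S_gt0 SQ v0r (fun t t0 => dv t t0 (ltry _)).
have gpos : 0 < mu_a * d - g by rewrite subr_gt0.
have dpos : 0 < mu_a * d.
  rewrite mulr_gt0 // ltNge; apply/negP => d0.
  move: zd; rewrite leNgt => /negP; apply; apply: le_lt_trans ltr01.
  by rewrite mulr_ge0_le0 // mulr_ge0 // ltW.
have aE0 : `|alpha_error t| @[t --> +oo] --> (0 : R).
  apply: (@cvg0_of_sqr_le _ _ Ka (2 * (mu_a * d))) => //; first by rewrite mulr_gt0.
  by move=> t t0; apply: le_trans (HKa t t0) _; rewrite mulrN.
have a0 : alpha_error t @[t --> +oo] --> (0 : 'M[R]_(N, n)).
  by apply/norm_cvg0P.
have ak k : (alpha k t - al0) @[t --> +oo] --> (0 : 'cV[R]_n).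
  exact: (@cvg0_pack _ (fun k t => alpha k t - al0)).
have ak' k : alpha k t @[t --> +oo] --> al0.
  have : (alpha k t - al0 + al0) @[t --> +oo] --> 0 + al0.
    by apply: cvgD; [exact: ak|exact: cvg_cst].
  by rewrite add0r; under eq_fun do rewrite subrK.
have [[Ps Pp] ricP] := calP_spec p al0.
set P0 := calP p al0 in Ps Pp ricP.
have Pu : P0 \in unitmx by exact: posdef_unit.
pose M := invmx P0.
have Ms : M^T = M by rewrite trmx_inv Ps.
have MP : M *m P0 = 1%:M by rewrite mulVmx.
have PM : P0 *m M = 1%:M by rewrite mulmxV.
have M_gt0 x : x != 0 -> 0 < qform M x.
  move=> x0; have -> : qform M x = qform P0 (M *m x).
    by rewrite -qform_congr Ms MP mul1mx.
  apply: Pp; apply: contra_neq x0 => Mx.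
  by rewrite -(mul1mx x) -PM -mulmxA Mx mulmx0.
pose V (X : 'M[R]_(N, n * p)) := \tr (X^T *m Q *m X *m M).
have V_gt0 X : X != 0 -> 0 < V X.
  (* The Gram factor L of Q turns V into the form of M evaluated on the columns of (L X)^T; L X = 0
     would annihilate the positive form of Q. *)
  move=> X0; have -> : V X = \tr (((L *m X)^T)^T *m M *m (L *m X)^T).
    by rewrite /V QE trmxK [RHS]mxtrace_mulC trmx_mul !mulmxA.
  apply: mxtrace_qform_gt0 => //; apply: contraTneq (mxtrace_qform_gt0 Q0 X0).
  move=> /(congr1 trmx); rewrite trmxK trmx0 => LX.
  by rewrite QE -!mulmxA LX !mulmx0 mxtrace0 ltxx.
have W_gt0 (X : 'M[R]_(N, n * p)) : X != 0 -> 0 < \tr (X^T *m Q *m X *m (M *m M)).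
  move=> X0; have -> : \tr (X^T *m Q *m X *m (M *m M)) =
      \tr ((X *m M)^T *m Q *m (X *m M)).
    by rewrite trmx_mul Ms !mulmxA [LHS]mxtrace_mulC !mulmxA.
  apply: mxtrace_qform_gt0 => //; apply: contra_neq X0 => XM.
  by rewrite -(mulmx1 X) -MP mulmxA XM mul0mx.
have [c3 c30 Hc3] := coercive (@continuous_mxtrace_quad _ _ _ Q M)
  (fun s X => mxtrace_quad_scale Q M s X) V_gt0.
have [c1 c10 Hc1] := coercive (@continuous_mxtrace_quad _ _ _ Q (M *m M))
  (fun s X => mxtrace_quad_scale Q (M *m M) s X) W_gt0.
have [K K0 HK] := mxtrace_quad_le Q M.
have h0 : perturbation_gain t @[t --> +oo] --> (0 : R).
  have -> : (0 : R) = \sum_(k < N) ((n * p)%:R * 0 +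
      mu_z * ((n * p)%:R * ((n * p)%:R * (0 * `|C^T *m C|) * (N%:R * `|H|)))).
    by rewrite big1 // => k _; rewrite mul0r !(mulr0, mul0r) addr0.
  have cc (r : R) : r @[_ --> +oo] --> r by exact: cvg_cst.
  apply: cvg_sum_fin => k; apply: cvgD.
    apply: cvgM => //; apply/norm_cvg0P; rewrite -(subrr (calS p al0)).
    by apply: cvgB; [exact: cvg_calS|exact: cvg_cst].
  apply: cvgM => //; apply: cvgM => //; apply: cvgM => //; apply: cvgM => //.
  apply: cvgM => //; apply/norm_cvg0P; rewrite -(subrr (calP p al0)).
  by apply: cvgB; [exact: cvg_calP|exact: cvg_cst].
have f0 : perturbation_offset t @[t --> +oo] --> (0 : R).
  have -> : (0 : R) = \sum_(k < N) (n * p)%:R * 0 by rewrite big1 // => k _; rewrite mulr0.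
  apply: cvg_sum_fin => k; apply: cvgM; first exact: cvg_cst.
  pose B := q.+1%:R * `|Z|.
  apply: (@cvg0_of_sqr_le _ _ (Ka * (B ^+ 2 * Kv)) (2 * (mu_a * d - g))) => //.
    by rewrite mulr_gt0.
  move=> t t0; rewrite exprMn.
  (* The squared alpha error decays at rate 2 mu_a d and the squared leader state grows at rate at
     most 2 g, which is smaller. *)
  have -> : - (2 * (mu_a * d - g)) * t = 2 * - (mu_a * d) * t + 2 * g * t by ring.
  rewrite expRD [leRHS]mulrACA; apply: ler_pM; rewrite ?sqr_ge0 //.
    apply: le_trans (HKa t t0); rewrite ler_pXn2r ?nnegrE //.
    apply: le_trans (calS_diff_le _ _) _.
    by have := normr_unpack_le (alpha_error t) k; rewrite packK.
  rewrite -[leRHS]mulrA; apply: (@le_trans _ _ (B ^+ 2 * `|v0 t| ^+ 2)).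
    rewrite -exprMn ler_pXn2r ?nnegrE ?mulr_ge0 //.
    by rewrite /B -mulrA normr_mulmx_le.
  by rewrite ler_wpM2l ?sqr_ge0 // HKv.
have E0 : zeta_error t @[t --> +oo] --> (0 : 'M[R]_(N, n * p)).
  pose D t := zeta_error t *m (calS p al0)^T
     - mu_z *: (H *m zeta_error t *m (C^T *m C *m P0)) + perturbation t.
  apply: (@perturbed_stability _ _ _ zeta_error (fun t => V (zeta_error t))
    (fun t => \tr (((D t)^T *m Q *m zeta_error t + (zeta_error t)^T *m Q *m D t) *m M))
    perturbation_gain perturbation_offset c1 (K + 1) c3 (2 * K)) => //.
  - by rewrite ltr_wpDl.
  - move=> t t0; have dE := zeta_error_ode t0.
    apply: is_derive_mxtrace.
    have dQ := is_derive_mulmx (is_derive_trmx dE) (is_derive_cst Q t 1).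
    rewrite mulmx0 addr0 in dQ.
    have := is_derive_mulmx (is_derive_mulmx dQ dE) (is_derive_cst M t 1).
    by rewrite mulmx0 addr0.
  - move=> t; apply: le_trans (ler_norm _) _; apply: le_trans (HK _ _) _.
    by rewrite -mulrA -expr2 ler_wpM2r ?sqr_ge0 // lerDl.
  - move=> t t0.
    have := lyapunov_dissipation Ps Pu ricP Qs Qge QH hmuz0 zd (erefl (D t)).
    move=> /le_trans; apply; apply: lerD; first by rewrite mulNr lerN2.
    rewrite -!mulrA ler_wpM2l //; apply: le_trans (ler_norm _) _.
    apply: le_trans (HK _ _) _; rewrite -mulrA ler_wpM2l // ler_wpM2l //.
    exact: perturbation_le.
by move=> k; split => //; exact: (@cvg0_pack _ (fun k t => zeta k t - Z *m v0 t)).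
Qed.

End Synchronization.

Theorem theorem3p1 (R : realType) (q p n N : nat)
    (S0 : 'M[R]_q.+1) (C0 : 'M[R]_(p, q.+1))
    (E : rel 'I_N.+1) (a : 'M[R]_N.+1) (mu_a mu_z : R)
    (hn : n = degree_mxminpoly S0)
    (ha : weighted_adjacency E a)
    (hE : spanning_tree_from_leader E)
    (hmua0 : 0 < mu_a) (hmuz0 : 0 < mu_z)
    (hmua : max_re S0 * (min_re (follower_laplacian a))^-1 < mu_a)
    (hmuz : (min_re (follower_laplacian a))^-1 < mu_z)
    (v00 : 'cV[R]_q.+1) (alpha00 : 'I_N -> 'cV[R]_n)
    (zeta00 : 'I_N -> 'cV[R]_(n * p)) :
  let alpha0 := minpoly_coeffs n S0 in
  let ivp T := ivp_solution_on S0 C0 a mu_a mu_z T v00 alpha00 zeta00 in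
  (* a solution exists on [0, +oo[ *)
  (exists v0 alpha zeta, ivp +oo%E v0 alpha zeta) /\
  (* every solution on some [0, T[ extends to [0, +oo[ *)
  (forall (T : R) v0 alpha zeta, 0 < T -> ivp T%:E v0 alpha zeta ->
    exists v0' alpha' zeta', ivp +oo%E v0' alpha' zeta' /\
      forall t, 0 <= t < T ->
        [/\ v0' t = v0 t,
            forall k, alpha' k t = alpha k t
          & forall k, zeta' k t = zeta k t]) /\
  (* every solution on [0, +oo[ synchronizes with the leader *)
  (forall v0 alpha zeta, ivp +oo%E v0 alpha zeta -> forall k : 'I_N,
    [/\ (alpha k t - alpha0) @[t --> +oo] --> (0 : 'cV[R]_n),
        (calS p (alpha k t) - calS p alpha0) @[t --> +oo]
          --> (0 : 'M[R]_(n * p)),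
        (calP p (alpha k t) - calP p alpha0) @[t --> +oo]
          --> (0 : 'M[R]_(n * p)),
        (zeta k t - stacked_output n S0 C0 (v0 t)) @[t --> +oo]
          --> (0 : 'cV[R]_(n * p))
      & (calC R n p *m zeta k t - C0 *m v0 t) @[t --> +oo]
          --> (0 : 'cV[R]_p)]).
Proof.
move=> alpha0 ivp; split; [|split].
- have [v0 [alpha [zeta [sol _ _]]]] :=
    closed_loop_exists S0 C0 a mu_a mu_z v00 alpha00 zeta00.
  by exists v0, alpha, zeta.
- move=> T v0 alpha zeta T0 sol.
  have [v0' [alpha' [zeta' [sol' _ calpha']]]] :=
    closed_loop_exists S0 C0 a mu_a mu_z v00 alpha00 zeta00.
  exists v0', alpha', zeta'; split => // t /andP[t0 tT].
  by apply: (closed_loop_unique sol sol' calpha'); rewrite ?lte_fin.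
- move=> v0 alpha zeta [sol _ _ _] k.
  (* A follower k is given, so the spectrum of H is nonempty and [min_re] is a minimum. *)
  have N0 : (0 < N)%N by apply: leq_ltn_trans (ltn_ord k).
  have [ak zk] := synchronization hn ha hE N0 hmua0 hmuz0 hmua hmuz sol k.
  have {}ak' : alpha k t @[t --> +oo] --> alpha0.
    have : (alpha k t - alpha0 + alpha0) @[t --> +oo] --> 0 + alpha0.
      by apply: cvgD; [exact: ak|exact: cvg_cst].
    by rewrite add0r; under eq_fun do rewrite subrK.
  have n0 : (0 < n)%N by rewrite hn mxminpoly_nonconstant.
  have zE : (fun t => zeta k t - stacked_output n S0 C0 (v0 t)) =
      (fun t => zeta k t - stack_mx n S0 C0 *m v0 t).
    by apply/funext => t; rewrite stacked_outputE.
  split => //.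
  + rewrite -(subrr (calS p alpha0)).
    by apply: cvgB; [exact: cvg_calS|exact: cvg_cst].
  + rewrite -(subrr (calP p alpha0)).
    by apply: cvgB; [exact: cvg_calP|exact: cvg_cst].
  + by rewrite zE.
  + have -> : (fun t => calC R n p *m zeta k t - C0 *m v0 t) =
        (fun t => calC R n p *m (zeta k t - stack_mx n S0 C0 *m v0 t)).
      by apply/funext => t; rewrite mulmxBr mulmxA calC_stack.
    rewrite -(mulmx0 _ (calC R n p)).
    by apply: cvg_mulmx; [exact: cvg_cst|exact: zk].
Qed.
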